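(* Let $d\ge 1$, let $\mathscr{K}$ be a compact subset of $\mathscr{P}_d$ and let $f\in\mathsf{H}^2_d$. Let the sequences $(P_n)_{n\ge 0}$ in $\mathscr{K}$ and $(f_n)_{n\ge 0}$, $(U_n)_{n\ge 0}$, $(B_n)_{n\ge 0}$ be produced by the following procedure: $f_0=f$, $B_0=1$ and, for each $n\ge 0$, $$P_n\in\operatorname{argmin}\left\{\left\|\mathrm{proj}\left(f_n,\tfrac{P^*}{P}\mathsf{H}^2_d\right)\right\| : P\in\mathscr{K}\right\},$$ $$U_n=\mathrm{proj}\left(f_n,\left(\tfrac{P_n^*}{P_n}\mathsf{H}^2_d\right)^{\perp}\right),\qquad f_{n+1}=\frac{P_n}{P_n^*}\,(f_n-U_n),\qquad B_{n+1}=B_n\,\frac{P_n^*}{P_n}.$$ Then the terms $U_nB_n$ $(n\ge 0)$ are mutually orthogonal, $\bigcap_{n\ge 0} B_n\mathsf{H}^2_d=\{0\}$, and $$f=\sum_{n\ge 0}U_nB_n ,$$ with convergence in $\mathsf{H}^2_d$.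
   Context: $\mathbb{D}=\{z\in\mathbb{C}: |z|<1\}$, and $\partial^*\mathbb{D}^d=\{z\in\mathbb{C}^d: |z_1|=\dots=|z_d|=1\}$ is the distinguished boundary of the polydisk $\mathbb{D}^d$. $\mathsf{H}^2_d=\mathsf{H}^2(\mathbb{D}^d)$ is the Hardy space of the polydisk, with inner product $\langle f,g\rangle=(2\pi)^{-d}\int_{\partial^*\mathbb{D}^d} f(e^{i\theta_1},\dots,e^{i\theta_d})\overline{g(e^{i\theta_1},\dots,e^{i\theta_d})}\,d\theta_1\cdots d\theta_d$ (boundary values) and norm $\|f\|=\sqrt{\langle f,f\rangle}$. For a closed subspace $V\subset\mathsf{H}^2_d$, $V^\perp$ is its orthogonal complement in $\mathsf{H}^2_d$ and $\mathrm{proj}(f,V)$ is the orthogonal projection of $f$ on $V$. For a nonzero polynomial $P\in\mathbb{C}[z_1,\dots,z_d]$, let $\mathrm{d}^\circ P=(m_1,\dots,m_d)$, where $m_i$ is the degree of $P$ with respect to $z_i$; let $\overline{P}$ be the polynomial obtained from $P$ by replacing each coefficient by its complex conjugate; and let $P^*(z)=z_1^{m_1}\cdots z_d^{m_d}\,\overline{P}(z_1^{-1},\dots,z_d^{-1})$. The set $\mathscr{P}_d$ consists of the non-constant polynomials $P\in\mathbb{C}[z_1,\dots,z_d]$ that have no zeros in $\mathbb{D}^d\cup\partial^*\mathbb{D}^d$ and have no (non-constant) common factor with $P^*$. For $P\in\mathscr{P}_d$ the function $P^*/P$ is inner, so $\frac{P^*}{P}\mathsf{H}^2_d$ is a closed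 subspace of $\mathsf{H}^2_d$. A subset $\mathscr{K}\subset\mathscr{P}_d$ is compact if its elements have uniformly bounded degrees and it is compact in the corresponding finite-dimensional space of polynomials (coefficientwise topology). *)

(* Defs.v *)
From HB Require Import structures.
From mathcomp Require Import all_boot all_order all_algebra.
From mathcomp Require Import complex.
From mathcomp Require mpoly.

Set Implicit Arguments.
Unset Strict Implicit.
Unset Printing Implicit Defensive.

Import Order.TTheory GRing.Theory Num.Theory.
Local Open Scope ring_scope.

(* mpoly is imported only inside this module: its notations clash with those of
   MathComp-Analysis. *)
Module Polynomials.
Import mpoly.

Section Polynomials.
Variables (C : numClosedFieldType) (d : nat).
Implicit Types P Q : {mpoly C[d]}.

Definition nonconstant P : Prop := forall c : C, P <> c%:MP.

Definition common_factor Q P1 P2 : Prop :=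
  exists A1 A2, P1 = Q * A1 /\ P2 = Q * A2.

Definition multidegree P : 'X_{1..d} :=
  [multinom (\max_(m <- msupp P) m i)%N | i < d].

Definition conj_mpoly P : {mpoly C[d]} := map_mpoly Num.conj P.

(* The polynomial P^*; see reversed_mpolyE. The truncated subtraction of
   exponents never truncates, since m <= multidegree P. *)
Definition reversed_mpoly P : {mpoly C[d]} :=
  \sum_(m <- msupp (conj_mpoly P))
     (conj_mpoly P)@_m *: 'X_[(multidegree P - m)%MM].

Lemma reversed_mpolyE P (z : 'I_d -> C) : (forall i, z i != 0) ->
  (reversed_mpoly P).@[z] =
  (\prod_(i < d) z i ^+ multidegree P i) *
  (conj_mpoly P).@[fun i => (z i)^-1].
Proof.
move=> z0; rewrite /reversed_mpoly raddf_sum /= mevalE mulr_sumr.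
apply: eq_big_seq => m.
rewrite (perm_mem (msupp_map_mpoly _ (fmorph_inj (@Num.conj C)))) => mP.
rewrite mevalZ mevalX mulrCA -big_split /=; congr (_ * _).
apply: eq_bigr => i _; rewrite mnmBE exprVn -expfB_cond //.
by rewrite (negbTE (z0 i)) add0n mnmE (big_rem m mP) /= leq_maxl.
Qed.

Definition degree_lt N P : Prop := (msize P <= N)%N.

Definition coefficients N P : 'X_{1..d < N} -> C := fun m => P@_m.

End Polynomials.
End Polynomials.
Export Polynomials.


From mathcomp Require Import all_classical all_reals all_analysis.
Import numFieldNormedType.Exports.
Local Open Scope classical_set_scope.

Section Polydisk.
Variables (R : realType) (d : nat).

(* The topology of the complex numbers is found on R[i]^o. *)
Local Notation point := 'rV[R[i]^o]_d.

Definition polydisk : set point := [set z | forall j, `|z ord0 j| < 1].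

Definition distinguished_boundary : set point :=
  [set z | forall j, `|z ord0 j| = 1].

Definition expi (t : R) : R[i] := (cos t +i* sin t)%C.

Definition radial_point (r : R) (t : d.-tuple R) : point :=
  \row_(j < d) ((r%:C)%C * expi (tnth t j)).

End Polydisk.

Section Integral.
Variable R : realType.

(* The iterated Lebesgue integral over [0, 2 pi]^d. *)
Fixpoint torus_integral (d : nat) : (d.-tuple R -> R) -> R :=
  match d with
  | 0 => fun F => F [tuple]
  | d'.+1 => fun F =>
      \int[lebesgue_measure]_(t in `[0, 2 * pi])
        torus_integral (fun s : d'.-tuple R => F [tuple of t :: s])
  end.

Definition torus_mean (d : nat) (F : d.-tuple R -> R) : R :=
  (2 * pi) ^- d * torus_integral F.

Definition torus_cmean (d : nat) (F : d.-tuple R -> R[i]) : R[i] :=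
  (torus_mean (fun t => complex.Re (F t)) +i*
   torus_mean (fun t => complex.Im (F t)))%C.

End Integral.

Section Hardy.
Variables (R : realType) (d : nat).

Local Notation point := 'rV[R[i]^o]_d.
Local Notation function := (point -> R[i]^o).
Local Notation cpoly := (mpoly.mpoly d R[i]).

(* A function on the polydisk is represented by its extension by 0 to C^d, so
   that equality of functions on the polydisk is Leibniz equality. *)
Definition hardy : set function := [set f : function |
  [/\ forall z : point, ~ polydisk z -> f z = 0,
      forall z : point, polydisk z -> differentiable f z &
      exists M : R, forall r : R, 0 <= r < 1 ->
        torus_mean (fun t : d.-tuple R =>
          complex.Re (`|f (radial_point r t)| ^+ 2)) <= M]].

(* Radial limit at the point (e^{i t_1}, ..., e^{i t_d}), which exists for
   almost every t when f is in the Hardy space. *)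
Definition boundary_value (f : function) (t : d.-tuple R) : R[i] :=
  lim (f (radial_point r t) @[r --> (1 : R)^'-]).

Definition inner (f g : function) : R[i] :=
  torus_cmean (fun t => boundary_value f t * (boundary_value g t)^* ).

Definition hnorm (f : function) : R := Num.sqrt (complex.Re (inner f f)).

Definition orthogonal_complement (V : set function) : set function :=
  [set g | hardy g /\ forall h, V h -> inner g h = 0].

(* g is the orthogonal projection of f on V; such a g is unique. *)
Definition is_projection (V : set function) (f g : function) : Prop :=
  V g /\ orthogonal_complement V (f \- g).

Definition hardy_multiples (phi : function) : set function :=
  [set phi \* h | h in hardy].

(* g / phi as an element of the Hardy space: the pointwise quotient has
   removable singularities at the zeros of phi in the polydisk. *)
Definition is_hardy_quotient (g phi h : function) : Prop :=
  hardy h /\ g = phi \* h.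

Definition meval_row (P : cpoly) (z : point) : R[i] :=
  mpoly.meval (z ord0) P.

Definition rational_inner (P : cpoly) : function :=
  fun z => meval_row (reversed_mpoly P) z / meval_row P z.

Definition admissible : set cpoly := [set P |
  [/\ nonconstant P,
      forall z, polydisk z \/ distinguished_boundary z -> meval_row P z != 0 &
      forall Q, common_factor Q P (reversed_mpoly P) -> ~ nonconstant Q]].

Definition compact_family (K : set cpoly) : Prop :=
  exists N : nat, (forall P, K P -> degree_lt N P) /\
    compact ([set (coefficients P : {ptws mpoly.bmultinom d N -> R[i]^o})
             | P in K]).

(* P minimizes the norm of the projection of f on (P^*/P) H^2 over K. *)
Definition argmin_projection (K : set cpoly) (f : function)
    (P : cpoly) : Prop :=
  K P /\ exists2 g, is_projection (hardy_multiples (rational_inner P)) f g &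
    forall Q h, K Q -> is_projection (hardy_multiples (rational_inner Q)) f h ->
      hnorm g <= hnorm h.

End Hardy.

(* Main.v *)
Require Import Defs.
From HB Require Import structures.
From mathcomp Require Import all_boot all_order all_algebra.
From mathcomp Require Import complex.
From mathcomp Require mpoly.
From mathcomp Require Import ring lra.
Import Order.TTheory GRing.Theory Num.Theory.
Local Open Scope ring_scope.

Set Implicit Arguments.
Unset Strict Implicit.
Unset Printing Implicit Defensive.

(** Write phi_n = P_n^*/P_n and g_n = B_n f_n. The recursion gives
    f_n - U_n = phi_n f_{n+1}, hence g_{n+1} = g_n - U_n B_n, and g_n is the
    remainder of f after n terms. All the functions phi_n are inner, so that
    multiplication by B_n is isometric (inner_mull). Since U_n is orthogonal to
    the multiples of phi_n, the term U_n B_n is orthogonal to the multiples of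
    B_{n+1}, in particular to all later terms and to g_{n+1}
    (terms_orthogonal). Therefore Re <f, g_n> = |g_n|^2, and the series
    converges to f if g_n tends weakly to 0.

    Weak convergence to 0 comes from the interior of the polydisk. If P has no
    zero on the closed polydisk then |P^*| < |P| inside: on a complex line
    through the torus, passing from P to P^* replaces the factors l - a, with
    |a| > 1, by the smaller 1 - conj(a) l (normC_reversed_lt). On a compact
    family the quotient is bounded at each such point by a constant c < 1
    (compact_uniform_bound), so B_n is at most c^n there. Now
    <f, g_n> is close to <f_s, g_n>, where f_s(z) = f(sz), uniformly in n if s
    is close to 1, and <f_s, g_n> = <f, (g_n)_s> tends to 0 by dominated
    convergence, because (g_n)_s has the small factor (B_n)_s and the norms of
    the f_n are bounded (inner_weak_null). The same lemma shows that a function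
    h in all the spaces B_n H^2 has <h, h> = 0.

    This relies on the theory of boundary values in the Hardy space of the
    polydisk: the radial limits r -> 1 exist almost everywhere, they are limits
    in the mean square, dilation is symmetric for the pairing, and functions of
    norm 0 vanish. The point is that the radial approach only involves the
    one-parameter flow which rotates all coordinates by the same angle. On an
    orbit of it the real part of f is a harmonic function on a disc, so that
    f(r s .) is obtained from f(s .) by averaging over the flow with the
    Poisson kernel of radius r. These averages are self-adjoint contractions of
    L^2 of the torus which form a semigroup in r; the energies of f(r .)
    therefore increase with r and control the distances in the mean square
    (energy_dist). Almost everywhere convergence needs a maximal inequality in
    L^2 (finite_maximal_bound), which is obtained by a TT-star argument from
    the inequality P_{rs} <= 8 (P_r + P_s) between Poisson kernels. The Poisson
    formula on a disc is deduced from Goursat's theorem on rectangles, in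
    logarithmic polar coordinates (mean_value, poisson_formula_disc). *)

(** * The reversed polynomial along a complex line *)

Module ReversedPolynomial.
Import mpoly.

(** Exponents of the monomials of degree less than N; the coefficient vectors
    of these polynomials carry the topology of a compact family. *)
Definition bounded_index (d N : nat) : finType := 'X_{1..d < N}.

Section evaluation.
Context {C : numClosedFieldType} {d : nat}.
Implicit Types (P Q : {mpoly C[d]}) (z w : 'I_d -> C).

Lemma meval_bounded N P z : degree_lt N P ->
  P.@[z] = \sum_(m : 'X_{1..d < N}) P@_m * \prod_i z i ^+ m i.
Proof.
move=> PN; rewrite {1}(mpolywE PN) raddf_sum /=; apply: eq_bigr => m _.
by rewrite mevalZ mevalX.
Qed.

Lemma conj_mpolyE P z : (conj_mpoly P).@[z] = (P.@[fun i => (z i)^*])^*.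
Proof.
have PN : degree_lt (msize P) P by rewrite /degree_lt.
rewrite /conj_mpoly (map_mpolyE _ PN) raddf_sum /= (meval_bounded _ PN) rmorph_sum /=.
apply: eq_bigr => m _; rewrite mevalZ mevalX rmorphM /= rmorph_prod /=.
by congr (_ * _); apply: eq_bigr => i _; rewrite rmorphXn /= conjCK.
Qed.

(** Both factors come from reversed_mpolyE; the second one is P at the
    reflection of z in the torus, up to conjugation. *)
Lemma normC_reversed P z : (forall i, z i != 0) ->
  `|(reversed_mpoly P).@[z]| =
  (\prod_i `|z i| ^+ multidegree P i) * `|P.@[fun i => ((z i)^*)^-1]|.
Proof.
move=> z0; rewrite reversed_mpolyE // normrM normr_prod; congr (_ * _).
  by apply: eq_bigr => i _; rewrite normrX.
rewrite conj_mpolyE norm_conjC; congr `|_|; apply: meval_eq => i.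
by rewrite fmorphV.
Qed.

Lemma multidegree_le P Q i : (forall m, m \in msupp P -> Q@_m != 0) ->
  (multidegree P i <= multidegree Q i)%N.
Proof.
move=> PQ; rewrite !mnmE; apply/bigmax_leqP_seq => m mP _.
have mQ : m \in msupp Q by rewrite mcoeff_msupp; exact: PQ.
by rewrite (big_rem m mQ) /= leq_maxl.
Qed.

Lemma multidegree_gt0 P : nonconstant P -> (0 < \sum_i multidegree P i)%N.
Proof.
move=> nP; rewrite lt0n; apply/negP; rewrite sum_nat_eq0 => /forallP H.
apply: (nP P@_0%MM); apply/mpolyP => m; rewrite mcoeffC.
have [->|m0] := eqVneq m 0%MM; first by rewrite mulr1.
rewrite mulr0; apply/eqP; rewrite -[_ == _]negbK -mcoeff_msupp; apply/negP => mP.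
case/eqP: m0; apply/mnmP => i; rewrite mnm0E; apply/eqP; rewrite -leqn0.
have /eqP <- := H i; rewrite mnmE (big_rem m mP) /=; exact: leq_maxl.
Qed.

(** Evaluation extended to arbitrary coefficient vectors, on which it is
    linear; continuity in P is expressed through it. *)
Definition eval_coef N (x : 'X_{1..d < N} -> C) z : C := \sum_m x m * \prod_i z i ^+ (m : 'X_{1..d}) i.

Lemma meval_coef N P z : degree_lt N P -> P.@[z] = eval_coef (@coefficients C d N P) z.
Proof. exact: meval_bounded. Qed.

(** Near P the multidegree can only grow, because the monomials of P persist,
    and since |z_i| < 1 this only decreases the monomial factor. The bound
    depends continuously on the coefficients of Q, whereas Q |->
    reversed_mpoly Q is not continuous at a drop of the multidegree. *)
Lemma normC_reversed_le N P Q z : degree_lt N P -> degree_lt N Q ->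
  (forall i, 0 < `|z i| < 1) ->
  (forall m : 'X_{1..d < N}, coefficients P m != 0 -> coefficients Q m != 0) ->
  `|(reversed_mpoly Q).@[z]| <= (\prod_i `|z i| ^+ multidegree P i) *
     `|eval_coef (@coefficients C d N Q) (fun i => ((z i)^*)^-1)|.
Proof.
move=> PN QN z01 PQ; have z0 i : z i != 0 by have /andP[] := z01 i; rewrite normr_gt0.
rewrite normC_reversed // -(meval_coef _ QN) ler_wpM2r //; apply: ler_prod => i _.
rewrite exprn_ge0 //=; have /andP[_ z1] := z01 i.
apply: ler_wiXn2l => //; first exact: ltW.
apply: multidegree_le => m mP; have mN : (mdeg m < N)%N.
  exact: leq_trans (msize_mdeg_lt mP) PN.
by move: mP; rewrite mcoeff_msupp; exact: (PQ (BMultinom mN)).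
Qed.

End evaluation.

Section slice.
Context {C : numClosedFieldType} {d : nat} (P : {mpoly C[d]}) (w : 'I_d -> C).
Hypothesis w1 : forall i, `|w i| = 1.
Hypothesis P_nz : forall z, (forall i, `|z i| < 1) \/ (forall i, `|z i| = 1) -> P.@[z] != 0.

(** The polynomial P restricted to the complex line through a point w of the
    torus. *)
Definition slice_poly : {poly C} :=
  \sum_(m <- msupp P) (P@_m * \prod_i w i ^+ m i) *: 'X^(mdeg m).

Lemma horner_slice l : slice_poly.[l] = P.@[fun i => l * w i].
Proof.
rewrite /slice_poly horner_sum mevalE; apply: eq_bigr => m _.
rewrite hornerZ hornerXn -mulrA; congr (_ * _).
rewrite [RHS](eq_bigr (fun i => l ^+ m i * w i ^+ m i)) => [|i _]; last by rewrite exprMn.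
by rewrite big_split /= prodrXr mulrC mdegE.
Qed.

Lemma size_slice : (size slice_poly <= (\sum_i multidegree P i).+1)%N.
Proof.
rewrite /slice_poly big_seq; apply: leq_trans (size_sum _ _ _) _.
apply/bigmax_leqP_seq => m mP _; apply: leq_trans (size_scale_leq _ _) _.
rewrite size_polyXn ltnS mdegE; apply: leq_sum => i _.
by rewrite mnmE (big_rem m mP) /= leq_maxl.
Qed.

Lemma slice_nz l : `|l| <= 1 -> slice_poly.[l] != 0.
Proof.
move=> l1; rewrite horner_slice; apply: P_nz.
have [l1e|l1'] := eqVneq `|l| 1; last first.
  by left => i; rewrite normrM w1 mulr1 lt_neqAle l1'.
by right => i; rewrite normrM w1 mulr1.
Qed.

(** On the line through w, reflection in the torus is l |-> 1 / conj(l). *)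
Lemma normC_reversed_slice l : l != 0 ->
  `|(reversed_mpoly P).@[fun i => l * w i]| =
  `|l| ^+ (\sum_i multidegree P i) * `|slice_poly.[(l^*)^-1]|.
Proof.
move=> l0; have w0 i : w i != 0 by rewrite -normr_eq0 w1 oner_eq0.
rewrite normC_reversed => [|i]; last by rewrite mulf_neq0.
congr (_ * _).
  by rewrite -prodrXr; apply: eq_bigr => i _; rewrite normrM w1 mulr1.
rewrite horner_slice; congr `|_|; apply: meval_eq => i.
rewrite rmorphM /= invfM; congr (_ * _).
by apply: (mulfI (x := (w i)^*)); rewrite ?conjC_eq0 // mulfV ?conjC_eq0 // mulrC -normCK w1 expr1n.
Qed.

(** The difference of the squares is (1 - |l|^2) (|a|^2 - 1). *)
Lemma blaschke_factor (l a : C) : `|l| < 1 -> 1 < `|a| -> `|1 - l^* * a| < `|l - a|.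
Proof.
move=> l1 a1; rewrite -ltr_sqr ?nnegrE // !normCK -subr_gt0.
rewrite [X in 0 < X](_ : _ = (1 - `|l| ^+ 2) * (`|a| ^+ 2 - 1)); last first.
  by rewrite !normCK !rmorphB !rmorphM /= conjCK rmorph1; ring.
by rewrite mulr_gt0 // subr_gt0 ?expr_lt1 ?exprn_egt1.
Qed.

(** Factor the slice polynomial over its zeros a, which satisfy |a| > 1
    because P has no zero on the closed polydisk. By normC_reversed_slice, the
    reversed polynomial has 1 - conj(l) a in place of l - a, which is smaller
    by blaschke_factor, times the power of |l| by which the degree of the
    slice falls short of the total multidegree. If there is no zero at all,
    that power is positive, since P is not constant. *)
Lemma normC_reversed_lt l : nonconstant P -> l != 0 -> `|l| < 1 ->
  `|(reversed_mpoly P).@[fun i => l * w i]| < `|P.@[fun i => l * w i]|.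
Proof.
move=> nP l0 l1; rewrite normC_reversed_slice // -horner_slice.
have p0 : slice_poly != 0.
  by apply: contraTneq (slice_nz (ltW l1)) => ->; rewrite horner0 eqxx.
have [r pr] := closed_field_poly_normal slice_poly.
have lc0 : lead_coef slice_poly != 0 by rewrite lead_coef_eq0.
have hE x : `|slice_poly.[x]| = `|lead_coef slice_poly| * \prod_(a <- r) `|x - a|.
  by rewrite pr lead_coefZ (monicP (monic_prod_XsubC _ _ _)) mulr1 hornerZ horner_prod normrM normr_prod; congr (_ * _); apply: eq_bigr => a _; rewrite hornerXsubC.
have rK : (size r <= \sum_i multidegree P i)%N.
  by have := size_slice; rewrite pr size_scale // size_prod_XsubC ltnS.
have r1 a : a \in r -> 1 < `|a|.
  move=> ar; rewrite real_ltNge ?num_real ?normr_real ?real1 //; apply/negP => /slice_nz/negP; apply.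
  by rewrite pr hornerZ mulf_eq0; apply/orP; right; rewrite -rootE root_prod_XsubC.
have lb0 : l^* != 0 by rewrite conjC_eq0.
rewrite !hE mulrCA ltr_pM2l ?normr_gt0 //.
rewrite -(subnK rK) exprD -mulrA.
have -> : `|l| ^+ size r * \prod_(a <- r) `|(l^*)^-1 - a| = \prod_(a <- r) `|1 - l^* * a|.
  elim: {pr hE rK r1} r => [|a r IH]; first by rewrite !big_nil mulr1.
  rewrite !big_cons -IH /= exprS mulrACA; congr (_ * _).
  by rewrite -[`|l|]norm_conjC -normrM mulrBr mulfV.
have prod_le : 0 <= \prod_(a <- r) `|1 - l^* * a| by rewrite prodr_ge0.
have [r0|r0] := eqVneq r [::].
  rewrite r0 !big_nil mulr1 subn0 exprn_ilt1 ?normr_ge0 //.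
  by rewrite -lt0n multidegree_gt0.
apply: (@le_lt_trans _ _ (\prod_(a <- r) `|1 - l^* * a|)).
  by rewrite ler_piMl // exprn_ile1 // ltW.
rewrite big_seq [ltRHS]big_seq; apply: ltr_prod.
  by case: r r0 {pr hE rK r1 prod_le} => // a r _; rewrite /= mem_head.
by move=> a /r1 a1; rewrite normr_ge0 blaschke_factor.
Qed.

Lemma normC_reversed_torus : `|(reversed_mpoly P).@[w]| = `|P.@[w]|.
Proof.
have := normC_reversed_slice (oner_neq0 C); rewrite rmorph1 invr1 normr1 expr1n mul1r horner_slice.
have E Q : Q.@[fun i => 1 * w i] = Q.@[w] by apply: meval_eq => i; rewrite mul1r.
by rewrite !E.

Qed.

End slice.
End ReversedPolynomial.

From mathcomp Require Import all_classical all_reals all_analysis measurable_realfun.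
Import Order.TTheory GRing.Theory Num.Theory numFieldNormedType.Exports.
Local Open Scope classical_set_scope.
Local Open Scope ring_scope.

(** * The mean over the torus *)

Section circle.
Context {R : realType}.
Implicit Types (G : R -> \bar R) (a x y : R).

Lemma twopi_gt0 : 0 < 2 * pi :> R.
Proof. by rewrite mulr_gt0 // pi_gt0. Qed.

Lemma measurable_id_R : measurable_fun setT (id : measurableTypeR R -> R).
Proof. by move=> _ A mA; rewrite setTI. Qed.

(** The uniform probability on [0, 2 pi], as a measure on R with its default
    measurable structure, the one that tuples of reals are built on. *)
Definition circle_mean (A : set R) : \bar R := uniform_prob twopi_gt0 A.

HB.instance Definition _ := isMeasure.Build _ R R circle_mean
  (measure0 (uniform_prob twopi_gt0)) (@measure_ge0 _ _ _ (uniform_prob twopi_gt0))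
  (@measure_semi_sigma_additive _ _ _ (uniform_prob twopi_gt0)).

HB.instance Definition _ := Measure_isProbability.Build _ R R circle_mean
  (probability_setT (uniform_prob twopi_gt0)).

(** G factors through x |-> e^{ix}, that is, G is a function on the circle. *)
Definition circular T (G : R -> T) := forall x y, expi x = expi y -> G x = G y.

Lemma expiD x y : expi (x + y) = expi x * expi y.
Proof. by rewrite /expi cosD sinD /GRing.mul /= addrC [X in (_ +i* X)%C]addrC. Qed.

Lemma expi_2pi : expi (2 * pi) = 1 :> R[i].
Proof. by rewrite /expi mulr_natl cos2pi sin2pi. Qed.

Lemma expi0 : expi 0 = 1 :> R[i].
Proof. by rewrite /expi cos0 sin0. Qed.

Lemma expiN x : expi (- x) = (expi x)^*.
Proof. by rewrite /expi cosN sinN. Qed.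

Lemma expi_period x : expi (x + 2 * pi) = expi x.
Proof. by rewrite expiD expi_2pi mulr1. Qed.

Lemma expi_periodz x (k : int) : expi (x + k%:~R * (2 * pi)) = expi x.
Proof.
have H n : expi (n%:R * (2 * pi)) = 1 :> R[i].
  elim: n => [|n IH]; first by rewrite mul0r expi0.
  by rewrite -natr1 mulrDl mul1r expi_period.
rewrite expiD; case: k => n; first by rewrite H mulr1.
by rewrite NegzE mulrNz mulNr expiN H rmorph1 mulr1.
Qed.

Lemma ge0_circle_meanE G : measurable_fun [set: R] G -> (forall x, 0 <= G x)%E ->
  (\int[circle_mean]_x G x =
   ((2 * pi)^-1)%:E * \int[lebesgue_measure]_(x in `[0%R, (2 * pi)%R]) G x)%E.
Proof.
move=> mG G0.
have H := @integral_uniform R 0 (2 * pi) twopi_gt0 G mG G0.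
rewrite -[X in X^-1%:E]subr0 -H.
exact: (ge0_integral_pushforward measurable_id_R (uniform_prob twopi_gt0) measurableT mG).
Qed.

Lemma lebesgue_measure_shift a (A : set R) : measurable A ->
  pushforward lebesgue_measure (fun x => x + a : measurableTypeR R) A =
  lebesgue_measure A :> \bar R.
Proof.
move=> mA; apply/esym.
have ma : measurable_fun [set: R] (fun x : R => x + a : measurableTypeR R).
  exact: measurable_funD.
apply: (@lebesgue_measure_unique R
  (pushforward lebesgue_measure (fun x => x + a : measurableTypeR R))) => // _ [[u v]] _ <-.
rewrite /= /pushforward.
have -> : (fun x : R => x + a) @^-1` `]u, v] = `]u - a, v - a]%classic.
  by apply/seteqP; split => x /=; rewrite !in_itv /= ltrBlDr lerBrDr.
rewrite !lebesgue_measure_itv /= !lte_fin ltrD2r.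
by case: ifP => // _; rewrite !EFinN -!EFinD; congr (_%:E); ring.
Qed.

Lemma circular_period T (G : R -> T) x : circular G -> G (x + 2 * pi) = G x.
Proof. by move=> cG; apply: cG; exact: expi_period. Qed.

Local Notation mu := (@lebesgue_measure R).

Lemma ge0_integral_shift a u v G : measurable_fun [set: R] G ->
  (forall x, 0 <= G x)%E ->
  (\int[mu]_(x in `[u, v]) G (x + a)%R = \int[mu]_(x in `[(u + a)%R, (v + a)%R]) G x)%E.
Proof.
move=> mG G0.
have ma : measurable_fun setT (fun x : measurableTypeR R => x + a : measurableTypeR R).
  exact: measurable_funD.
have -> : `[u, v]%classic =
   (fun x : measurableTypeR R => x + a : measurableTypeR R) @^-1` `[u + a, v + a].
  by apply/seteqP; split => x /=; rewrite !in_itv /= !lerD2r.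
rewrite -[LHS](ge0_integral_pushforward ma mu _ (f := G)) //; last first.
- exact: measurable_funTS.
- by apply: eq_measure_integral => A mA _; exact: lebesgue_measure_shift.
Qed.

Lemma ge0_integral_opp u v G : measurable_fun [set: R] G ->
  (forall x, 0 <= G x)%E ->
  (\int[mu]_(x in `[u, v]) G (- x)%R = \int[mu]_(x in `[(- v)%R, (- u)%R]) G x)%E.
Proof.
move=> mG G0.
have ma : measurable_fun setT (fun x : measurableTypeR R => - x : measurableTypeR R).
  exact: oppr_measurable.
have -> : `[u, v]%classic =
   (fun x : measurableTypeR R => - x : measurableTypeR R) @^-1` `[- v, - u].
  by apply/seteqP; split => x /=; rewrite !in_itv /= !lerN2 andbC.
rewrite -[LHS](ge0_integral_pushforward ma mu _ (f := G)) //; last first.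
- exact: measurable_funTS.
- by apply: eq_measure_integral => A mA _; exact: lebesgue_measureN.
Qed.

Lemma ge0_integral_cat u v w G : measurable_fun [set: R] G ->
  (forall x, 0 <= G x)%E -> u <= v -> v <= w ->
  (\int[mu]_(x in `[u, w]) G x =
   \int[mu]_(x in `[u, v]) G x + \int[mu]_(x in `[v, w]) G x)%E.
Proof.
move=> mG G0 uv vw.
rewrite (@itv_bndbnd_setU _ _ _ (BLeft v)) ?bnd_simp //.
rewrite ge0_integral_setU //=; last first.
- apply/disj_setPS => x [/=]; rewrite !in_itv /= => /andP[_ xv] /andP[vx _].
  by move: (le_lt_trans vx xv); rewrite ltxx.
- exact: measurable_funTS.
by rewrite integral_itv_bndo_bndc //; exact: measurable_funTS.
Qed.

(** After reduction of a modulo 2 pi, the shifted window [b, b + 2 pi] is cut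
    at 2 pi and the part beyond is moved back by one period. *)
Lemma ge0_circle_mean_shift a G : measurable_fun [set: R] G ->
  (forall x, 0 <= G x)%E -> circular G ->
  (\int[circle_mean]_x G (x + a)%R = \int[circle_mean]_x G x)%E.
Proof.
move=> mG G0 cG.
pose k := Num.floor (a / (2 * pi)).
pose b := a - k%:~R * (2 * pi).
have b0 : 0 <= b by rewrite subr_ge0 -ler_pdivlMr ?twopi_gt0 // Num.Theory.floor_le.
have b1 : b <= 2 * pi.
  have := Num.Theory.floorD1_gt (a / (2 * pi)); rewrite -/k ltr_pdivrMr ?twopi_gt0 //.
  by rewrite intrD mulrDl mul1r /b => /ltW; rewrite lerBlDl.
have -> : (fun x => G (x + a)) = (fun x => G (x + b)).
  apply/funext => x; apply: cG.
  by rewrite -[RHS](expi_periodz _ k) /b -addrA subrK.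
have mGb : measurable_fun [set: R] (fun x => G (x + b)).
  by apply: measurableT_comp => //; exact: measurable_funD.
rewrite !ge0_circle_meanE //; congr (_ * _)%E.
rewrite ge0_integral_shift // add0r.
rewrite (@ge0_integral_cat b (2 * pi)) //; last by rewrite lerDl.
rewrite (@ge0_integral_cat 0 b (2 * pi)) // addeC; congr (_ + _)%E.
have := @ge0_integral_shift (2 * pi) 0 b G mG G0.
rewrite add0r [2 * pi + b]addrC => <-.
by apply: eq_integral => x _; exact: circular_period.
Qed.

Lemma ge0_circle_mean_opp G : measurable_fun [set: R] G ->
  (forall x, 0 <= G x)%E -> circular G ->
  (\int[circle_mean]_x G (- x)%R = \int[circle_mean]_x G x)%E.
Proof.
move=> mG G0 cG.
have mGN : measurable_fun [set: R] (fun x => G (- x)).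
  by apply: measurableT_comp => //; exact: oppr_measurable.
rewrite !ge0_circle_meanE //; congr (_ * _)%E.
rewrite ge0_integral_opp // oppr0.
have := @ge0_integral_shift (2 * pi) (- (2 * pi)) 0 G mG G0.
rewrite addNr add0r => <-.
by apply: eq_integral => x _; rewrite circular_period.
Qed.

End circle.

Section torus.
Context {R : realType}.

Definition tuple_cons n (p : R * n.-tuple R) : n.+1.-tuple R := [tuple of p.1 :: p.2].

Lemma measurable_tuple_cons n : measurable_fun setT (@tuple_cons n).
Proof. by apply: measurable_cons; [exact: measurable_fst|exact: measurable_snd]. Qed.

Definition torus_cons n (m : probability (n.-tuple R) R) (A : set (n.+1.-tuple R)) : \bar R :=
  pushforward (@circle_mean R \x m)%E (@tuple_cons n) A.

Section torus_cons.
Variables (n : nat) (m : probability (n.-tuple R) R).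

Let tc0 : torus_cons m set0 = 0%E.
Proof. by rewrite /torus_cons /pushforward preimage_set0 measure0. Qed.

Let tc_ge0 A : (0 <= torus_cons m A)%E.
Proof. exact: (@measure_ge0 _ _ _ (@circle_mean R \x m)%E). Qed.

Let tc_sigma_additive : semi_sigma_additive (torus_cons m).
Proof.
move=> F mF tF mUF; rewrite /torus_cons /pushforward preimage_bigcup.
apply: (@measure_semi_sigma_additive _ _ _ (@circle_mean R \x m)%E).
- by move=> i; rewrite -[X in measurable X]setTI; exact: measurable_tuple_cons.
- apply/trivIsetP => /= i j _ _ ij; rewrite -preimage_setI.
  by move/trivIsetP : tF => /(_ _ _ _ _ ij) ->//; rewrite preimage_set0.
- by rewrite -preimage_bigcup -[X in measurable X]setTI; exact: measurable_tuple_cons.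
Qed.

HB.instance Definition _ := isMeasure.Build _ _ R (torus_cons m) tc0 tc_ge0 tc_sigma_additive.

Let tcT : torus_cons m setT = 1%E.
Proof. by rewrite /torus_cons /pushforward preimage_setT probability_setT. Qed.

HB.instance Definition _ := Measure_isProbability.Build _ _ R (torus_cons m) tcT.

End torus_cons.

(** The normalized Haar measure of the torus. It is built one coordinate at a
    time, like torus_integral, so that Fubini's theorem compares the two
    (torus_meanE). *)
Fixpoint torus (n : nat) : probability (n.-tuple R) R :=
  match n with
  | 0 => \d_ [tuple]
  | n'.+1 => torus_cons (torus n')
  end.

Lemma ge0_torus_cons n (F : n.+1.-tuple R -> \bar R) :
  measurable_fun setT F -> (forall t, 0 <= F t)%E ->
  (\int[torus n.+1]_t F t = \int[circle_mean]_x \int[torus n]_s F (tuple_cons (x, s)))%E.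
Proof.
move=> mF F0.
rewrite (ge0_integral_pushforward (@measurable_tuple_cons n)) //.
rewrite preimage_setT fubini_tonelli1 //.
  by apply: measurableT_comp => //; exact: measurable_tuple_cons.
by move=> x; exact: F0.
Qed.

(** The rotation by e^{ia} of all coordinates at once. Radial limits on the
    polydisk are governed by this one-parameter flow: the orbit of a point is
    the boundary circle of the complex line through it. *)
Definition tshift n (t : n.-tuple R) (a : R) : n.-tuple R :=
  map_tuple (fun x => x + a) t.

Lemma tnth_tshift n (t : n.-tuple R) a i : tnth (tshift t a) i = tnth t i + a.
Proof. by rewrite tnth_map. Qed.

Lemma tshift_cons n x (s : n.-tuple R) a :
  tshift (tuple_cons (x, s)) a = tuple_cons (x + a, tshift s a).
Proof. exact: val_inj. Qed.

Definition periodic n T (F : n.-tuple R -> T) := forall t s,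
  (forall i, expi (tnth t i) = expi (tnth s i)) -> F t = F s.

Lemma periodic_cons n T (F : n.+1.-tuple R -> T) x : periodic F ->
  periodic (fun s => F (tuple_cons (x, s))).
Proof.
move=> pF t s ts; apply: pF => i.
by case: (unliftP ord0 i) => [j ->|->]; rewrite ?tnthS ?tnth0.
Qed.

Lemma periodic_consl n T (F : n.+1.-tuple R -> T) s : periodic F ->
  circular (fun x => F (tuple_cons (x, s))).
Proof.
move=> pF x y xy; apply: pF => i.
by case: (unliftP ord0 i) => [j ->|->]; rewrite ?tnthS ?tnth0.
Qed.

Lemma periodic_tshiftl n T (F : n.-tuple R -> T) t : periodic F ->
  circular (fun a => F (tshift t a)).
Proof. by move=> pF x y xy; apply: pF => i; rewrite !tnth_tshift !expiD xy. Qed.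

Lemma measurable_tshift2 n d (T : measurableType d) (f : T -> n.-tuple R) (g : T -> R) :
  measurable_fun setT f -> measurable_fun setT g ->
  measurable_fun setT (fun x => tshift (f x) (g x)).
Proof.
move=> mf mg; apply/measurable_fun_tnthP => i.
rewrite (_ : _ \o _ = fun x => tnth (f x) i + g x); last first.
  by apply/funext => x /=; rewrite tnth_tshift.
apply: measurable_funD => //.
by have /measurable_fun_tnthP := mf; exact.
Qed.

(** Induction on the dimension: rotate the last coordinates for each fixed
    first one, then the first one. *)
Lemma ge0_torus_shift n (F : n.-tuple R -> \bar R) a : measurable_fun setT F ->
  (forall t, 0 <= F t)%E -> periodic F ->
  (\int[torus n]_t F (tshift t a) = \int[torus n]_t F t)%E.
Proof.
elim: n F => [|n IH] F mF F0 pF.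
  by apply: eq_integral => t _; congr F; rewrite (tuple0 t) (tuple0 (tshift _ _)).
have mFc (x : R) : measurable_fun setT (fun s : n.-tuple R => F (tuple_cons (x, s))).
  by apply: measurableT_comp => //; apply: measurableT_comp; [exact: measurable_tuple_cons|exact: measurable_pair1].
rewrite !ge0_torus_cons //; last first.
  by apply: measurableT_comp => //; exact: measurable_tshift2.
under eq_integral => x _.
  under eq_integral => s _ do rewrite tshift_cons.
  rewrite (IH (fun s => F (tuple_cons (x + a, s)))) //; last exact: periodic_cons.
  over.
rewrite (ge0_circle_mean_shift a (G := fun x => \int[torus n]_s F (tuple_cons (x, s)))%E) //.
- apply: (measurable_fun_fubini_tonelli_F (fun p => F (tuple_cons p))) => //.
  by apply: measurableT_comp => //; exact: measurable_tuple_cons.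
- by move=> x; exact: integral_ge0.
- by move=> x y xy; apply: eq_integral => s _; exact: (periodic_consl s pF).
Qed.

End torus.

Section torus_integral.
Context {R : realType}.
Local Notation mu := (@lebesgue_measure R).

Lemma measurable_fineT d (T : measurableType d) (f : T -> \bar R) :
  measurable_fun setT f -> measurable_fun setT (fine \o f).
Proof. by move=> mf; apply: measurableT_comp => //; exact: measurable_fine. Qed.

(** The integral may diverge for some x, so the positive and negative parts
    are integrated separately; each gives an extended measurable function by
    Tonelli's theorem. *)
Lemma measurable_Rintegral_param d (T : measurableType d) d' (Y : measurableType d')
    (m : {sigma_finite_measure set Y -> \bar R}) (D : set Y) (F : T * Y -> R) :
  measurable D ->
  measurable_fun setT F -> measurable_fun setT (fun x => \int[m]_(y in D) F (x, y)).
Proof.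
move=> mD mF.
have -> : (fun x => \int[m]_(y in D) F (x, y)) =
   fine \o (fun x => (\int[m]_y (((EFin \o F) \_ (setT `*` D))^\+) (x, y)
                      - \int[m]_y (((EFin \o F) \_ (setT `*` D))^\-) (x, y))%E).
  apply/funext => x /=; rewrite /Rintegral integral_mkcond integralE; congr (fine (_ - _)).
    by apply: eq_integral => y _; rewrite !funeposE /patch in_setX in_setT.
  by apply: eq_integral => y _; rewrite !funenegE /patch in_setX in_setT.
apply: measurable_fineT.
have mF' : measurable_fun setT ((EFin \o F) \_ (setT `*` D)).
  have mXD : measurable ([set: T] `*` D) by exact: measurableX.
  apply: (measurable_restrictT _ mXD).1.
  by apply: measurable_funTS; exact/measurable_EFinP.
apply: emeasurable_funB.
- apply: (measurable_fun_fubini_tonelli_F (((EFin \o F) \_ (setT `*` D))^\+)%E) => //.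
  exact: measurable_funepos.
- apply: (measurable_fun_fubini_tonelli_F (((EFin \o F) \_ (setT `*` D))^\-)%E) => //.
  exact: measurable_funeneg.
Qed.

Lemma measurable_torus_integral n d (T : measurableType d) (F : T * n.-tuple R -> R) :
  measurable_fun setT F -> measurable_fun setT (fun x => torus_integral (fun s => F (x, s))).
Proof.
elim: n d T F => [|n IH] d T F mF /=.
  exact: (measurableT_comp mF (measurable_pair2 _)).
pose F' (p : (T * measurableTypeR R)%type * n.-tuple R) : R := F (p.1.1, tuple_cons (p.1.2, p.2)).
apply: (@measurable_Rintegral_param _ T _ (measurableTypeR R) mu `[0, 2 * pi]%classic
  (fun p : T * measurableTypeR R => torus_integral (fun s : n.-tuple R => F' (p, s)))) => //.
apply: (IH _ (T * measurableTypeR R)%type F').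
apply: measurableT_comp => //; apply: measurable_fun_pair => /=.
  by apply: measurableT_comp; [exact: measurable_fst|exact: measurable_fst].
apply: measurableT_comp; first exact: measurable_tuple_cons.
apply: measurable_fun_pair; last exact: measurable_snd.
apply: (measurableT_comp measurable_id_R).
by apply: measurableT_comp; [exact: measurable_snd|exact: measurable_fst].
Qed.

Lemma circle_RintegralE (g : R -> R) : measurable_fun setT g ->
  \int[circle_mean]_x g x = (2 * pi)^-1 * \int[mu]_(x in `[0, 2 * pi]) g x.
Proof.
move=> mg; rewrite /Rintegral integralE [in RHS]integralE.
have c0 : (0 < (2 * pi)^-1 :> R)%R by rewrite invr_gt0 twopi_gt0.
have mp : measurable_fun [set: R] ((fun x => (g x)%:E)^\+)%E.
  by apply: measurable_funepos; exact/measurable_EFinP.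
have mn : measurable_fun [set: R] ((fun x => (g x)%:E)^\-)%E.
  by apply: measurable_funeneg; exact/measurable_EFinP.
rewrite !ge0_circle_meanE //.
set A := integral _ _ _; set B := integral _ _ _.
have : (0 <= A)%E by exact: integral_ge0.
have : (0 <= B)%E by exact: integral_ge0.
case: A B => [a| |] [b| |] //= _ _; rewrite ?gt0_muley ?lte_fin //=.
- by rewrite mulrBr.
- by rewrite mulr0.
- by rewrite mulr0.
- by rewrite mulr0.
Qed.

Lemma integrable_torus_cons n (F : n.+1.-tuple R -> R) :
  (torus n.+1).-integrable setT (EFin \o F) ->
  (circle_mean \x torus n)%E.-integrable setT (EFin \o F \o @tuple_cons R n).
Proof.
move=> /integrableP[mF iF]; apply/integrableP; split.
  by apply: measurableT_comp => //; exact: measurable_tuple_cons.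
move: iF; rewrite (ge0_integral_pushforward (@measurable_tuple_cons R n)) //.
by apply: measurableT_comp.
Qed.

Lemma integral_torus_cons n (F : n.+1.-tuple R -> R) :
  (torus n.+1).-integrable setT (EFin \o F) ->
  (\int[torus n.+1]_t (F t)%:E =
   \int[circle_mean]_x \int[torus n]_s (F (tuple_cons (x, s)))%:E)%E.
Proof.
move=> iF; have iF' := integrable_torus_cons iF.
have [mF _] := integrableP _ _ _ iF.
rewrite (integral_pushforward (@measurable_tuple_cons R n)) //.
by rewrite preimage_setT -integral12_prod_meas1.
Qed.

(** A positive factor keeps infinite parts infinite, so both sides take the
    same default value when the integral diverges. *)
Lemma Rintegral_gt0Zl d (T : measurableType d) (m : {measure set T -> \bar R})
    (D : set T) (c : R) (g : T -> R) : measurable D -> measurable_fun D g -> 0 < c ->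
  \int[m]_(x in D) (c * g x) = c * \int[m]_(x in D) g x.
Proof.
move=> mD mg c0; rewrite /Rintegral integralE [in RHS]integralE.
have mp : measurable_fun D ((fun x => (g x)%:E)^\+)%E.
  by apply: measurable_funepos; exact/measurable_EFinP.
have mn : measurable_fun D ((fun x => (g x)%:E)^\-)%E.
  by apply: measurable_funeneg; exact/measurable_EFinP.
have -> : (fun x => (c * g x)%:E) = (fun x => c%:E * (g x)%:E)%E by [].
rewrite (ge0_funeposM _ (ltW c0)) (ge0_funenegM _ (ltW c0)).
rewrite !ge0_integralZl_EFin ?ltW //.
set A := integral _ _ _; set B := integral _ _ _.
have : (0 <= A)%E by exact: integral_ge0.
have : (0 <= B)%E by exact: integral_ge0.
case: A B => [a| |] [b| |] //= _ _; rewrite ?gt0_muley ?lte_fin //=.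
- by rewrite mulrBr.
- by rewrite mulr0.
- by rewrite mulr0.
- by rewrite mulr0.
Qed.

(** By Fubini's theorem almost every slice is integrable, and there the
    induction hypothesis applies. On the remaining null set the iterated
    integral takes default values, which contribute nothing since the inner
    integral is a measurable function of the first coordinate. *)
Lemma torus_meanE n (F : n.-tuple R -> R) :
  (torus n).-integrable setT (EFin \o F) -> torus_mean F = \int[torus n]_t F t.
Proof.
elim: n F => [|n IH] F iF.
  rewrite /torus_mean expr0 invr1 mul1r /= /Rintegral.
  rewrite integral_dirac //; last by have [] := integrableP _ _ _ iF.
  by rewrite diracT mul1e.
have [/measurable_EFinP mF _] := integrableP _ _ _ iF.
pose G (p : R * n.-tuple R) := F (tuple_cons p).
have mG : measurable_fun setT G.
  by apply: measurableT_comp => //; exact: measurable_tuple_cons.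
have mT : measurable_fun [set: R] (fun x => torus_mean (fun s => G (x, s))).
  rewrite /torus_mean; apply: measurable_funM => //.
  exact: (measurable_torus_integral mG).
transitivity (\int[circle_mean]_x torus_mean (fun s : n.-tuple R => G (x, s))).
  rewrite circle_RintegralE // /torus_mean /= exprS invfM -mulrA; congr (_ * _).
  rewrite Rintegral_gt0Zl //; last by rewrite invr_gt0 exprn_gt0 // twopi_gt0.
  by apply: measurable_funTS; exact: (measurable_torus_integral mG).
rewrite /Rintegral integral_torus_cons //; congr fine.
apply: ae_eq_integral => //.
- exact/measurable_EFinP.
- exact: (measurable_fubini_F (integrable_torus_cons iF)).
have := ae_integrable1 (integrable_torus_cons iF).
apply: filterS => x iFx _.
rewrite IH // fineK //.
exact: (integrable_fin_num measurableT iFx).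
Qed.

End torus_integral.

(** * Goursat's theorem on rectangles *)

Section goursat.
Context {R : realType}.
Local Notation mu := (@lebesgue_measure R).
Local Notation Int u v f := (\int[mu]_(x in `[u, v]) f x).
Implicit Types u v w x y : R.

Lemma eqW x y : x = y -> x <= y. Proof. by move->. Qed.

Lemma Rintegral_cat (f : R -> R) u v w : u <= v -> v <= w ->
  mu.-integrable `[u, w] (EFin \o f) -> Int u w f = Int u v f + Int v w f.
Proof.
move=> uv vw fi.
have := @Rintegral_itvB R f (BLeft u) (BRight w) v fi.
rewrite !bnd_simp => /(_ uv vw) H.
rewrite -(@Rintegral_itv_obnd_cbnd R v (BRight w)) ?(-H); last first.
  apply: integrableS fi => //; apply: subset_itv; rewrite bnd_simp //.
by rewrite -H addrC subrK.
Qed.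

Lemma integrable_subitv (f : R -> R) u v x y : u <= x -> y <= v ->
  mu.-integrable `[u, v] (EFin \o f) -> mu.-integrable `[x, y] (EFin \o f).
Proof.
move=> ux yv fi; apply: integrableS fi => //.
by apply: subset_itv; rewrite bnd_simp.
Qed.

Lemma Rintegral_near_cst (f g : R -> R) u v c e : u <= v ->
  mu.-integrable `[u, v] (EFin \o f) -> mu.-integrable `[u, v] (EFin \o g) ->
  (forall x, u <= x <= v -> `|f x - g x - c| <= e) ->
  `|Int u v f - Int u v g - c * (v - u)| <= e * (v - u).
Proof.
move=> uv fi gi H.
have ei k : mu.-integrable `[u, v] (EFin \o (fun=> k)).
  apply: measurable_bounded_integrable => //.
  - by rewrite /= lebesgue_measure_itv /= lte_fin; case: ifP; rewrite -?EFinB ltry.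
  - by exists `|k|; split; [exact: num_real|move=> M kM x _; exact: ltW].
have fgi : mu.-integrable `[u, v] (EFin \o (fun x => f x - g x)).
  by have := integrableB _ fi gi; apply.
have Ic k : Int u v (fun=> k) = k * (v - u).
  rewrite Rintegral_cst //; congr (_ * _).
  rewrite /= lebesgue_measure_itv /= lte_fin.
  by case: ltgtP uv => //= -> _; rewrite subrr.
rewrite -RintegralB // -(Ic c) -RintegralB //.
apply: le_trans (le_normr_Rintegral _ _) _ => //.
  by have := integrableB _ fgi (ei c); apply.
rewrite -(Ic e); apply: le_Rintegral => //.
  have h : mu.-integrable `[u, v] (EFin \o (fun x => f x - g x - c)).
    by have := integrableB _ fgi (ei c); apply.
  by have := integrable_abse h; apply: eq_integrable.
Qed.

Variables (U V : R -> R -> R).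

(** The imaginary part of the integral of (U + iV) d(s + it) along the
    boundary of the rectangle [s1, s2] x [t1, t2]. *)
Definition boundary_flux s1 s2 t1 t2 :=
  Int t1 t2 (U s2) - Int t1 t2 (U s1)
  - (Int s1 s2 (fun s => V s t2) - Int s1 s2 (fun s => V s t1)).

(** U + iV is complex differentiable on the rectangle as a function of s + it,
    with derivative A + iB. *)
Definition conjugate_pair (a b c d : R) := forall s0 t0, a <= s0 <= b -> c <= t0 <= d ->
  exists A B : R, forall e, 0 < e -> exists2 h, 0 < h &
  forall s t, a <= s <= b -> c <= t <= d -> `|s - s0| < h -> `|t - t0| < h ->
   `|U s t - U s0 t0 - A * (s - s0) + B * (t - t0)| <= e * (`|s - s0| + `|t - t0|) /\
   `|V s t - V s0 t0 - B * (s - s0) - A * (t - t0)| <= e * (`|s - s0| + `|t - t0|).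

Variables (a b c d : R).
Hypotheses (ab : a <= b) (cd : c <= d).
Hypothesis iU : forall s, a <= s <= b -> mu.-integrable `[c, d] (EFin \o U s).
Hypothesis iV : forall t, c <= t <= d -> mu.-integrable `[a, b] (EFin \o (fun s => V s t)).
Hypothesis cUV : conjugate_pair a b c d.

Let h n := (b - a) / 2 ^+ n.
Let k n := (d - c) / 2 ^+ n.
Let E n x y := boundary_flux x (x + h n) y (y + k n).

Let h_ge0 n : 0 <= h n.
Proof. by rewrite divr_ge0 ?subr_ge0 // exprn_ge0. Qed.

Let k_ge0 n : 0 <= k n.
Proof. by rewrite divr_ge0 ?subr_ge0 // exprn_ge0. Qed.

Let hS n : h n = h n.+1 + h n.+1.
Proof. by rewrite /h exprS; field; rewrite expf_neq0. Qed.

Let kS n : k n = k n.+1 + k n.+1.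
Proof. by rewrite /k exprS; field; rewrite expf_neq0. Qed.

Let inside n x y := [/\ a <= x, x + h n <= b, c <= y & y + k n <= d].

Let split4 n x y : inside n x y ->
  E n x y = E n.+1 x y + E n.+1 (x + h n.+1) y
          + E n.+1 x (y + k n.+1) + E n.+1 (x + h n.+1) (y + k n.+1).
Proof.
move=> [ax xb cy yd]; rewrite /E /boundary_flux.
have h0 := h_ge0 n.+1; have k0 := k_ge0 n.+1; have hs := hS n; have ks := kS n.
rewrite -!(addrA x) -!(addrA y) -hs -ks.
have catU s : a <= s <= b -> Int y (y + k n) (U s) =
   Int y (y + k n.+1) (U s) + Int (y + k n.+1) (y + k n) (U s).
  move=> sab; apply: Rintegral_cat; [lra|lra|].
  by apply: integrable_subitv (iU sab).
have catV t : c <= t <= d -> Int x (x + h n) (fun s => V s t) =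
   Int x (x + h n.+1) (fun s => V s t) + Int (x + h n.+1) (x + h n) (fun s => V s t).
  move=> scd; apply: Rintegral_cat; [lra|lra|].
  by apply: integrable_subitv (iV scd).
rewrite !catU ?catV; try lra.
Qed.

(** A quarter of the rectangle that carries at least a fourth of its flux. *)
Let pick n x y : R * R :=
  if `|E n x y| <= 4 * `|E n.+1 x y| then (x, y) else
  if `|E n x y| <= 4 * `|E n.+1 (x + h n.+1) y| then (x + h n.+1, y) else
  if `|E n x y| <= 4 * `|E n.+1 x (y + k n.+1)| then (x, y + k n.+1) else
  (x + h n.+1, y + k n.+1).

Let pickP n x y (p := pick n x y) : inside n x y ->
  [/\ `|E n x y| <= 4 * `|E n.+1 p.1 p.2|,
     x <= p.1, p.1 + h n.+1 <= x + h n, y <= p.2 & p.2 + k n.+1 <= y + k n].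
Proof.
move=> I; rewrite /p /pick.
have h0 := h_ge0 n.+1; have k0 := k_ge0 n.+1; have hs := hS n; have ks := kS n.
case: ifPn => [H1|]; first by split => //=; lra.
rewrite -ltNge => H1.
case: ifPn => [H2|]; first by split => //=; lra.
rewrite -ltNge => H2.
case: ifPn => [H3|]; first by split => //=; lra.
rewrite -ltNge => H3; split => /=; [|lra..].
rewrite leNgt; apply/negP => H4.
have e1E := split4 I.
have : `|E n x y| <= `|E n.+1 x y| + `|E n.+1 (x + h n.+1) y|
   + `|E n.+1 x (y + k n.+1)| + `|E n.+1 (x + h n.+1) (y + k n.+1)|.
  rewrite e1E; apply: le_trans (ler_normD _ _) _; rewrite lerD2r.
  apply: le_trans (ler_normD _ _) _; rewrite lerD2r; exact: ler_normD.
lra.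
Qed.

Let z := fix z n := if n is n'.+1 then pick n' (z n').1 (z n').2 else (a, c).

Let z_inside n : inside n (z n).1 (z n).2.
Proof.
elim: n => [|n IH].
  by rewrite /inside /h /k /= expr0 !divr1; split; lra.
have [_ p1 p2 p3 p4] := pickP IH.
by case: IH => i1 i2 i3 i4; split => /=; lra.
Qed.

Let z_mono n m : (n <= m)%N -> [/\ (z n).1 <= (z m).1, (z m).1 + h m <= (z n).1 + h n,
  (z n).2 <= (z m).2 & (z m).2 + k m <= (z n).2 + k n].
Proof.
move=> /subnK <-; elim: (m - n)%N => [|j [i1 i2 i3 i4]]; first by [].
have [_ p1 p2 p3 p4] := pickP (z_inside (j + n)).
by rewrite addSn; split => /=; lra.
Qed.

Let z_large n : `|boundary_flux a b c d| <= 4 ^+ n * `|E n (z n).1 (z n).2|.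
Proof.
elim: n => [|n IH]; first by rewrite expr0 mul1r /E /h /k /= expr0 !divr1 !subrKC.
have [p1 _ _ _ _] := pickP (z_inside n).
apply: le_trans IH _; rewrite exprSr -mulrA ler_pM2l // exprn_gt0.
Qed.

Let limit_corner (x hh : nat -> R) : (forall n m, (n <= m)%N -> x n <= x m /\ x m + hh m <= x n + hh n) ->
  (forall n, 0 <= hh n) -> exists l, forall n, x n <= l <= x n + hh n.
Proof.
move=> H h0.
have ub n m : x m <= x n + hh n.
  case: (leqP n m) => [/H[_ H2]|/ltnW/H[H1 _]].
    by apply: le_trans _ H2; rewrite lerDl.
  by apply: le_trans H1 _; rewrite lerDl.
exists (sup (range x)) => n; apply/andP; split.
  apply: ub_le_sup; last by exists n.
  by exists (x 0%N + hh 0%N) => _ [m _ <-].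
by apply: ge_sup; [exists (x 0%N), 0%N|move=> _ [m _ <-]].
Qed.

(** Bisection: among the four quarters of a rectangle there is one with at
    least a fourth of the flux, so nested rectangles E n have a flux of at
    least 4^-n times the initial one. At their common point the functions are
    affine up to an error e times the distance, an affine pair has no flux,
    and hence the flux of the n-th rectangle is at most a constant times e
    4^-n. *)
Lemma boundary_flux_eq0 : boundary_flux a b c d = 0.
Proof.
apply/eqP; rewrite -normr_le0 leNgt; apply/negP => F0.
have [s0 Hs] : exists l, forall n, (z n).1 <= l <= (z n).1 + h n.
  by apply: limit_corner => // n m /z_mono[].
have [t0 Ht] : exists l, forall n, (z n).2 <= l <= (z n).2 + k n.
  by apply: limit_corner => // n m /z_mono[].
have s0ab : a <= s0 <= b.
  by move: (Hs 0%N); rewrite /h /= expr0 divr1 addrC subrK.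
have t0cd : c <= t0 <= d.
  by move: (Ht 0%N); rewrite /k /= expr0 divr1 addrC subrK.
have [A [B HAB]] := cUV s0ab t0cd.
pose L := (b - a) + (d - c) + 1.
have L0 : 0 < L by rewrite /L; lra.
set F := `|_| in F0.
(* With this slope error the flux of the n-th rectangle is at most F / 2 / 4^n. *)
have e0 : 0 < F / (4 * L ^+ 2) by rewrite divr_gt0 // mulr_gt0 // exprn_gt0.
have [del del0 Hdel] := HAB _ e0.
have [n Hn] : exists n, L / 2 ^+ n < del.
  have : (L * 2^-1 ^+ n) @[n --> \oo] --> L * 0.
    by apply: cvgMr; apply: cvg_expr; rewrite ger0_norm; lra.
  rewrite mulr0 => /cvgrPdist_lt/(_ _ del0)[n _ /(_ _ (leqnn n))].
  rewrite sub0r normrN ger0_norm ?mulr_ge0 ?exprn_ge0 ?invr_ge0 // ?ltW //.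
  by rewrite exprVn; exists n.
have [i1 i2 i3 i4] := z_inside n.
have := Hs n; have := Ht n; have := z_large n.
move: i1 i2 i3 i4; rewrite /E -/F.
set x := (z n).1; set y := (z n).2 => i1 i2 i3 i4 large /andP[y1 y2] /andP[x1 x2].
have hk : h n + k n <= L / 2 ^+ n.
  by rewrite /h /k -mulrDl ler_pM2r ?invr_gt0 ?exprn_gt0 // /L; lra.
have h0 := h_ge0 n; have k0 := k_ge0 n.
set e := F / _ in e0 Hdel.
have bnd s t : x <= s <= x + h n -> y <= t <= y + k n ->
   `|U s t - U s0 t0 - A * (s - s0) + B * (t - t0)| <= e * (h n + k n) /\
   `|V s t - V s0 t0 - B * (s - s0) - A * (t - t0)| <= e * (h n + k n).
  move=> sx ty.
  have s1 : `|s - s0| <= h n by rewrite ler_norml; lra.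
  have t1 : `|t - t0| <= k n by rewrite ler_norml; lra.
  have := Hdel s t; case; [lra|lra|lra|lra|] => b1 b2.
  by split; [apply: le_trans b1 _|apply: le_trans b2 _]; rewrite ler_pM2l // lerD.
have BU : `|Int y (y + k n) (U (x + h n)) - Int y (y + k n) (U x) - A * h n * ((y + k n) - y)|
   <= (e * (h n + k n)) *+ 2 * ((y + k n) - y).
  apply: Rintegral_near_cst; [lra| | |].
  - by apply: integrable_subitv (iU _) => //; lra.
  - by apply: integrable_subitv (iU _) => //; lra.
  move=> t ty.
  have [|//|u1 _] := bnd (x + h n) t; first lra.
  have [|//|u2 _] := bnd x t; first lra.
  rewrite (_ : _ - _ - _ = (U (x + h n) t - U s0 t0 - A * (x + h n - s0) + B * (t - t0))
   - (U x t - U s0 t0 - A * (x - s0) + B * (t - t0))); last ring.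
  by apply: le_trans (ler_normB _ _) _; rewrite mulr2n lerD.
have BV : `|Int x (x + h n) (fun s => V s (y + k n)) - Int x (x + h n) (fun s => V s y) - A * k n * ((x + h n) - x)|
   <= (e * (h n + k n)) *+ 2 * ((x + h n) - x).
  apply: Rintegral_near_cst; [lra| | |].
  - by apply: integrable_subitv (iV _) => //; lra.
  - by apply: integrable_subitv (iV _) => //; lra.
  move=> s sx.
  have [//||_ u1] := bnd s (y + k n); first lra.
  have [//||_ u2] := bnd s y; first lra.
  rewrite (_ : _ - _ - _ = (V s (y + k n) - V s0 t0 - B * (s - s0) - A * (y + k n - t0))
   - (V s y - V s0 t0 - B * (s - s0) - A * (y - t0))); last ring.
  by apply: le_trans (ler_normB _ _) _; rewrite mulr2n lerD.
have small : `|boundary_flux x (x + h n) y (y + k n)| <= 2 * e * (h n + k n) ^+ 2.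
  rewrite /boundary_flux.
  rewrite (_ : _ - _ - _ = (Int y (y + k n) (U (x + h n)) - Int y (y + k n) (U x) - A * h n * ((y + k n) - y))
    - (Int x (x + h n) (fun s => V s (y + k n)) - Int x (x + h n) (fun s => V s y) - A * k n * ((x + h n) - x))); last ring.
  apply: le_trans (ler_normB _ _) _; apply: le_trans (lerD BU BV) _.
  by apply: eqW; ring.
have : 2 * e * (h n + k n) ^+ 2 <= F / 2 / 4 ^+ n.
  apply: (@le_trans _ _ (2 * e * (L / 2 ^+ n) ^+ 2)).
    apply: ler_wpM2l; first by rewrite mulr_ge0 // ltW.
    apply: lerXn2r => //; rewrite nnegrE; first by lra.
    by rewrite divr_ge0 ?exprn_ge0 // ltW.
  have q0 : (4 : R) ^+ n != 0 by rewrite expf_neq0.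
  have E4 : ((2 : R) ^+ n) ^+ 2 = 4 ^+ n.
    by rewrite -exprM mulnC exprM; congr (_ ^+ _); ring.
  rewrite /e expr_div_n E4; move: q0; set q := 4 ^+ n => q0.
  by apply: eqW; field; rewrite q0 gt_eqF.
move=> small2.
have : F <= F / 2.
  apply: le_trans large _; rewrite mulrC -ler_pdivlMr ?exprn_gt0 //.
  exact: le_trans small small2.
lra.
Qed.

End goursat.

(** * Complex modulus, continuity and derivative in real terms *)

Section complex_modulus.
Context {R : realType}.
Implicit Types z w : R[i].

(** The modulus with values in R rather than in the complex numbers, where
    linear arithmetic is available. *)
Definition cabs z : R := Num.sqrt (complex.Re z ^+ 2 + complex.Im z ^+ 2).

Lemma normC_cabs z : `|z| = (cabs z)%:C%C.
Proof. by rewrite normc_def. Qed.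

Lemma cabs_ge0 z : 0 <= cabs z.
Proof. exact: sqrtr_ge0. Qed.

Lemma cabsM z w : cabs (z * w) = cabs z * cabs w.
Proof. by apply: complexI; rewrite rmorphM /= -!normC_cabs normrM. Qed.

Lemma cabsV z : cabs z^-1 = (cabs z)^-1.
Proof. by apply: complexI; rewrite fmorphV /= -!normC_cabs normfV. Qed.

Lemma cabsD z w : cabs (z + w) <= cabs z + cabs w.
Proof. by rewrite -lecR rmorphD /= -!normC_cabs ler_normD. Qed.

Lemma cabsN z : cabs (- z) = cabs z.
Proof. by apply: complexI; rewrite -!normC_cabs normrN. Qed.

Lemma cabsC z w : cabs (z - w) = cabs (w - z).
Proof. by rewrite -cabsN opprB. Qed.

Lemma cabs_dist z w : `|cabs z - cabs w| <= cabs (z - w).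
Proof.
have := cabsD (z - w) w; have := cabsD (w - z) z; rewrite !subrK (cabsC w z) => H1 H2.
by rewrite ler_norml; apply/andP; split; lra.
Qed.

Lemma cabs_real (x : R) : cabs x%:C%C = `|x|.
Proof. by rewrite /cabs /= expr0n addr0 sqrtr_sqr. Qed.

Lemma cabs0 : cabs 0 = 0.
Proof. by rewrite -[0]/((0 : R)%:C%C) cabs_real normr0. Qed.

Lemma cabs1 : cabs 1 = 1.
Proof. by rewrite -[1]/((1 : R)%:C%C) cabs_real normr1. Qed.

Lemma cabs_eq0 z : (cabs z == 0) = (z == 0).
Proof. by rewrite -[RHS]normr_eq0 normC_cabs -[0 in RHS]/((0 : R)%:C%C) (inj_eq (@complexI _)). Qed.

Lemma cabs_sqr z : cabs z ^+ 2 = complex.Re z ^+ 2 + complex.Im z ^+ 2.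
Proof. by rewrite sqr_sqrtr // addr_ge0 // sqr_ge0. Qed.

Lemma cabs_expi t : cabs (expi t) = 1.
Proof. by rewrite /cabs /= cos2Dsin2 sqrtr1. Qed.

Lemma Re_le_cabs z : `|complex.Re z| <= cabs z.
Proof. by rewrite -sqrtr_sqr ler_wsqrtr // lerDl sqr_ge0. Qed.

Lemma Im_le_cabs z : `|complex.Im z| <= cabs z.
Proof. by rewrite -sqrtr_sqr ler_wsqrtr // lerDr sqr_ge0. Qed.

Lemma cabs_le_ReIm z : cabs z <= `|complex.Re z| + `|complex.Im z|.
Proof.
rewrite -ler_sqr ?nnegrE ?cabs_ge0 ?addr_ge0 // cabs_sqr sqrrD.
rewrite !real_normK ?num_real // addrAC lerDl mulrn_wge0 // mulr_ge0.
Qed.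

Lemma cReD z w : complex.Re (z + w) = complex.Re z + complex.Re w.
Proof. by case: z w => [a b] [c d]. Qed.
Lemma cImD z w : complex.Im (z + w) = complex.Im z + complex.Im w.
Proof. by case: z w => [a b] [c d]. Qed.
Lemma cReN z : complex.Re (- z) = - complex.Re z.
Proof. by case: z. Qed.
Lemma cImN z : complex.Im (- z) = - complex.Im z.
Proof. by case: z. Qed.
Lemma cReB z w : complex.Re (z - w) = complex.Re z - complex.Re w.
Proof. by rewrite cReD cReN. Qed.
Lemma cImB z w : complex.Im (z - w) = complex.Im z - complex.Im w.
Proof. by rewrite cImD cImN. Qed.
Lemma cReM z w : complex.Re (z * w) =
  complex.Re z * complex.Re w - complex.Im z * complex.Im w.
Proof. by case: z w => [a b] [c d]. Qed.
Lemma cImM z w : complex.Im (z * w) =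
  complex.Re z * complex.Im w + complex.Im z * complex.Re w.
Proof. by case: z w => [a b] [c d] /=; rewrite addrC. Qed.

End complex_modulus.

Section holomorphic.
Context {R : realType}.
Local Notation C := R[i].
Local Notation mu := (@lebesgue_measure R).
Local Notation Int u v f := (\int[mu]_(x in `[u, v]) f x).
Implicit Types (F G : C -> C) (z w : C).

(** Continuity, and below differentiability, as explicit estimates of moduli;
    cderivableP compares the latter with derivable. *)
Definition ccontinuous F z := forall e, 0 < e -> exists2 h : R, 0 < h &
  forall w, cabs (w - z) < h -> cabs (F w - F z) < e.

Definition cderivable F z := exists c, forall e, 0 < e -> exists2 h : R, 0 < h &
  forall w, cabs (w - z) < h -> cabs (F w - F z - c * (w - z)) <= e * cabs (w - z).

Lemma is_derive_linear (f : R -> R) D e : is_derive (0 : R) 1 f D -> 0 < e ->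
  exists2 h : R, 0 < h & forall x, `|x| < h -> `|f x - f 0 - D * x| <= e * `|x|.
Proof.
move=> [fd fD] e0.
have : h^-1 *: ((f \o shift 0) (h *: 1) - f 0) @[h --> 0^'] --> D by rewrite -fD; exact: fd.
move=> /cvgrPdist_le/(_ _ e0)[h h0 H]; exists h => // x xh.
have [->|x0] := eqVneq x 0; first by rewrite subrr mulr0 subrr normr0 mulr0.
have := H x; rewrite /ball_ /= sub0r normrN => /(_ xh x0).
rewrite /= addr0 /GRing.scale /= mulr1 => {}H.
rewrite (_ : _ - _ = - x * (D - x^-1 * (f x - f 0))); last by field.
by rewrite normrM normrN mulrC ler_wpM2r.
Qed.

Lemma expR_linear e : 0 < e -> exists2 h : R, 0 < h &
  forall x, `|x| < h -> `|expR x - 1 - x| <= e * `|x|.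
Proof.
move=> e0; have [h h0 H] := is_derive_linear (is_derive_expR 0) e0.
by exists h => // x /H; rewrite expR0 mul1r.
Qed.

Lemma sin_linear e : 0 < e -> exists2 h : R, 0 < h &
  forall x, `|x| < h -> `|sin x - x| <= e * `|x|.
Proof.
move=> e0; have [h h0 H] := is_derive_linear (is_derive_sin 0) e0.
by exists h => // x /H; rewrite sin0 cos0 mul1r subr0.
Qed.

Lemma cos_linear e : 0 < e -> exists2 h : R, 0 < h &
  forall x, `|x| < h -> `|cos x - 1| <= e * `|x|.
Proof.
move=> e0; have [h h0 H] := is_derive_linear (is_derive_cos 0) e0.
by exists h => // x /H; rewrite sin0 cos0 oppr0 mul0r subr0.
Qed.

(** The exponential of s + it. In these coordinates annuli become rectangles.
    *)
Definition cexp (s t : R) : C := (expR s)%:C%C * expi t.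

Lemma cexpD s t x y : cexp (s + x) (t + y) = cexp s t * cexp x y.
Proof. by rewrite /cexp expRD rmorphM expiD mulrACA. Qed.

Lemma cabs_cexp s t : cabs (cexp s t) = expR s.
Proof. by rewrite cabsM cabs_expi mulr1 cabs_real ger0_norm // expR_ge0. Qed.

(** The derivative of the exponential at 0, from those of expR, sin and cos.
    *)
Lemma cexp_linear0 e : 0 < e -> exists2 h : R, 0 < h &
  forall x y : R, `|x| < h -> `|y| < h ->
  cabs (cexp x y - 1 - (x +i* y)%C) <= e * (`|x| + `|y|).
Proof.
move=> e0.
have [e' [e'0 e'8 e'2]] : exists e' : R, [/\ 0 < e', e' <= e / 8 & e' <= 1 / 2].
  exists (Num.min (e / 8) (1 / 2)); rewrite lt_min ?ge_min ?lexx ?orbT.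
  by split => //; apply/andP; split; lra.
have [h1 h10 H1] := expR_linear e'0.
have [h2 h20 H2] := sin_linear e'0.
have [h3 h30 H3] := cos_linear e'0.
exists (Num.min e' (Num.min h1 (Num.min h2 h3))); first by rewrite !lt_min e'0 h10 h20.
move=> x y; rewrite !lt_min => /and4P[xe x1 x2 x3] /and4P[ye y1 y2 y3].
have {}H1 := H1 _ x1; have {}H2 := H2 _ y2; have {}H3 := H3 _ y3.
apply: le_trans (cabs_le_ReIm _) _.
rewrite /cexp cReB cReB cImB cImB cReM cImM /= !mul0r subr0 addr0 subr0.
have c1 : `|cos y| <= 1 by exact: cos_max.
have s1 : `|sin y| <= 1 by exact: sin_max.
have -> : expR x * cos y - 1 - x = (expR x - 1 - x) * cos y + (1 + x) * (cos y - 1) by ring.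
have -> : expR x * sin y - y = expR x * (sin y - y) + (expR x - 1 - x) * y + x * y by ring.
have X := normr_ge0 x; have Y := normr_ge0 y.
have B1 : `|(expR x - 1 - x) * cos y + (1 + x) * (cos y - 1)| <= e' * `|x| + 2 * (e' * `|y|).
  apply: le_trans (ler_normD _ _) _; rewrite !normrM; apply: lerD.
    by rewrite -[leRHS]mulr1; apply: ler_pM.
  apply: ler_pM => //.
  apply: le_trans (ler_normD _ _) _; rewrite normr1; lra.
have E2 : `|expR x| <= 2.
  rewrite (_ : expR x = (expR x - 1 - x) + (1 + x)); last ring.
  have e1x : e' * `|x| <= 1 / 2 * (1 / 2) by apply: ler_pM => //; lra.
  apply: le_trans (ler_normD _ _) _.
  have := ler_normD 1 x; rewrite normr1; lra.
have B2 : `|expR x * (sin y - y) + (expR x - 1 - x) * y + x * y| <=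
    2 * (e' * `|y|) + e' * `|x| + e' * `|y|.
  apply: le_trans (ler_normD _ _) _; apply: lerD; last first.
    by rewrite normrM; apply: ler_pM => //; lra.
  apply: le_trans (ler_normD _ _) _; rewrite !normrM; apply: lerD.
    by apply: ler_pM.
  by rewrite -[leRHS]mulr1; apply: ler_pM => //; lra.
have : e' * `|x| <= e / 8 * `|x| by apply: ler_wpM2r.
have : e' * `|y| <= e / 8 * `|y| by apply: ler_wpM2r.
have : 0 <= e * `|x| by rewrite mulr_ge0 // ltW.
have : 0 <= e * `|y| by rewrite mulr_ge0 // ltW.
lra.
Qed.

Lemma cexp_linear s t e : 0 < e -> exists2 h : R, 0 < h &
  forall s' t' : R, `|s' - s| < h -> `|t' - t| < h ->
  cabs (cexp s' t' - cexp s t - cexp s t * ((s' - s) +i* (t' - t))%C) <=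
    e * (`|s' - s| + `|t' - t|).
Proof.
move=> e0; have K0 : 0 < expR s by exact: expR_gt0.
have [h h0 H] := cexp_linear0 (divr_gt0 e0 K0).
exists h => // s' t' /H{}H /H{}H.
rewrite -{1}(subrKC s s') -{1}(subrKC t t') cexpD.
rewrite -[X in _ - X - _]mulr1 -!mulrBr cabsM cabs_cexp.
apply: le_trans (ler_wpM2l (ltW K0) H) _.
by rewrite mulrA mulrCA mulfV ?gt_eqF // mulr1.
Qed.

Lemma cderivable_ccontinuous F z : cderivable F z -> ccontinuous F z.
Proof.
move=> [c Hc] e e0; have [h h0 H] := Hc 1 ltr01.
pose K := 2 + cabs c; have K0 : 0 < K by rewrite /K; have := cabs_ge0 c; lra.
exists (Num.min h (e / K)); first by rewrite lt_min h0 divr_gt0.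
move=> w; rewrite lt_min => /andP[/H{}H wK].
rewrite -(subrK (c * (w - z)) (F w - F z)).
apply: le_lt_trans (cabsD _ _) _; rewrite cabsM.
move: wK; rewrite ltr_pdivlMr // /K => wK.
have := cabs_ge0 (w - z); lra.
Qed.

(** The chain rule for F at the exponential of s + it. *)
Lemma cderivable_polar F (s t : R) : cderivable F (cexp s t) ->
  exists c : C, forall e, 0 < e -> exists2 h : R, 0 < h &
  forall s' t' : R, `|s' - s| < h -> `|t' - t| < h ->
  cabs (F (cexp s' t') - F (cexp s t) - c * ((s' - s) +i* (t' - t))%C) <=
    e * (`|s' - s| + `|t' - t|).
Proof.
move=> [c Hc]; exists (c * cexp s t) => e e0.
pose K := expR s + 1; have K0 : 0 < K by rewrite addr_gt0 // expR_gt0.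
pose k := cabs c + 1; have k0 : 0 < k by rewrite ltr_wpDl // cabs_ge0.
have e1 : 0 < e / 2 / K by rewrite !divr_gt0.
have e2 : 0 < Num.min 1 (e / 2 / k) by rewrite lt_min ltr01 !divr_gt0.
have [h1 h10 H1] := Hc _ e1.
have [h2 h20 H2] := cexp_linear s t e2.
exists (Num.min h2 (h1 / 2 / K)); first by rewrite lt_min h20 !divr_gt0.
move=> s' t'; rewrite !lt_min => /andP[/H2{}H2 s1] /andP[/H2{}H2 t1].
set D := `|s' - s| + `|t' - t| in H2 *; have D0 : 0 <= D by rewrite addr_ge0.
set i := ((s' - s) +i* (t' - t))%C in H2 *.
have iD : cabs i <= D by exact: cabs_le_ReIm.
have H3 : cabs (cexp s' t' - cexp s t) <= K * D.
  rewrite -(subrK (cexp s t * i) (_ - _)).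
  apply: le_trans (cabsD _ _) _; rewrite cabsM cabs_cexp /K mulrDl addrC.
  apply: lerD; first by rewrite ler_wpM2l // expR_ge0.
  apply: le_trans H2 _; apply: ler_wpM2r => //.
  by rewrite ge_min lexx.
have Dh : K * D < h1.
  move: s1 t1; rewrite !ltr_pdivlMr // => s1 t1.
  by rewrite /D mulrC mulrDl; lra.
have {}H1 := H1 _ (le_lt_trans H3 Dh).
rewrite -mulrA (_ : _ - _ = (F (cexp s' t') - F (cexp s t) - c * (cexp s' t' - cexp s t))
  + c * (cexp s' t' - cexp s t - cexp s t * i)); last ring.
apply: le_trans (cabsD _ _) _; rewrite cabsM.
have A1 : e / 2 / K * cabs (cexp s' t' - cexp s t) <= e / 2 * D.
  rewrite (_ : e / 2 * D = e / 2 / K * (K * D)); last by field; rewrite gt_eqF.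
  by apply: ler_wpM2l => //; rewrite ltW.
have A2 : cabs c * cabs (cexp s' t' - cexp s t - cexp s t * i) <= e / 2 * D.
  apply: (@le_trans _ _ (k * (e / 2 / k * D))).
    apply: ler_pM; rewrite ?cabs_ge0 //; first by rewrite lerDl.
    apply: le_trans H2 _; apply: ler_wpM2r => //.
    by rewrite ge_min lexx orbT.
  by apply: eqW; field; rewrite gt_eqF.
lra.
Qed.

Lemma ccontinuous_Re_cexp F s : (forall t, ccontinuous F (cexp s t)) ->
  continuous (fun t => complex.Re (F (cexp s t))).
Proof.
move=> cF t; apply/cvgrPdist_lt => e e0.
have [h h0 H] := cF t e e0.
have K0 : 0 < expR s + 1 by rewrite addr_gt0 // expR_gt0.
have [h1 h10 H1] := cexp_linear s t ltr01.
near=> t'.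
rewrite distrC -cReB; apply: le_lt_trans (Re_le_cabs _) _; apply: H.
have t'h : `|t' - t| < h1.
  rewrite distrC; near: t'; exact: cvgr_dist_lt.
have := H1 s t'; rewrite subrr normr0 add0r mul1r => /(_ h10 t'h) H2.
rewrite -(subrK (cexp s t * (0 +i* (t' - t))%C) (_ - _)).
apply: le_lt_trans (cabsD _ _) _; rewrite cabsM cabs_cexp.
have ct : cabs (0 +i* (t' - t))%C = `|t' - t| by rewrite /cabs /= expr0n add0r sqrtr_sqr.
have : `|t' - t| < h / (expR s + 1).
  by rewrite distrC; near: t'; apply: cvgr_dist_lt => //; rewrite divr_gt0.
rewrite ltr_pdivlMr // ct mulrDr; lra.
Unshelve. all: by end_near. Qed.

End holomorphic.

(** * The mean value property *)

Section mean_value.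
Context {R : realType}.
Local Notation C := R[i].
Local Notation mu := (@lebesgue_measure R).
Local Notation Int u v f := (\int[mu]_(x in `[u, v]) f x).
Implicit Types (F G : C -> C) (z w : C).

Lemma uniform_on_circle (g : R -> R -> R) r0 :
  (forall t0 e, 0 < e -> exists2 h : R, 0 < h &
     forall r t, `|r - r0| < h -> `|t - t0| < h -> `|g r t - g r0 t0| < e) ->
  forall e, 0 < e -> exists2 h : R, 0 < h & forall r, `|r - r0| < h ->
    forall t, 0 <= t <= 2 * pi -> `|g r t - g r0 t| < e.
Proof.
move=> H e e0; have /compact_near_coveringP cov := @segment_compact R 0 (2 * pi).
have : \forall r \near r0, `[0, 2 * pi]%classic `<=` (fun t => `|g r t - g r0 t| < e).
  apply: (cov _ (nbhs r0) (fun r t => `|g r t - g r0 t| < e)) => t _; have e2 : 0 < e / 2 by rewrite divr_gt0.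
  have [h h0 Hh] := H t _ e2.
  exists (ball t h, ball r0 h); first by split; exact: nbhsx_ballx.
  move=> [t' r] /= [t'h rh].
  rewrite -(subrK (g r0 t) (g r t')) -addrA.
  apply: le_lt_trans (ler_normD _ _) _; rewrite (splitr e) ltrD //.
    by apply: Hh; rewrite distrC.
  by rewrite distrC; apply: Hh; rewrite ?subrr ?normr0 // distrC.
move=> [h h0 Hh]; exists h => // r rh t tI.
by apply: Hh; rewrite /= ?in_itv //= distrC.
Qed.

Lemma integrable_circle (g : R -> R) : continuous g ->
  mu.-integrable `[0, 2 * pi] (EFin \o g).
Proof.
move=> cg; apply: continuous_compact_integrable; first exact: segment_compact.
exact: continuous_subspaceT.
Qed.

Lemma Rintegral_circle_near (f g : R -> R) e : continuous f -> continuous g ->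
  (forall t, 0 <= t <= 2 * pi -> `|f t - g t| <= e) ->
  `|Int 0 (2 * pi) f - Int 0 (2 * pi) g| <= e * (2 * pi).
Proof.
move=> cf cg H; have p0 := @twopi_gt0 R.
have := @Rintegral_near_cst R f g 0 (2 * pi) 0 e (ltW p0)
  (integrable_circle cf) (integrable_circle cg).
by rewrite mul0r !subr0; apply=> t /H; rewrite subr0.
Qed.

Lemma constant_closure (M : R -> R) a b : a < b -> continuous M ->
  (forall x y, a < x -> x <= y -> y < b -> M x = M y) -> M a = M b.
Proof.
move=> ab cM H.
have E x y : a < x < b -> a < y < b -> M x = M y.
  by move=> /andP[? ?] /andP[? ?]; case: (leP x y) => [|/ltW] xy; [|apply/esym]; apply: H.
pose m := (a + b) / 2.
have main c : (c = a) \/ (c = b) -> M c = M m.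
  move=> cab; apply/eqP; rewrite -subr_eq0 -normr_eq0; apply/negPn/negP => N.
  have e0 : 0 < `|M c - M m| by rewrite lt_neqAle eq_sym N normr_ge0.
  have /cvgrPdist_lt/(_ _ e0)[h /= h0 Hh] := cM c.
  pose k := Num.min (h / 2) ((b - a) / 2).
  have k0 : 0 < k by rewrite lt_min; apply/andP; split; lra.
  have kh : k <= h / 2 by rewrite ge_min lexx.
  have kab : k <= (b - a) / 2 by rewrite ge_min lexx orbT.
  have [x xab xc] : exists2 x, a < x < b & `|c - x| < h.
    case: cab => ->.
      by exists (a + k); [lra|rewrite opprD addNKr normrN gtr0_norm //; lra].
    by exists (b - k); [lra|rewrite opprB addrC subrK gtr0_norm //; lra].
  have := Hh x xc; rewrite (E x m) ?ltxx //; rewrite /m; lra.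
by rewrite (main a) ?(main b); auto.
Qed.

Lemma cexp_continuous (s t : R) e : 0 < e -> exists2 h : R, 0 < h &
  forall s' t' : R, `|s' - s| < h -> `|t' - t| < h ->
  cabs (cexp s' t' - cexp s t) < e.
Proof.
move=> e0; have [h1 h10 H1] := cexp_linear s t ltr01.
have K0 : 0 < expR s + 1 by rewrite addr_gt0 // expR_gt0.
exists (Num.min h1 (e / 2 / (expR s + 1))); first by rewrite lt_min h10 !divr_gt0.
move=> s' t'; rewrite !lt_min => /andP[/H1{}H1 s1] /andP[/H1{}H1 t1].
rewrite -(subrK (cexp s t * ((s' - s) +i* (t' - t))%C) (_ - _)).
apply: le_lt_trans (cabsD _ _) _; rewrite cabsM cabs_cexp.
have := cabs_le_ReIm ((s' - s) +i* (t' - t))%C => /= H2.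
have : expR s * cabs ((s' - s) +i* (t' - t))%C <= expR s * (`|s' - s| + `|t' - t|).
  by rewrite ler_wpM2l // expR_ge0.
move: s1 t1; rewrite !ltr_pdivlMr // !mulrDr; lra.
Qed.

Lemma cexp0 (t : R) : cexp 0 t = expi t.
Proof. by rewrite /cexp expR0 mul1r. Qed.

Lemma cexp_ln (r t : R) : 0 < r -> cexp (ln r) t = r%:C%C * expi t.
Proof. by move=> r0; rewrite /cexp lnK. Qed.

Lemma expi_continuous (t : R) e : 0 < e -> exists2 h : R, 0 < h &
  forall t' : R, `|t' - t| < h -> cabs (expi t' - expi t) < e.
Proof.
move=> e0; have [h h0 H] := cexp_continuous 0 t e0; exists h => // t' t'h.
by rewrite -!cexp0 H // subrr normr0.
Qed.

(** In logarithmic polar coordinates the annulus is a rectangle of zero flux,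
    by boundary_flux_eq0. The integrals over the sides t = 0 and t = 2 pi
    cancel by periodicity, so the other two sides have the same integral. *)
Lemma annulus_mean F r1 r2 : 0 < r1 -> r1 <= r2 ->
  (forall z, r1 <= cabs z <= r2 -> cderivable F z) ->
  Int 0 (2 * pi) (fun t => complex.Re (F (r1%:C%C * expi t))) =
  Int 0 (2 * pi) (fun t => complex.Re (F (r2%:C%C * expi t))).
Proof.
move=> r10 r12 dF; have r20 := lt_le_trans r10 r12.
pose U s t := complex.Re (F (cexp s t)).
pose V s t := complex.Im (F (cexp s t)).
have cab s : ln r1 <= s <= ln r2 -> forall t, cderivable F (cexp s t).
  move=> /andP[s1 s2] t; apply: dF; rewrite cabs_cexp.
  by rewrite -(lnK r10) -(lnK r20) !ler_expR s1 s2.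
have p0 := ltW (@twopi_gt0 R).
have lab : ln r1 <= ln r2 by rewrite ler_ln.
have := @boundary_flux_eq0 R U V (ln r1) (ln r2) 0 (2 * pi) lab p0.
have iU s : ln r1 <= s <= ln r2 -> mu.-integrable `[0, 2 * pi] (EFin \o U s).
  move=> sab; apply: integrable_circle; apply: ccontinuous_Re_cexp => t.
  by apply: cderivable_ccontinuous; exact: cab.
have iV t : 0 <= t <= 2 * pi -> mu.-integrable `[ln r1, ln r2] (EFin \o (V ^~ t)).
  move=> _; apply: continuous_compact_integrable; first exact: segment_compact.
  apply: continuous_in_subspaceT => s; rewrite inE /= in_itv /= => sab.
  apply/cvgrPdist_lt => e e0.
  have [h h0 H] := cderivable_ccontinuous (cab s sab t) e0.
  have [h1 h10 H1] := cexp_continuous s t h0.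
  near=> s'; rewrite distrC -cImB; apply: le_lt_trans (Im_le_cabs _) _.
  apply/H/H1; last by rewrite subrr normr0.
  by rewrite distrC; near: s'; exact: cvgr_dist_lt.
have cUV : conjugate_pair U V (ln r1) (ln r2) 0 (2 * pi).
  move=> s0 t0 sab tab; have [c Hc] := cderivable_polar (cab s0 sab t0).
  exists (complex.Re c), (complex.Im c) => e e0.
  have [h h0 H] := Hc _ e0; exists h => // s t _ _ /H{}H /H{}H.
  split; [apply: le_trans H; apply: le_trans (Re_le_cabs _)|
          apply: le_trans H; apply: le_trans (Im_le_cabs _)]; apply: eqW; congr `|_|.
    by rewrite /U cReB cReB cReM /=; ring.
  by rewrite /V cImB cImB cImM /=; ring.
move=> /(_ iU iV cUV); rewrite /boundary_flux.
have -> : (fun s => V s (2 * pi)) = (fun s => V s 0).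
  by apply/funext => s; rewrite /V /cexp expi_2pi expi0.
rewrite subrr subr0 /U => /subr0_eq.
have E r : 0 < r -> Int 0 (2 * pi) (fun t => complex.Re (F (cexp (ln r) t))) =
    Int 0 (2 * pi) (fun t => complex.Re (F (r%:C%C * expi t))).
  by move=> rp; apply: eq_Rintegral => t _; rewrite cexp_ln.
by rewrite !E // => ->.
Unshelve. all: by end_near. Qed.

(** Clipping the radius to [0, 1] makes the circular means below continuous
    functions on the whole line. *)
Let clip (x : R) := Num.max 0 (Num.min x 1).

Let clip_ge0 x : 0 <= clip x.
Proof. by rewrite le_max lexx. Qed.

Let clip_le1 x : clip x <= 1.
Proof. by rewrite ge_max ler01 ge_min lexx orbT. Qed.

Let clip_id x : 0 <= x <= 1 -> clip x = x.
Proof. by move=> /andP[x0 x1]; rewrite /clip min_l // max_r. Qed.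

Let clip_lip x y : `|clip x - clip y| <= `|x - y|.
Proof.
have clip0 u : u <= 0 -> clip u = 0.
  by move=> u0; rewrite /clip max_l // ge_min u0.
have clip1 u : 1 <= u -> clip u = 1.
  by move=> u1; rewrite /clip min_r // max_r.
have clipE u : [\/ u <= 0 /\ clip u = 0, 0 <= u <= 1 /\ clip u = u | 1 <= u /\ clip u = 1].
  have [u0|u0] : u <= 0 \/ 0 < u by case: (leP u 0); auto.
    by constructor 1; split => //; exact: clip0.
  have [u1|u1] : u <= 1 \/ 1 < u by case: (leP u 1); auto.
    by constructor 2; rewrite clip_id (ltW u0) u1.
  by constructor 3; split; [exact: ltW|apply: clip1; exact: ltW].
have N := ler_norm (x - y); have N' := ler_norm (y - x); rewrite distrC in N'.
by case: (clipE x) => -[? ->]; case: (clipE y) => -[? ->]; rewrite ler_norml; lra.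
Qed.

(** The circular means are continuous in the radius and, by annulus_mean,
    constant on either side of r, hence constant. Differentiability on the
    circle of radius r is left out because the difference quotient of
    poisson_formula0 has its removable singularity there. *)
Lemma mean_value F r : 0 <= r < 1 ->
  (forall z, cabs z <= 1 -> ccontinuous F z) ->
  (forall z, 0 < cabs z < 1 -> cabs z != r -> cderivable F z) ->
  Int 0 (2 * pi) (fun t => complex.Re (F (expi t))) = 2 * pi * complex.Re (F 0).
Proof.
move=> /andP[r0 r1] cF dF; have p0 := @twopi_gt0 R.
pose g x t := complex.Re (F ((clip x)%:C%C * expi t)).
have cg x t e : 0 < e -> exists2 h : R, 0 < h &
     forall x' t', `|x' - x| < h -> `|t' - t| < h -> `|g x' t' - g x t| < e.
  move=> e0; have x1 : cabs ((clip x)%:C%C * expi t) <= 1.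
    by rewrite cabsM cabs_real cabs_expi mulr1 ger0_norm.
  have [h h0 H] := cF _ x1 e e0.
  have h2 : 0 < h / 2 by rewrite divr_gt0.
  have [h1 h10 H1] := expi_continuous t h2.
  exists (Num.min h1 (h / 2)); first by rewrite lt_min h10.
  move=> x' t'; rewrite !lt_min => /andP[_ xx] /andP[/H1{}H1 _].
  rewrite /g -cReB; apply: le_lt_trans (Re_le_cabs _) _; apply: H.
  rewrite (_ : _ - _ = (clip x' - clip x)%:C%C * expi t' + (clip x)%:C%C * (expi t' - expi t)); last first.
    by rewrite rmorphB /=; ring.
  apply: le_lt_trans (cabsD _ _) _; rewrite !cabsM !cabs_real cabs_expi mulr1.
  have A1 := clip_lip x' x.
  have : `|clip x| * cabs (expi t' - expi t) <= 1 * cabs (expi t' - expi t).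
    by apply: ler_wpM2r; rewrite ?cabs_ge0 // ger0_norm.
  lra.
have cgx x : continuous (g x).
  move=> t; apply/cvgrPdist_lt => e e0; have [h h0 H] := cg x t e e0.
  near=> t'; rewrite distrC; apply: H; first by rewrite subrr normr0.
  by rewrite distrC; near: t'; exact: cvgr_dist_lt.
pose M x := Int 0 (2 * pi) (g x).
have cM : continuous M.
  move=> x; apply/cvgrPdist_lt => e e0.
  have e1 : 0 < e / (4 * pi) by rewrite divr_gt0 // mulr_gt0 // pi_gt0.
  have [h h0 H] := uniform_on_circle (cg x) e1.
  near=> x'; rewrite distrC.
  apply: (@le_lt_trans _ _ (e / (4 * pi) * (2 * pi))).
    have xx : `|x' - x| < h by rewrite distrC; near: x'; exact: cvgr_dist_lt.
    by apply: Rintegral_circle_near => // t tI; apply/ltW/H.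
  rewrite (_ : _ * _ = e / 2); last first.
    by have := lt0r_neq0 (pi_gt0 R); move: (pi : R) => p p0'; field.
  lra.
have ME x : 0 <= x <= 1 -> M x = Int 0 (2 * pi) (fun t => complex.Re (F (x%:C%C * expi t))).
  by move=> x01; rewrite /M /g clip_id.
have Mann x y : 0 < x -> x <= y -> y < 1 -> (forall u, x <= u <= y -> u != r) -> M x = M y.
  move=> x0 xy y1 xyr; rewrite !ME; [|lra|lra].
  apply: annulus_mean => // z /andP[xz zy]; apply: dF; first by lra.
  by apply: xyr; rewrite xz zy.
have M01 : M 0 = M 1.
  rewrite (_ : M 1 = M r); last first.
    apply/esym; apply: constant_closure => // x y rx xy y1; apply: Mann => //; first lra.
    by move=> u /andP[xu uy]; rewrite gt_eqF // (lt_le_trans rx).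
  have [->//|rn0] := eqVneq r 0.
  have rp : 0 < r by rewrite lt_neqAle eq_sym rn0.
  apply: constant_closure => // x y x0 xy yr; apply: Mann => //; first lra.
  by move=> u /andP[xu uy]; rewrite lt_eqF // (le_lt_trans uy).
have -> : Int 0 (2 * pi) (fun t => complex.Re (F (expi t))) = M 1.
  by rewrite ME ?lexx ?ler01 //; apply: eq_Rintegral => t _; rewrite mul1r.
rewrite -M01 ME ?lexx ?ler01 //.
under eq_Rintegral do rewrite mul0r.
rewrite Rintegral_cst //= lebesgue_measure_itv /= lte_fin p0 /=.
by rewrite subr0 mulrC.
Unshelve. all: by end_near. Qed.

End mean_value.

(** * The Poisson kernel *)

Section complex_bridge.
Context {R : realType}.
Local Notation C := (R[i]^o).
Implicit Types (F G : C -> C) (z w : C).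

Lemma posC (e : R[i]) : 0 < e -> exists2 h : R, 0 < h & e = h%:C%C.
Proof.
case: e => a b; rewrite ltcE /= => /andP[/eqP -> a0].
by exists a.
Qed.

Lemma ccontinuousM (F G : R[i] -> R[i]) z :
  ccontinuous F z -> ccontinuous G z -> ccontinuous (fun w => F w * G w) z.
Proof.
move=> cF cG e e0.
pose a := cabs (F z) + 1; pose b := cabs (G z) + 1.
have a0 : 0 < a by rewrite ltr_wpDl // cabs_ge0.
have b0 : 0 < b by rewrite ltr_wpDl // cabs_ge0.
have [h1 h10 H1] := cF _ (divr_gt0 (divr_gt0 e0 (ltr0n _ 2)) b0).
have e2 : 0 < Num.min 1 (e / 2 / a) by rewrite lt_min ltr01 !divr_gt0.
have [h2 h20 H2] := cG _ e2.
exists (Num.min h1 h2); first by rewrite lt_min h10.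
move=> w; rewrite lt_min => /andP[/H1{}H1 /H2].
rewrite lt_min => /andP[H2a H2b].
rewrite (_ : _ - _ = (F w - F z) * G w + F z * (G w - G z)); last ring.
apply: le_lt_trans (cabsD _ _) _; rewrite !cabsM (splitr e).
have Gb : cabs (G w) <= b.
  rewrite -(subrK (G z) (G w)); apply: le_trans (cabsD _ _) _; rewrite /b; lra.
apply: ltr_leD.
  apply: (@le_lt_trans _ _ (cabs (F w - F z) * b)); first by rewrite ler_wpM2l // cabs_ge0.
  by rewrite -ltr_pdivlMr.
apply: (@le_trans _ _ (a * (e / 2 / a))); last by rewrite mulrCA mulfV ?gt_eqF // mulr1.
by apply: ler_pM; rewrite ?cabs_ge0 ?lerDl // ltW.
Qed.

Lemma cderivable_local (F G : R[i] -> R[i]) z (d : R) : 0 < d ->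
  (forall w, cabs (w - z) < d -> G w = F w) -> cderivable F z -> cderivable G z.
Proof.
move=> d0 FG [c H]; exists c => e /H[h h0 Hh].
exists (Num.min h d); first by rewrite lt_min h0.
move=> w; rewrite lt_min => /andP[/Hh{}Hh wd].
by rewrite !FG // subrr cabs0.
Qed.

Lemma cderivableP F z : cderivable F z <-> derivable F z 1.
Proof.
split=> [[c H]|H].
  apply/cvg_ex; exists c; apply/cvgrPdist_le => _ /posC[e e0 ->].
  have [h h0 Hh] := H e e0.
  apply/nbhs_ballP; exists h%:C%C; first by rewrite /= ltcR.
  move=> w; rewrite /= /ball_ [X in X < _ -> _]normC_cabs ltcR sub0r cabsN => wh w0.
  rewrite [X in X <= _]normC_cabs lecR.
  have := Hh (w + z); rewrite addrK => /(_ wh).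
  rewrite /GRing.scale /= mulr1 => {}Hh.
  rewrite (_ : c - _ = - w^-1 * (F (w + z) - F z - c * w)); last by field.
  rewrite cabsM cabsN cabsV mulrC ler_pdivrMr //.
  by rewrite lt_neqAle cabs_ge0 eq_sym cabs_eq0 w0.
have {}H : (fun h : C => h^-1 *: ((F \o shift z) (h *: (1 : C)) - F z)) @ (0 : C)^' --> 'D_1 F z.
  exact: H.
exists ('D_1 F z) => e e0.
have : 0 < e%:C%C :> R[i] by rewrite ltcR.
move: H => /cvgrPdist_le H /H[_ /posC[h h0 ->] Hh]; exists h => // w wz.
have [->|wz0] := eqVneq w z; first by rewrite !subrr mulr0 subrr cabs0 mulr0.
have := Hh (w - z).
rewrite /= /ball_ [X in (X < _ -> _) -> _]normC_cabs ltcR sub0r cabsN subr_eq0 => /(_ wz wz0).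
rewrite [X in X <= _ -> _]normC_cabs lecR /GRing.scale /= mulr1 subrK => {}Hh.
have wz1 : w - z != 0 by rewrite subr_eq0.
rewrite (_ : F w - F z - _ = - (w - z) * ('D_1 F z - (w - z)^-1 * (F w - F z))); last by field.
by rewrite cabsM cabsN mulrC ler_wpM2r // cabs_ge0.
Qed.

End complex_bridge.

Section poisson.
Context {R : realType}.
Local Notation C := (R[i]^o).
Local Notation mu := (@lebesgue_measure R).
Local Notation Int u v f := (\int[mu]_(x in `[u, v]) f x).
Implicit Types (r s t : R).

Definition poisson r t : R := (1 - r ^+ 2) / (1 - 2 * r * cos t + r ^+ 2).

Lemma poisson_den_gt0 r t : 0 <= r < 1 -> 0 < 1 - 2 * r * cos t + r ^+ 2.
Proof.
move=> /andP[r0 r1]; apply: (@lt_le_trans _ _ ((1 - r) ^+ 2)).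
  by rewrite exprn_gt0 // subr_gt0.
have : r * cos t <= r * 1 by rewrite ler_wpM2l // cos_le1.
by rewrite sqrrB expr1n; lra.
Qed.

Lemma poisson_gt0 r t : 0 <= r < 1 -> 0 < poisson r t.
Proof.
move=> r01; rewrite divr_gt0 ?poisson_den_gt0 // subr_gt0 expr_lt1 //; lra.
Qed.

Lemma poisson_even r t : poisson r (- t) = poisson r t.
Proof. by rewrite /poisson cosN. Qed.

Lemma circular_poisson r : circular (poisson r).
Proof. by move=> x y [xy _]; rewrite /poisson xy. Qed.

(** If u <= v, the kernel of radius uv is at most 8 times the kernel of radius
    u: its numerator is at most 2 times as large, and its denominator at least
    a fourth. *)
Lemma poisson_bound r s t : 0 <= r < 1 -> 0 <= s < 1 ->
  poisson (r * s) t <= 8 * (poisson r t + poisson s t).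
Proof.
have main u v : 0 <= u < 1 -> u <= v -> v < 1 -> poisson (u * v) t <= 8 * poisson u t.
  move=> u01 uv v1.
  have uv01 : 0 <= u * v < 1.
    by rewrite mulr_ge0 ?mulr_ilt1 //; lra.
  have c1 := cos_le1 t; have c2 := cos_geN1 t.
  have w0 : u * u <= u * v by rewrite ler_wpM2l //; lra.
  have w1 : u * v <= u by rewrite ler_piMr //; lra.
  have A0 := poisson_den_gt0 t uv01; have B0 := poisson_den_gt0 t u01.
  rewrite /poisson; move: w0 w1 A0 B0 c1 c2 uv01; move: (u * v) (cos t) => w c w0 w1 A0 B0 c1 c2 w01.
  have N : 1 - w ^+ 2 <= 2 * (1 - u ^+ 2).
    have : (u * u) ^+ 2 <= w ^+ 2 by rewrite ler_pXn2r ?nnegrE //; nra.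
    have : u * u <= 1 by nra.
    by rewrite !expr2; nra.
  have D : 1 - 2 * u * c + u ^+ 2 <= 4 * (1 - 2 * w * c + w ^+ 2).
    have V1 : 0 <= (1 + c) * (4 * (1 - w) ^+ 2 - (1 - u) ^+ 2).
      by apply: mulr_ge0; [lra|rewrite !expr2; nra].
    have V2 : 0 <= (1 - c) * (4 * (1 + w) ^+ 2 - (1 + u) ^+ 2).
      by apply: mulr_ge0; [lra|rewrite !expr2; nra].
    by rewrite !expr2 in V1 V2 *; lra.
  move: N D A0 B0; move: (1 - 2 * u * c + u ^+ 2) (1 - 2 * w * c + w ^+ 2) => B A N D A0 B0.
  have b0 : 0 <= 1 - u ^+ 2 by rewrite expr2; nra.
  apply: (@le_trans _ _ (2 * (1 - u ^+ 2) / A)).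
    by rewrite ler_pM2r // invr_gt0.
  rewrite (_ : _ / A = 8 * ((1 - u ^+ 2) / (4 * A))); last by field; rewrite gt_eqF.
  by rewrite ler_pM2l // ler_wpM2l // lef_pV2 // posrE // mulr_gt0.
move=> r01 s01; have [rs|/ltW sr] := leP r s.
  apply: le_trans (main r s r01 rs _) _; first lra.
  by rewrite ler_pM2l // lerDl ltW // poisson_gt0.
rewrite mulrC; apply: le_trans (main s r s01 sr _) _; first lra.
by rewrite ler_pM2l // lerDr ltW // poisson_gt0.
Qed.

Lemma continuous_poisson r : 0 <= r < 1 -> continuous (poisson r).
Proof.
move=> r01 t; apply: cvgM; first exact: cvg_cst.
apply: cvgV; first by rewrite gt_eqF // poisson_den_gt0.
apply: cvgD; last exact: cvg_cst.
apply: cvgB; first exact: cvg_cst.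
by apply: cvgM; [exact: cvg_cst|exact: continuous_cos].
Qed.

Lemma expi_neq0 t : expi t != 0 :> R[i].
Proof. by rewrite -cabs_eq0 cabs_expi oner_eq0. Qed.

Lemma expi_conjK t : expi t * (expi t)^* = 1 :> R[i].
Proof. by rewrite -expiN -expiD subrr expi0. Qed.

Lemma poisson_denE r t : (1 - 2 * r * cos t + r ^+ 2)%:C%C =
  (1 - r%:C%C * (expi t)^*) * (1 - r%:C%C * expi t) :> R[i].
Proof.
have eE := expi_conjK t.
have cE : (2 * cos t)%:C%C = expi t + (expi t)^*.
  by apply/eqP; rewrite eq_complex /= subrr !eqxx mulr_natl mulr2n eqxx.
rewrite (_ : 1 - 2 * r * cos t + r ^+ 2 = 1 - r * (2 * cos t) + r * r); last ring.
rewrite rmorphD rmorphB rmorph1 (rmorphM _ r r) (rmorphM _ r (2 * cos t)) /= cE.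
move: eE; move: (expi t) => e; move: (e^*) => e' eE.
by rewrite mulrBr mulr1 !mulrBl mul1r mulrACA [e' * e]mulrC eE; ring.
Qed.

Lemma poisson_complex r t : 0 <= r < 1 ->
  (poisson r t)%:C%C = expi t * (1 - r ^+ 2)%:C%C / ((expi t - r%:C%C) * (1 - r%:C%C * expi t)) :> R[i].
Proof.
move=> r01; have D0 := lt0r_neq0 (poisson_den_gt0 t r01).
have eE := expi_conjK t; have e0 := expi_neq0 t.
have DC0 : (1 - 2 * r * cos t + r ^+ 2)%:C%C != 0 :> R[i].
  by rewrite -[0]/((0 : R)%:C%C) (inj_eq (@complexI _)).
have rE : expi t - r%:C%C = expi t * (1 - r%:C%C * (expi t)^*).
  by rewrite mulrBr mulr1 mulrCA eE mulr1.
rewrite rE -[_ * _ * (1 - r%:C%C * expi t)]mulrA -poisson_denE /poisson rmorphM fmorphV /=.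
move: e0 DC0; move: (expi t) ((1 - 2 * r * cos t + r ^+ 2)%:C%C) ((1 - r ^+ 2)%:C%C) => e D N e0 D0'.
rewrite invfM mulrACA mulfV // mul1r.
by [].
Qed.

(** The mean value property of F(z) = (f(z) - f(r)) z (1 - r^2) / ((z - r) (1
    - r z)), which vanishes at 0. On the unit circle the factor of f(z) - f(r)
    is the Poisson kernel (poisson_complex), which is real. *)
Lemma poisson_formula0 (f : R[i] -> R[i]) r : 0 <= r < 1 ->
  (forall z, cabs z <= 1 -> ccontinuous f z) ->
  (forall z, cabs z < 1 -> cderivable f z) ->
  Int 0 (2 * pi) (fun t => (complex.Re (f (expi t)) - complex.Re (f r%:C%C)) * poisson r t) = 0.
Proof.
move=> r01 cf df; pose l : R[i] := r%:C%C.
have l1 : cabs l < 1 by rewrite cabs_real ger0_norm; lra.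
have [c Hc] := df l l1.
pose q z := if z == l then c else (f z - f l) / (z - l).
pose k z : R[i] := z * ((1 - r ^+ 2)%:C%C / (1 - l * z)).
pose F z := q z * k z.
have den z : cabs z <= 1 -> 1 - l * z != 0.
  move=> z1; apply/negP => /eqP/subr0_eq/(congr1 cabs).
  rewrite cabs1 cabsM => E.
  have : cabs l * cabs z <= cabs l * 1 by apply: ler_wpM2l => //; exact: cabs_ge0.
  lra.
have dk z : cabs z <= 1 -> derivable (k : C -> C) z 1.
  move=> z1; apply: derivableM => //; apply: derivableM => //.
  apply: derivableV; first exact: den.
  by apply: derivableB => //; apply: derivableM.
have dB z : derivable ((fun w : C => w - l : C) : C -> C) z 1.
  apply: (cderivableP (fun w => w - l) z).1; exists 1 => e e0; exists 1 => // w _.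
  rewrite (_ : _ - _ = 0); last ring.
  by rewrite cabs0 mulr_ge0 ?cabs_ge0 // ltW.
have dinv z : z != l -> derivable ((fun w => (w - l)^-1) : C -> C) z 1.
  move=> zl; have zl0 : (z : C) - l != 0 by rewrite subr_eq0.
  exact: (@derivableV R[i] C (fun w : C => w - l : C) z 1 zl0 (dB z)).
have ck z : cabs z <= 1 -> ccontinuous k z.
  by move=> /dk/cderivableP/cderivable_ccontinuous.
have cq z : cabs z <= 1 -> ccontinuous q z.
  move=> z1; have [->|zl] := eqVneq z l.
    move=> e e0; have e2 : 0 < e / 2 by rewrite divr_gt0.
    have [h h0 H] := Hc _ e2; exists h => // w wl.
    rewrite /q eqxx; case: eqVneq => [_|wl0]; first by rewrite subrr cabs0.
    have wl1 : w - l != 0 by rewrite subr_eq0.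
    rewrite (_ : _ - c = (f w - f l - c * (w - l)) / (w - l)); last by field.
    rewrite cabsM cabsV ltr_pdivrMr; last by rewrite lt_neqAle eq_sym cabs_eq0 wl1 cabs_ge0.
    apply: le_lt_trans (H w wl) _; rewrite ltr_pM2r; first lra.
    by rewrite lt_neqAle eq_sym cabs_eq0 wl1 cabs_ge0.
  have C1 : ccontinuous (fun w => (f w - f l) * (w - l)^-1) z.
    apply: ccontinuousM.
      move=> e /(cf z z1 e)[h h0 H]; exists h => // w /H.
      by rewrite opprB addrA subrK.
    apply: cderivable_ccontinuous; apply/cderivableP.
    exact: dinv.
  move=> e e0; have [h h0 H] := C1 e e0.
  have d0 : 0 < cabs (z - l) by rewrite lt_neqAle eq_sym cabs_eq0 subr_eq0 zl cabs_ge0.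
  exists (Num.min h (cabs (z - l))); first by rewrite lt_min h0.
  move=> w; rewrite lt_min => /andP[/H{}H wz]; rewrite /q (negbTE zl) ifN //.
  by apply: contraTneq wz => ->; rewrite cabsC ltxx.
have H := @mean_value R F r r01 _ _.
have : Int 0 (2 * pi) (fun t => complex.Re (F (expi t))) = 2 * pi * complex.Re (F 0).
  apply: H => [z z1|z /andP[z0 z1] zr].
    by apply: ccontinuousM; [exact: cq|exact: ck].
  have zl : z != l.
    by apply: contra_neq zr => ->; rewrite cabs_real ger0_norm; lra.
  have d0 : 0 < cabs (z - l) by rewrite lt_neqAle eq_sym cabs_eq0 subr_eq0 zl cabs_ge0.
  apply: (@cderivable_local R (fun w => (f w - f l) * (w - l)^-1 * k w) F z (cabs (z - l))) => //.
    move=> w wz; rewrite /F /q ifN //.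
    by apply: contraTneq wz => ->; rewrite cabsC ltxx.
  apply/cderivableP; apply: derivableM; last by apply: dk; exact: ltW.
  apply: derivableM; last exact: dinv.
  apply/cderivableP; have [c' H'] := df z z1; exists c' => e /H'[h h0 Hh].
  by exists h => // w /Hh; rewrite opprB addrA subrK.
rewrite /F /k mul0r mulr0 /= mulr0 => {}H; rewrite -[RHS]H.
apply: eq_Rintegral => t _.
rewrite -cReB.
have rl : expi t != l.
  apply/negP => /eqP/(congr1 cabs); rewrite cabs_expi; lra.
rewrite /q (negbTE rl).
have -> : (f (expi t) - f l) / (expi t - l) * (expi t * ((1 - r ^+ 2)%:C%C / (1 - l * expi t)))
  = (f (expi t) - f l) * (poisson r t)%:C%C.
  rewrite poisson_complex //.
  by rewrite /l invfM; ring.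
by rewrite cReM /= mulr0 subr0.
Qed.

End poisson.

Section poisson_formula.
Context {R : realType}.
Local Notation C := (R[i]^o).
Local Notation mu := (@lebesgue_measure R).
Local Notation Int u v f := (\int[mu]_(x in `[u, v]) f x).
Implicit Types (r s t : R).

(** The function (1 + rz) / (1 - rz), whose real part on the unit circle is
    the Poisson kernel (Re_herglotz). *)
Definition herglotz r (z : R[i]) : R[i] := 2 / (1 - r%:C%C * z) - 1.

Lemma herglotz_den r z : 0 <= r < 1 -> cabs z <= 1 -> 1 - r%:C%C * z != 0 :> R[i].
Proof.
move=> r01 z1; apply/negP => /eqP/subr0_eq/(congr1 cabs).
rewrite cabs1 cabsM cabs_real ger0_norm; last lra.
have : r * cabs z <= r * 1 by apply: ler_wpM2l => //; lra.
lra.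
Qed.

Lemma cderivableZ (f : R[i] -> R[i]) (a z : R[i]) :
  cderivable f (a * z) -> cderivable (fun w => f (a * w)) z.
Proof.
move=> [c H]; exists (c * a) => e e0.
pose k := cabs a + 1; have k0 : 0 < k by rewrite ltr_wpDl // cabs_ge0.
have [h h0 Hh] := H _ (divr_gt0 e0 k0).
exists (h / k); first by rewrite divr_gt0.
move=> w wz; have aw : cabs (a * w - a * z) <= k * cabs (w - z).
  by rewrite -mulrBr cabsM ler_wpM2r ?cabs_ge0 // lerDl.
have /Hh : cabs (a * w - a * z) < h.
  by apply: le_lt_trans aw _; rewrite mulrC -ltr_pdivlMr.
rewrite -mulrBr mulrA => /le_trans; apply.
apply: (@le_trans _ _ (e / k * (k * cabs (w - z)))).
  by rewrite ler_wpM2l ?mulrBr // ltW // divr_gt0.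
by rewrite mulrA divfK ?gt_eqF.
Qed.

Lemma cderivableMl (f : R[i] -> R[i]) (a z : R[i]) :
  cderivable f z -> cderivable (fun w => a * f w) z.
Proof.
move=> [c H]; exists (a * c) => e e0.
pose k := cabs a + 1; have k0 : 0 < k by rewrite ltr_wpDl // cabs_ge0.
have [h h0 Hh] := H _ (divr_gt0 e0 k0).
exists h => // w /Hh {}Hh.
rewrite -mulrA -!mulrBr cabsM.
apply: (@le_trans _ _ (k * (e / k * cabs (w - z)))).
  by apply: ler_pM; rewrite ?cabs_ge0 // lerDl.
by apply: eqW; field; rewrite gt_eqF.
Qed.

Lemma cderivableBr (f : R[i] -> R[i]) (a z : R[i]) :
  cderivable f z -> cderivable (fun w => f w - a) z.
Proof.
move=> [c H]; exists c => e /H[h h0 Hh]; exists h => // w /Hh.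
by rewrite opprB addrA subrK.
Qed.

Lemma cderivable_herglotz r z : 0 <= r < 1 -> cabs z <= 1 -> cderivable (herglotz r) z.
Proof.
move=> r01 z1.
have D1 : derivable (fun w : C => 1 - r%:C%C * w : C) z 1.
  by apply: derivableB => //; apply: derivableM.
have /cderivableP D2 := @derivableV R[i] C _ z 1 (herglotz_den r01 z1) D1.
exact: cderivableBr (cderivableMl 2 D2).
Qed.

Lemma Re_herglotz r s t : 0 <= r * s < 1 ->
  complex.Re (herglotz r (s%:C%C * expi t)) = poisson (r * s) t.
Proof.
move=> r01; have D0 := lt0r_neq0 (poisson_den_gt0 t r01).
have -> : herglotz r (s%:C%C * expi t) = 2 * (1 - (r * s)%:C%C * expi t)^-1 - 1.
  by rewrite /herglotz rmorphM /= mulrA.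
move: (r * s) D0 r01 => q D0 q01.
have DE := poisson_denE q t.
have n0 : 1 - q%:C%C * expi t != 0 :> R[i].
  by apply: herglotz_den => //; rewrite cabs_expi.
have -> : (1 - q%:C%C * expi t)^-1 = (1 - q%:C%C * (expi t)^*) * ((1 - 2 * q * cos t + q ^+ 2)^-1)%:C%C.
  have D0' : (1 - 2 * q * cos t + q ^+ 2)%:C%C != 0 :> R[i].
    by rewrite -[0]/((0 : R)%:C%C) (inj_eq (@complexI _)).
  rewrite fmorphV /=; apply: (mulIf n0); rewrite mulVf // mulrAC -DE mulfV //.
rewrite cReB !cReM !cImM /= /poisson.
by rewrite !(mul0r, mulr0, subr0, addr0, mul1r, mulr1, oppr0, sub0r); field.
Qed.

Lemma integrable_circle_mean (g : R -> R) : continuous g ->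
  circle_mean.-integrable setT (EFin \o g).
Proof.
move=> cg; have mg := continuous_measurable_fun cg.
apply/integrableP; split; first exact/measurable_EFinP.
rewrite ge0_circle_meanE //; last first.
  by apply: measurableT_comp => //; exact/measurable_EFinP.
have /integrableP[_ H] := integrable_circle cg.
by rewrite lte_mul_pinfty // lee_fin invr_ge0 ltW // twopi_gt0.
Qed.

Lemma poisson_mean1 r : 0 <= r < 1 -> \int[circle_mean]_t poisson r t = 1.
Proof.
move=> r01.
have cp : measurable_fun [set: R] (poisson r).
  by apply: continuous_measurable_fun; exact: continuous_poisson.
rewrite circle_RintegralE //.
have := @mean_value R (herglotz r) 0 _ _ _.
rewrite lexx ltr01 => /(_ isT) H.
have {}H : Int 0 (2 * pi) (fun t => complex.Re (herglotz r (expi t))) = 2 * pi * complex.Re (herglotz r 0).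
  apply: H => [z z1|z /andP[_ z1] _].
    by apply: cderivable_ccontinuous; exact: cderivable_herglotz.
  by apply: cderivable_herglotz => //; exact: ltW.
have E : (2 * pi)^-1 * Int 0 (2 * pi) (poisson r) = (2 * pi)^-1 * (2 * pi * complex.Re (herglotz r 0)).
  congr (_ * _); rewrite -H; apply: eq_Rintegral => t _.
  by have := @Re_herglotz r 1 t; rewrite mulr1 mul1r => ->.
rewrite E mulKf ?gt_eqF ?twopi_gt0 // /herglotz mulr0 subr0 divr1 /=.
by rewrite addrK.
Qed.

Lemma poisson_formula (f : R[i] -> R[i]) r a : 0 <= r < 1 ->
  (forall z, cabs z <= 1 -> ccontinuous f z) ->
  (forall z, cabs z < 1 -> cderivable f z) ->
  complex.Re (f (r%:C%C * expi a)) =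
  \int[circle_mean]_t (complex.Re (f (expi (t + a))) * poisson r t).
Proof.
move=> r01 cf df.
pose g z := f (expi a * z).
have cg z : cabs z <= 1 -> ccontinuous g z.
  move=> z1 e e0.
  have [|h h0 H] := cf (expi a * z) _ e e0; first by rewrite cabsM cabs_expi mul1r.
  by exists h => // w wz; apply: H; rewrite -mulrBr cabsM cabs_expi mul1r.
have dg z : cabs z < 1 -> cderivable g z.
  by move=> z1; apply: cderivableZ; apply: df; rewrite cabsM cabs_expi mul1r.
have gE t : g (expi t) = f (expi (t + a)) by rewrite /g addrC expiD.
have cRg : continuous (fun t => complex.Re (g (expi t))).
  have : continuous (fun t => complex.Re (g (cexp 0 t))).
    by apply: ccontinuous_Re_cexp => t; apply: cg; rewrite cabs_cexp expR0.
  by under eq_fun do rewrite cexp0.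
have cRe : continuous (fun t => complex.Re (f (expi (t + a)))).
  by under eq_fun do rewrite -gE.
have cP := continuous_poisson r01.
have i1 : circle_mean.-integrable setT (EFin \o (fun t => complex.Re (f (expi (t + a))) * poisson r t)).
  by apply: integrable_circle_mean => t; apply: cvgM; [exact: cRe|exact: cP].
have i2 : circle_mean.-integrable setT (EFin \o (fun t => complex.Re (g r%:C%C) * poisson r t)).
  by apply: integrable_circle_mean => t; apply: cvgM; [exact: cvg_cst|exact: cP].
have := poisson_formula0 r01 cg dg.
move=> /(congr1 ( *%R (2 * pi)^-1)); rewrite mulr0 -circle_RintegralE; last first.
  apply: continuous_measurable_fun => t; apply: cvgM; last exact: cP.
  by apply: cvgB; [exact: cRg|exact: cvg_cst].
under eq_Rintegral do rewrite mulrBl gE.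
rewrite RintegralB // RintegralZl //; last exact: integrable_circle_mean.
rewrite poisson_mean1 // mulr1 => /eqP; rewrite subr_eq0 => /eqP ->.
by rewrite /g mulrC.
Qed.

(** The dilated function z |-> f(sz) is differentiable on the closed disc. *)
Lemma poisson_formula_disc (f : R[i] -> R[i]) r s a : 0 <= r < 1 -> 0 <= s < 1 ->
  (forall z, cabs z < 1 -> cderivable f z) ->
  complex.Re (f ((r * s)%:C%C * expi a)) =
  \int[circle_mean]_t (complex.Re (f (s%:C%C * expi (t + a))) * poisson r t).
Proof.
move=> r01 s01 df.
have H z : cabs z <= 1 -> cderivable (fun w => f (s%:C%C * w)) z.
  move=> z1; apply: cderivableZ; apply: df.
  rewrite cabsM cabs_real ger0_norm; last lra.
  have : s * cabs z <= s * 1 by apply: ler_wpM2l => //; lra.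
  lra.
rewrite [r * s]mulrC rmorphM /= -mulrA.
apply: (@poisson_formula (fun w => f (s%:C%C * w))) => // z z1.
  by apply: cderivable_ccontinuous; exact: H.
by apply: H; exact: ltW.
Qed.

(** The Poisson formula for the Herglotz function. *)
Lemma poisson_convolution r s a : 0 <= r < 1 -> 0 <= s < 1 ->
  \int[circle_mean]_t (poisson r (t + a) * poisson s t) = poisson (r * s) a.
Proof.
move=> r01 s01.
have := @poisson_formula (herglotz r) s a s01.
have rs : 0 <= r * s < 1 by rewrite mulr_ge0 ?mulr_ilt1 //; lra.
rewrite Re_herglotz // => ->.
- apply: eq_Rintegral => t _; congr (_ * _).
  by have := @Re_herglotz r 1 (t + a); rewrite mulr1 mul1r => ->.
- by move=> z z1; apply: cderivable_ccontinuous; exact: cderivable_herglotz.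
- by move=> z z1; apply: cderivable_herglotz => //; exact: ltW.
Qed.

End poisson_formula.

(** * The linearized maximal inequality *)

Lemma integral_prob_cst d (Y : measurableType d) (R : realType) (P : probability Y R) (k : R) :
  (\int[P]_x k%:E = k%:E)%E.
Proof.
rewrite integral_cst // -[RHS]mule1; congr (_ * _)%E.
exact: probability_setT.
Qed.

Section maximal.
Context {R : realType} (n : nat).
Local Notation X := (n.-tuple R).
Local Notation T := (@torus R n).
Local Notation c := (@circle_mean R).

(** The inverse of the positive denominator is written as an exponential of a
    logarithm to get its measurability. *)
Lemma measurable_poisson d (Y : measurableType d) (f g : Y -> R) :
  (forall y, 0 <= f y < 1) -> measurable_fun setT f -> measurable_fun setT g ->
  measurable_fun setT (fun y => poisson (f y) (g y)).
Proof.
move=> f01 mf mg.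
pose D y := 1 - 2 * f y * cos (g y) + f y ^+ 2.
have -> : (fun y => poisson (f y) (g y)) = (fun y => (1 - f y ^+ 2) * expR (- ln (D y))).
  by apply/funext => y; rewrite expRN lnK // posrE poisson_den_gt0.
have mD : measurable_fun setT D.
  apply: measurable_funD; last exact: measurable_funX.
  apply: measurable_funB => //; apply: measurable_funM; first exact: measurable_funM.
  by apply: measurableT_comp => //; apply: continuous_measurable_fun; exact: continuous_cos.
apply: measurable_funM.
  by apply: measurable_funB => //; exact: measurable_funX.
apply: measurableT_comp => //; apply: measurableT_comp => //.
exact: measurableT_comp.
Qed.

Lemma ge0_fubini_swap (F : X -> R -> \bar R) :
  measurable_fun setT (fun p : X * R => F p.1 p.2) -> (forall t x, 0 <= F t x)%E ->
  (\int[T]_t \int[c]_x F t x = \int[c]_x \int[T]_t F t x)%E.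
Proof.
move=> mF F0; exact: (@fubini_tonelli _ _ _ _ _ T c (fun p => F p.1 p.2)).
Qed.

Lemma ge0_circle_swap (F : R -> R -> \bar R) :
  measurable_fun setT (fun p : R * R => F p.1 p.2) -> (forall t x, 0 <= F t x)%E ->
  (\int[c]_t \int[c]_x F t x = \int[c]_x \int[c]_t F t x)%E.
Proof.
move=> mF F0; exact: (@fubini_tonelli _ _ _ _ _ c c (fun p => F p.1 p.2)).
Qed.

Variables (r : X -> R) (rho : R).
Hypotheses (mr : measurable_fun setT r) (pr : periodic r).
Hypotheses (r_ge0 : forall t, 0 <= r t) (r_le : forall t, r t <= rho) (rho1 : rho < 1).

Let r01 t : 0 <= r t < 1.
Proof. by rewrite r_ge0 (le_lt_trans (r_le t)). Qed.

Let p t x := poisson (r t) x.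

Let p_ge0 t x : 0 <= p t x.
Proof. exact/ltW/poisson_gt0. Qed.

Lemma poisson_le_bound s x : 0 <= s <= rho -> poisson s x <= (1 - rho) ^- 2.
Proof.
move=> /andP[s0 sr]; rewrite /poisson.
have rh1 := rho1; have s01 : 0 <= s < 1 by lra.
have D : (1 - rho) ^+ 2 <= 1 - 2 * s * cos x + s ^+ 2.
  have : s * cos x <= s * 1 by rewrite ler_wpM2l // cos_le1.
  have : (1 - rho) ^+ 2 <= (1 - s) ^+ 2 by rewrite ler_pXn2r ?nnegrE //; lra.
  rewrite (sqrrB 1 s) expr1n; lra.
rewrite -[leRHS]mul1r; apply: ler_pM.
- by rewrite subr_ge0 expr_le1 //; lra.
- by rewrite invr_ge0 ltW // poisson_den_gt0.
- by rewrite lerBlDr lerDl sqr_ge0.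
- by rewrite lef_pV2 // posrE ?poisson_den_gt0 // exprn_gt0; lra.
Qed.

Let mp : measurable_fun setT (fun q : X * R => p q.1 q.2).
Proof.
apply: measurable_poisson; [by move=> y; exact: r01| |exact: measurable_snd].
exact: (measurableT_comp mr measurable_fst).
Qed.

Lemma tshiftD (t : X) x y : tshift (tshift t x) y = tshift t (x + y).
Proof. by apply: eq_from_tnth => i; rewrite !tnth_tshift addrA. Qed.

Lemma tshift0 (t : X) : tshift t 0 = t.
Proof. by apply: eq_from_tnth => i; rewrite !tnth_tshift addr0. Qed.

Let mshift : measurable_fun setT (fun q : X * R => tshift q.1 q.2).
Proof. by apply: measurable_tshift2; [exact: measurable_fst|exact: measurable_snd]. Qed.

Let mshiftN : measurable_fun setT (fun q : X * R => tshift q.1 (- q.2)).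
Proof.
apply: measurable_tshift2; first exact: measurable_fst.
by apply: measurableT_comp => //; exact: measurable_snd.
Qed.

(** The average of g along the flow, with respect to the Poisson kernel of a
    radius r(t) that depends on the point. For suitable radii it dominates a
    maximal function (finite_maximal_bound). *)
Definition poisson_average (g : X -> R) (t : X) : \bar R :=
  (\int[c]_x (p t x * g (tshift t x))%:E)%E.

(** The adjoint of poisson_average in L^2 of the torus (poisson_duality). *)
Definition poisson_adjoint (h : X -> R) (t : X) : \bar R :=
  (\int[c]_x (h (tshift t (- x)) * p (tshift t (- x)) x)%:E)%E.

Section dual.
Variables (h : X -> R) (M : R).
Hypotheses (mh : measurable_fun setT h) (ph : periodic h).
Hypotheses (h_ge0 : forall t, 0 <= h t) (h_le : forall t, h t <= M).

Let mavg : measurable_fun setT (fun q : X * R => p q.1 q.2 * h (tshift q.1 q.2)).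
Proof. by apply: measurable_funM => //; apply: measurableT_comp. Qed.

Let madj : measurable_fun setT
  (fun q : X * R => h (tshift q.1 (- q.2)) * p (tshift q.1 (- q.2)) q.2).
Proof.
apply: measurable_funM; first exact: measurableT_comp.
apply: measurable_poisson; [by move=> y; exact: r01| |exact: measurable_snd].
exact: measurableT_comp.
Qed.

Lemma measurable_poisson_average : measurable_fun setT (poisson_average h).
Proof.
apply: (measurable_fun_fubini_tonelli_F (fun q => (p q.1 q.2 * h (tshift q.1 q.2))%:E)).
  exact/measurable_EFinP.
by move=> q; rewrite lee_fin mulr_ge0.
Qed.

Lemma measurable_poisson_adjoint : measurable_fun setT (poisson_adjoint h).
Proof.
apply: (@measurable_fun_fubini_tonelli_F _ _ _ _ _ c (fun q : X * R =>
  (h (tshift q.1 (- q.2)) * p (tshift q.1 (- q.2)) q.2)%:E)).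
  exact/measurable_EFinP.
by move=> q; rewrite lee_fin mulr_ge0.
Qed.

Lemma poisson_average_ge0 t : (0 <= poisson_average h t)%E.
Proof. by apply: integral_ge0 => x _; rewrite lee_fin mulr_ge0. Qed.

Lemma poisson_adjoint_ge0 t : (0 <= poisson_adjoint h t)%E.
Proof. by apply: integral_ge0 => x _; rewrite lee_fin mulr_ge0. Qed.

Lemma periodic_poisson_adjoint : periodic (poisson_adjoint h).
Proof.
move=> t s ts; apply: eq_integral => x _; congr (_ %:E).
have E i : expi (tnth (tshift t (- x)) i) = expi (tnth (tshift s (- x)) i).
  by rewrite !tnth_tshift !expiD ts.
by rewrite (ph E) /p (pr E).
Qed.

Lemma periodic_poisson_average : periodic (poisson_average h).
Proof.
move=> t s ts; apply: eq_integral => x _; congr (_ %:E).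
have E i : expi (tnth (tshift t x) i) = expi (tnth (tshift s x) i).
  by rewrite !tnth_tshift !expiD ts.
by rewrite (ph E) /p (pr ts).
Qed.

Lemma poisson_mass t : (\int[c]_x (p t x)%:E = 1)%E.
Proof.
have /integrable_circle_mean iP := continuous_poisson (r01 t).
rewrite -[LHS]fineK; last exact: integrable_fin_num.
by rewrite -[fine _]/(Rintegral _ _ _) poisson_mean1.
Qed.

Lemma poisson_average_le t : (poisson_average h t <= M%:E)%E.
Proof.
have M0 : 0 <= M by apply: le_trans (h_le t).
have mpt : measurable_fun setT (p t).
  by apply: continuous_measurable_fun; exact: continuous_poisson.
apply: (@le_trans _ _ (\int[c]_x (M%:E * (p t x)%:E))%E).
  apply: ge0_le_integral => //.
  - by move=> x _; rewrite lee_fin mulr_ge0.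
  - by apply/measurable_EFinP; exact: (measurableT_comp mavg (measurable_pair1 t)).
  - by apply/measurable_EFinP; exact: measurable_funM.
  - by move=> x _; rewrite lee_fin mulrC ler_wpM2r.
rewrite ge0_integralZl_EFin // ?poisson_mass ?mule1 //.
  by move=> x _; rewrite lee_fin.
exact/measurable_EFinP.
Qed.

Lemma poisson_adjoint_le t : (poisson_adjoint h t <= (M * (1 - rho) ^- 2)%:E)%E.
Proof.
have M0 : 0 <= M by apply: le_trans (h_le t).
apply: (@le_trans _ _ (\int[c]_x (M * (1 - rho) ^- 2)%:E)%E).
  apply: ge0_le_integral => //.
  - by move=> x _; rewrite lee_fin mulr_ge0.
  - by apply/measurable_EFinP; exact: (measurableT_comp madj (measurable_pair1 t)).
  - move=> x _; rewrite lee_fin; apply: ler_pM => //.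
    by apply: poisson_le_bound; rewrite r_ge0 r_le.
by rewrite (integral_prob_cst c).
Qed.

(** Exchange the integrals and substitute t - x for t, by the invariance of
    the measure under the flow. *)
Lemma poisson_duality (g : X -> R) : measurable_fun setT g -> periodic g ->
  (forall t, 0 <= g t) ->
  (\int[T]_t ((h t)%:E * poisson_average g t) =
   \int[T]_t ((g t)%:E * poisson_adjoint h t))%E.
Proof.
move=> mg pg g0.
have mF : measurable_fun setT (fun q : X * R => h q.1 * (p q.1 q.2 * g (tshift q.1 q.2))).
  apply: measurable_funM; first exact: (measurableT_comp mh measurable_fst).
  by apply: measurable_funM => //; apply: measurableT_comp.
have mG : measurable_fun setT (fun q : X * R =>
   g q.1 * (h (tshift q.1 (- q.2)) * p (tshift q.1 (- q.2)) q.2)).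
  by apply: measurable_funM => //; exact: (measurableT_comp mg measurable_fst).
transitivity (\int[T]_t \int[c]_x (h t * (p t x * g (tshift t x)))%:E)%E.
  apply: eq_integral => t _; under [RHS]eq_integral do rewrite EFinM.
  rewrite ge0_integralZl_EFin //.
    by move=> x _; rewrite lee_fin mulr_ge0.
  apply/measurable_EFinP; apply: measurable_funM.
    exact: (measurableT_comp mp (measurable_pair1 t)).
  by apply: measurableT_comp => //; exact: (measurableT_comp mshift (measurable_pair1 t)).
rewrite ge0_fubini_swap; last 2 first.
- exact/measurable_EFinP.
- by move=> t x; rewrite lee_fin mulr_ge0 // mulr_ge0.
transitivity (\int[c]_x \int[T]_t (g t * (h (tshift t (- x)) * p (tshift t (- x)) x))%:E)%E.
  apply: eq_integral => x _.
  rewrite -(ge0_torus_shift (- x) (F := fun t => (h t * (p t x * g (tshift t x)))%:E)).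
  - apply: eq_integral => t _; rewrite tshiftD addNr tshift0.
    by congr (_ %:E); ring.
  - by apply/measurable_EFinP; exact: (measurableT_comp mF (measurable_pair2 x)).
  - by move=> t; rewrite lee_fin mulr_ge0 // mulr_ge0.
  - move=> t s ts; rewrite (ph ts) /p (pr ts) (pg (tshift t x) (tshift s x)) //.
    by move=> i; rewrite !tnth_tshift !expiD ts.
rewrite -ge0_fubini_swap; last 2 first.
- exact/measurable_EFinP.
- by move=> t x; rewrite lee_fin mulr_ge0 // mulr_ge0.
apply: eq_integral => t _; under eq_integral do rewrite EFinM.
rewrite ge0_integralZl_EFin //.
  by move=> x _; rewrite lee_fin mulr_ge0.
by apply/measurable_EFinP; exact: (measurableT_comp madj (measurable_pair1 t)).
Qed.

Let H t := fine (poisson_adjoint h t).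

Lemma EFin_poisson_adjoint t : (fine (poisson_adjoint h t))%:E = poisson_adjoint h t.
Proof.
rewrite fineK // ge0_fin_numE ?poisson_adjoint_ge0 //.
exact: le_lt_trans (poisson_adjoint_le t) (ltry _).
Qed.

Lemma EFin_poisson_average t : (fine (poisson_average h t))%:E = poisson_average h t.
Proof.
rewrite fineK // ge0_fin_numE ?poisson_average_ge0 //.
exact: le_lt_trans (poisson_average_le t) (ltry _).
Qed.

Lemma poisson_convolutionE s1 s2 x : 0 <= s1 < 1 -> 0 <= s2 < 1 ->
  (\int[c]_y (poisson s1 (x + y) * poisson s2 y)%:E = (poisson (s1 * s2) x)%:E)%E.
Proof.
move=> s10 s20; rewrite -(poisson_convolution x s10 s20) /Rintegral fineK; last first.
  apply: integrable_fin_num => //; apply: (@integrable_circle_mean R (fun y => poisson s1 (y + x) * poisson s2 y)).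
  move=> y; apply: cvgM; last exact: continuous_poisson.
  apply: (@continuous_comp _ _ _ (fun y => y + x) (poisson s1)); last exact: continuous_poisson.
  by apply: cvgD; [exact: cvg_id|exact: cvg_cst].
by apply: eq_integral => y _; rewrite addrC.
Qed.

(** Composing the average with its adjoint gives an average over x of
    convolutions of two kernels with different radii. By poisson_convolution
    such a convolution is the kernel of the product of the radii, and
    poisson_bound replaces it by a sum of kernels of either radius, which give
    back the average and the adjoint. *)
Lemma poisson_average_adjoint t :
  (poisson_average (fun t => fine (poisson_adjoint h t)) t <=
   8%:E * (poisson_average h t + poisson_adjoint h t))%E.
Proof.
have mt : measurable_fun setT (tshift t).
  exact: (measurableT_comp mshift (measurable_pair1 t)).
have mpt : measurable_fun setT (p t).
  exact: (measurableT_comp mp (measurable_pair1 t)).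
have mxy : measurable_fun setT (fun q : R * R => q.1 + q.2).
  by apply: measurable_funD; [exact: measurable_fst|exact: measurable_snd].
pose F x y := p t x * (h (tshift t (x - y)) * p (tshift t (x - y)) y).
have mF : measurable_fun setT (fun q : R * R => F q.1 q.2).
  have mxNy : measurable_fun setT (fun q : R * R => tshift t (q.1 - q.2)).
    apply: (measurableT_comp mt); apply: measurable_funB.
      exact: measurable_fst.
    exact: measurable_snd.
  apply: measurable_funM; first exact: (measurableT_comp mpt measurable_fst).
  apply: measurable_funM; first exact: (measurableT_comp mh mxNy).
  apply: measurable_poisson; [by move=> y; exact: r01| |exact: measurable_snd].
  exact: (measurableT_comp mr mxNy).
have F0 x y : 0 <= F x y by rewrite mulr_ge0 // mulr_ge0.
pose G x y := p t (x + y) * (h (tshift t x) * p (tshift t x) y).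
have mG : measurable_fun setT (fun q : R * R => G q.1 q.2).
  have mx : measurable_fun setT (fun q : R * R => tshift t q.1).
    exact: (measurableT_comp mt measurable_fst).
  apply: measurable_funM; first exact: (measurableT_comp mpt mxy).
  apply: measurable_funM; first exact: (measurableT_comp mh mx).
  apply: measurable_poisson; [by move=> y; exact: r01| |exact: measurable_snd].
  exact: (measurableT_comp mr mx).
have G0 x y : 0 <= G x y by rewrite mulr_ge0 // mulr_ge0.
have -> : poisson_average (fun t => fine (poisson_adjoint h t)) t =
    (\int[c]_x \int[c]_y (F x y)%:E)%E.
  apply: eq_integral => x _; rewrite EFinM EFin_poisson_adjoint /poisson_adjoint.
  rewrite -ge0_integralZl_EFin //.
  - by apply: eq_integral => y _; rewrite -EFinM tshiftD.
  - by move=> y _; rewrite lee_fin mulr_ge0.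
  - by apply/measurable_EFinP; exact: (measurableT_comp madj (measurable_pair1 _)).
rewrite ge0_circle_swap; [|exact/measurable_EFinP|by move=> x y; rewrite lee_fin].
have -> : (\int[c]_y \int[c]_x (F x y)%:E = \int[c]_y \int[c]_x (G x y)%:E)%E.
  apply: eq_integral => y _.
  rewrite -(ge0_circle_mean_shift y (G := fun x => (F x y)%:E)).
  - by apply: eq_integral => x _; rewrite /F addrK.
  - by apply/measurable_EFinP; exact: (measurableT_comp mF (measurable_pair2 y)).
  - by move=> x; rewrite lee_fin.
  - move=> x x' xx'; rewrite /F /p (circular_poisson _ xx').
    have E i : expi (tnth (tshift t (x - y)) i) = expi (tnth (tshift t (x' - y)) i).
      by rewrite !tnth_tshift !expiD xx'.
    by rewrite (ph E) (pr E).
rewrite -ge0_circle_swap; [|exact/measurable_EFinP|by move=> x y; rewrite lee_fin].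
pose P1 x := p t x * h (tshift t x); pose P2 x := h (tshift t x) * p (tshift t x) x.
have mP1 : measurable_fun setT P1.
  by apply: measurable_funM => //; exact: (measurableT_comp mh mt).
have mP2 : measurable_fun setT P2.
  apply: measurable_funM => //; first exact: (measurableT_comp mh mt).
  by apply: measurable_poisson => //; exact: (measurableT_comp mr mt).
have P1_0 x : 0 <= P1 x by rewrite mulr_ge0.
have P2_0 x : 0 <= P2 x by rewrite mulr_ge0.
apply: (@le_trans _ _ (\int[c]_x (8 * (P1 x + P2 x))%:E)%E).
  apply: ge0_le_integral => //.
  - by move=> x _; apply: integral_ge0 => y _; rewrite lee_fin.
  - apply: (@measurable_fun_fubini_tonelli_F _ _ _ _ _ c (fun q : R * R => (G q.1 q.2)%:E)).
      exact/measurable_EFinP.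
    by move=> q; rewrite lee_fin.
  - by apply/measurable_EFinP; apply: measurable_funM => //; exact: measurable_funD.
  - move=> x _.
    have -> : (\int[c]_y (G x y)%:E =
        (h (tshift t x))%:E * \int[c]_y (poisson (r t) (x + y) * poisson (r (tshift t x)) y)%:E)%E.
      rewrite -ge0_integralZl_EFin //.
      - by apply: eq_integral => y _; rewrite -EFinM; congr (_ %:E); rewrite /G /p; ring.
      - by move=> y _; rewrite lee_fin; apply: mulr_ge0; exact: p_ge0.
      - apply/measurable_EFinP; apply: measurable_funM.
          exact: (measurableT_comp mpt (measurableT_comp mxy (measurable_pair1 x))).
        by apply: measurable_poisson => //; move=> y; exact: r01.
    rewrite poisson_convolutionE // -EFinM lee_fin.
    rewrite (_ : 8 * _ = h (tshift t x) * (8 * (poisson (r t) x + poisson (r (tshift t x)) x))).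
      by rewrite ler_wpM2l // poisson_bound.
    by rewrite /P1 /P2 /p; ring.
rewrite (_ : (\int[c]_x (8 * (P1 x + P2 x))%:E)%E = (8%:E * (\int[c]_x (P1 x)%:E + \int[c]_x (P2 x)%:E))%E).
  rewrite lee_pmul2l //; apply: leeD => //.
  rewrite /poisson_adjoint -(ge0_circle_mean_opp (G := fun x => (P2 x)%:E)).
  - rewrite le_eqVlt; apply/orP; left; apply/eqP.
    by apply: eq_integral => x _; rewrite /P2 /p poisson_even.
  - exact/measurable_EFinP.
  - by move=> x; rewrite lee_fin.
  - move=> x x' xx'; rewrite /P2 /p (circular_poisson _ xx').
    have E i : expi (tnth (tshift t x) i) = expi (tnth (tshift t x') i).
      by rewrite !tnth_tshift !expiD xx'.
    by rewrite (ph E) (pr E).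
under eq_integral do rewrite EFinM.
rewrite ge0_integralZl_EFin //.
- congr (_ * _)%E; rewrite -ge0_integralD //.
  + by move=> x _; rewrite lee_fin.
  + exact/measurable_EFinP.
  + by move=> x _; rewrite lee_fin.
  + exact/measurable_EFinP.
- by move=> x _; rewrite lee_fin addr_ge0.
- by apply/measurable_EFinP; exact: measurable_funD.
Qed.

End dual.

End maximal.

Section maximal_inequality.
Context {R : realType} (n : nat).
Local Notation X := (n.-tuple R).
Local Notation T := (@torus R n).

Lemma bounded_integrable d (Y : measurableType d) (P : probability Y R) (f : Y -> R) K :
  measurable_fun setT f -> (forall t, `|f t| <= K) -> P.-integrable setT (EFin \o f).
Proof.
move=> mf fK; apply: measurable_bounded_integrable => //.
  by apply: le_lt_trans (ltry 1); exact: probability_le1.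
exists K; split; first exact: num_real.
by move=> M KM x _; apply: le_trans (fK x) (ltW KM).
Qed.

Lemma ge0_RintegralE d (Y : measurableType d) (P : probability Y R) (f : Y -> R) :
  P.-integrable setT (EFin \o f) -> (\int[P]_x (f x)%:E = (\int[P]_x f x)%:E)%E.
Proof. by move=> iF; rewrite /Rintegral fineK //; exact: integrable_fin_num. Qed.

Lemma Rintegral_le_lin d (Y : measurableType d) (P : probability Y R) (f g1 g2 : Y -> R) k l :
  P.-integrable setT (EFin \o f) -> P.-integrable setT (EFin \o g1) ->
  P.-integrable setT (EFin \o g2) -> (forall t, f t <= k * g1 t + l * g2 t) ->
  \int[P]_t f t <= k * \int[P]_t g1 t + l * \int[P]_t g2 t.
Proof.
move=> iF i1 i2 H.
have ik : P.-integrable setT (EFin \o (fun t => k * g1 t)).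
  exact: (integrableZl measurableT k i1).
have il : P.-integrable setT (EFin \o (fun t => l * g2 t)).
  exact: (integrableZl measurableT l i2).
have ikl : P.-integrable setT (EFin \o (fun t => k * g1 t + l * g2 t)).
  exact: (integrableD measurableT ik il).
rewrite -(RintegralZl k measurableT i1) -(RintegralZl l measurableT i2).
rewrite -(RintegralD measurableT ik il).
by apply: (le_Rintegral measurableT iF ikl) => t _; exact: H.
Qed.

(** The abstract form of the TT-star argument. With A the averaging operator,
    h = A u, H is the adjoint of A applied to h, a = A h and b = A H. The
    hypotheses give |H|^2 <= 16 <h, H> and |h|^2 = <u, H>; Young's inequality,
    with constants chosen to absorb the terms in H and then in h, yields the
    bound. *)
Lemma absorption d (Y : measurableType d) (P : probability Y R) (u h H a b : Y -> R)
    (I := fun f g : Y -> R => P.-integrable setT (EFin \o (fun t => f t * g t))) :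
  I h h -> I H H -> I h H -> I u H -> I u u -> I h a -> I h b ->
  (forall t, 0 <= h t) -> (forall t, b t <= 8 * (a t + H t)) ->
  \int[P]_t (h t * h t) = \int[P]_t (u t * H t) ->
  \int[P]_t (h t * a t) = \int[P]_t (h t * H t) ->
  \int[P]_t (h t * b t) = \int[P]_t (H t * H t) ->
  \int[P]_t (h t * h t) <= 256 * \int[P]_t (u t * u t).
Proof.
move=> ihh iHH ihH iuH iuu iha ihb h0 ba E1 E2 E3.
have B1 : \int[P]_t (H t * H t) <= 8 * \int[P]_t (h t * a t) + 8 * \int[P]_t (h t * H t).
  rewrite -E3; apply: (Rintegral_le_lin ihb iha ihH) => t.
  rewrite (_ : 8 * (h t * a t) + _ = h t * (8 * (a t + H t))); last ring.
  exact: ler_wpM2l.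
(* The weights leave half of |H|^2 here, and half of |h|^2 in B3, to be absorbed. *)
have B2 : \int[P]_t (h t * H t) <= 8 * \int[P]_t (h t * h t) + 32^-1 * \int[P]_t (H t * H t).
  apply: (Rintegral_le_lin ihH ihh iHH) => t.
  have := sqr_ge0 (16 * h t - H t); rewrite expr2; lra.
have B3 : \int[P]_t (u t * H t) <= 128 * \int[P]_t (u t * u t) + 512^-1 * \int[P]_t (H t * H t).
  apply: (Rintegral_le_lin iuH iuu iHH) => t.
  have := sqr_ge0 (256 * u t - H t); rewrite expr2; lra.
lra.
Qed.

Variables (r : X -> R) (rho : R).
Hypotheses (mr : measurable_fun setT r) (pr : periodic r).
Hypotheses (r_ge0 : forall t, 0 <= r t) (r_le : forall t, r t <= rho) (rho1 : rho < 1).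

(** The constant is the same for all r, which turns the inequality into a
    bound for a supremum over radii; the upper bound rho < 1 keeps the
    functions involved bounded. *)
Lemma maximal_linearized (u : X -> R) M : measurable_fun setT u -> periodic u ->
  (forall t, 0 <= u t <= M) ->
  \int[T]_t (fine (poisson_average r u t) ^+ 2) <= 256 * \int[T]_t (u t ^+ 2).
Proof.
move=> mu pu u0M.
have u0 t : 0 <= u t by have /andP[] := u0M t.
have uM t : u t <= M by have /andP[] := u0M t.
pose h t := fine (poisson_average r u t).
have hE t : (h t)%:E = poisson_average r u t.
  exact: (EFin_poisson_average mr r_ge0 r_le rho1 mu u0 uM).
have h0 t : 0 <= h t.
  by rewrite -lee_fin hE; exact: (poisson_average_ge0 r_ge0 r_le rho1 u0).
have hM t : h t <= M.
  by rewrite -lee_fin hE; exact: (poisson_average_le mr r_ge0 r_le rho1 mu u0 uM).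
have mh : measurable_fun setT h.
  apply: measurable_fineT; exact: (measurable_poisson_average mr r_ge0 r_le rho1 mu u0).
have ph : periodic h.
  by move=> t s ts; rewrite /h (periodic_poisson_average pr pu ts).
pose H t := fine (poisson_adjoint r h t).
have HE t : (H t)%:E = poisson_adjoint r h t.
  exact: (EFin_poisson_adjoint mr r_ge0 r_le rho1 mh h0 hM).
have H0 t : 0 <= H t.
  by rewrite -lee_fin HE; exact: (poisson_adjoint_ge0 r_ge0 r_le rho1 h0).
pose K := M * (1 - rho) ^- 2.
have HK t : H t <= K.
  by rewrite -lee_fin HE; exact: (poisson_adjoint_le mr r_ge0 r_le rho1 mh h0 hM).
have mH : measurable_fun setT H.
  apply: measurable_fineT; exact: (measurable_poisson_adjoint mr r_ge0 r_le rho1 mh h0).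
have pH : periodic H.
  by move=> t s ts; rewrite /H (periodic_poisson_adjoint pr ph ts).
have bint (f g : X -> R) A B : measurable_fun setT f -> measurable_fun setT g ->
    (forall t, 0 <= f t) -> (forall t, 0 <= g t) -> (forall t, f t <= A) -> (forall t, g t <= B) ->
    T.-integrable setT (EFin \o (fun t => f t * g t)).
  move=> mf mg f0 g0 fA gB; apply: (@bounded_integrable _ _ T _ (A * B)).
    exact: measurable_funM.
  by move=> t; rewrite ger0_norm ?mulr_ge0 //; apply: ler_pM.
have ihh := bint h h M M mh mh h0 h0 hM hM.
have iHH := bint H H K K mH mH H0 H0 HK HK.
have ihH := bint h H M K mh mH h0 H0 hM HK.
have iuH := bint u H M K mu mH u0 H0 uM HK.
have iuu := bint u u M M mu mu u0 u0 uM uM.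
pose a t := fine (poisson_average r h t).
have aE t : (a t)%:E = poisson_average r h t.
  exact: (EFin_poisson_average mr r_ge0 r_le rho1 mh h0 hM).
have a0 t : 0 <= a t.
  by rewrite -lee_fin aE; exact: (poisson_average_ge0 r_ge0 r_le rho1 h0).
have aM t : a t <= M.
  by rewrite -lee_fin aE; exact: (poisson_average_le mr r_ge0 r_le rho1 mh h0 hM).
have ma : measurable_fun setT a.
  apply: measurable_fineT; exact: (measurable_poisson_average mr r_ge0 r_le rho1 mh h0).
pose b t := fine (poisson_average r H t).
have bE t : (b t)%:E = poisson_average r H t.
  exact: (EFin_poisson_average mr r_ge0 r_le rho1 mH H0 HK).
have b0 t : 0 <= b t.
  by rewrite -lee_fin bE; exact: (poisson_average_ge0 r_ge0 r_le rho1 H0).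
have bK t : b t <= K.
  by rewrite -lee_fin bE; exact: (poisson_average_le mr r_ge0 r_le rho1 mH H0 HK).
have mb : measurable_fun setT b.
  apply: measurable_fineT; exact: (measurable_poisson_average mr r_ge0 r_le rho1 mH H0).
have iha := bint h a M M mh ma h0 a0 hM aM.
have ihb := bint h b M K mh mb h0 b0 hM bK.
have E1 : \int[T]_t (h t * h t) = \int[T]_t (u t * H t).
  rewrite /Rintegral; congr fine.
  have D := poisson_duality mr pr r_ge0 r_le rho1 mh ph h0 mu pu u0.
  apply: eq_trans (eq_trans _ D) _.
    by apply: eq_integral => t _; rewrite EFinM hE.
  by apply: eq_integral => t _; rewrite EFinM HE.
have E2 : \int[T]_t (h t * a t) = \int[T]_t (h t * H t).
  rewrite /Rintegral; congr fine.
  have D := poisson_duality mr pr r_ge0 r_le rho1 mh ph h0 mh ph h0.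
  apply: eq_trans (eq_trans _ D) _.
    by apply: eq_integral => t _; rewrite EFinM aE.
  by apply: eq_integral => t _; rewrite EFinM HE.
have E3 : \int[T]_t (h t * b t) = \int[T]_t (H t * H t).
  rewrite /Rintegral; congr fine.
  have D := poisson_duality mr pr r_ge0 r_le rho1 mh ph h0 mH pH H0.
  apply: eq_trans (eq_trans _ D) _.
    by apply: eq_integral => t _; rewrite EFinM bE.
  by apply: eq_integral => t _; rewrite EFinM HE.
have ba t : b t <= 8 * (a t + H t).
  rewrite -lee_fin bE.
  have -> : (8 * (a t + H t))%:E = (8%:E * ((a t)%:E + (H t)%:E))%E.
    by rewrite -EFinD -EFinM.
  rewrite aE HE.
  exact: (poisson_average_adjoint mr pr r_ge0 r_le rho1 mh ph h0 hM).
have main : \int[T]_t (h t * h t) <= 256 * \int[T]_t (u t * u t).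
  exact: (absorption ihh iHH ihH iuH iuu iha ihb h0 ba E1 E2 E3).
have sq (f : X -> R) : \int[T]_t (f t ^+ 2) = \int[T]_t (f t * f t).
  by apply: eq_Rintegral => t _; rewrite expr2.
by rewrite !sq.
Qed.

End maximal_inequality.

(** * Poisson operators along the flow *)

Section poisson_operator.
Context {R : realType} (n : nat).
Local Notation X := (n.-tuple R).
Local Notation T := (@torus R n).
Local Notation c := (@circle_mean R).

Definition torus_function (f : X -> R) := [/\ measurable_fun setT f, periodic f &
  exists M, forall t, `|f t| <= M].

Definition poisson_operator (r : R) (f : X -> R) (t : X) : R :=
  \int[c]_x (f (tshift t x) * poisson r x).

Lemma torus_functionD f g : torus_function f -> torus_function g ->
  torus_function (fun t => f t + g t).
Proof.
move=> [mf pf [M fM]] [mg pg [N gN]]; split.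
- exact: measurable_funD.
- by move=> t s ts; rewrite (pf _ _ ts) (pg _ _ ts).
- by exists (M + N) => t; apply: le_trans (ler_normD _ _) _; exact: lerD.
Qed.

Lemma torus_functionM f g : torus_function f -> torus_function g ->
  torus_function (fun t => f t * g t).
Proof.
move=> [mf pf [M fM]] [mg pg [N gN]]; split.
- exact: measurable_funM.
- by move=> t s ts; rewrite (pf _ _ ts) (pg _ _ ts).
- by exists (M * N) => t; rewrite normrM; exact: ler_pM.
Qed.

Lemma torus_function_cst k : torus_function (fun=> k).
Proof. by split => //; exists `|k|. Qed.

Lemma torus_functionN f : torus_function f -> torus_function (fun t => - f t).
Proof.
move=> [mf pf [M fM]]; split.
- exact: measurableT_comp.
- by move=> t s ts; rewrite (pf _ _ ts).
- by exists M => t; rewrite normrN.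
Qed.

Lemma torus_functionB f g : torus_function f -> torus_function g ->
  torus_function (fun t => f t - g t).
Proof. by move=> hf /torus_functionN; exact: torus_functionD. Qed.

Lemma torus_function_abs f : torus_function f -> torus_function (fun t => `|f t|).
Proof.
move=> [mf pf [M fM]]; split.
- exact: measurableT_comp.
- by move=> t s ts; rewrite (pf _ _ ts).
- by exists M => t; rewrite normr_id.
Qed.

Lemma torus_function_integrable f : torus_function f -> T.-integrable setT (EFin \o f).
Proof. by move=> [mf _ [M fM]]; exact: bounded_integrable fM. Qed.

Lemma measurable_tshiftr (t : X) : measurable_fun setT (tshift t).
Proof.
apply: measurable_tshift2; first exact: measurable_cst.
exact: measurable_id.
Qed.

Lemma integrable_poisson_operand r f t : 0 <= r < 1 -> torus_function f ->
  c.-integrable setT (EFin \o (fun x => f (tshift t x) * poisson r x)).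
Proof.
move=> r01 [mf _ [M fM]].
apply: (@bounded_integrable _ _ _ c _ (M * (1 - r) ^- 2)).
  apply: measurable_funM.
    exact: (measurableT_comp mf (measurable_tshiftr t)).
  by apply: continuous_measurable_fun; exact: continuous_poisson.
move=> x; rewrite normrM; apply: ler_pM => //.
rewrite ger0_norm; last exact/ltW/poisson_gt0.
have [r0 r1] := andP r01; apply: (poisson_le_bound r1).
by rewrite r0 lexx.
Qed.

Lemma poisson_operator_lin r f g k t : 0 <= r < 1 -> torus_function f -> torus_function g ->
  poisson_operator r (fun t => f t + k * g t) t =
  poisson_operator r f t + k * poisson_operator r g t.
Proof.
move=> r01 hf hg; have i1 := integrable_poisson_operand t r01 hf.
have i2 := integrable_poisson_operand t r01 hg.
rewrite /poisson_operator -(RintegralZl k measurableT i2).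
rewrite -(RintegralD measurableT i1 (integrableZl measurableT k i2)).
by apply: eq_Rintegral => x _; ring.
Qed.

Lemma poisson_operator_cst r k t : 0 <= r < 1 -> poisson_operator r (fun=> k) t = k.
Proof.
move=> r01; rewrite /poisson_operator.
rewrite (RintegralZl k measurableT (integrable_circle_mean (continuous_poisson r01))).
by rewrite poisson_mean1 // mulr1.
Qed.

Lemma poisson_averageE r f t : 0 <= r < 1 -> torus_function f ->
  poisson_average (fun=> r) f t = (poisson_operator r f t)%:E.
Proof.
move=> r01 hf; rewrite /poisson_operator /Rintegral fineK.
  by apply: eq_integral => x _; rewrite mulrC.
exact: (integrable_fin_num measurableT (integrable_poisson_operand t r01 hf)).
Qed.

Lemma poisson_adjointE r f t : 0 <= r < 1 -> torus_function f -> (forall t, 0 <= f t) ->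
  poisson_adjoint (fun=> r) f t = (poisson_operator r f t)%:E.
Proof.
move=> r01 hf f0; have [mf pf _] := hf; have p0 x : 0 <= poisson r x by exact/ltW/poisson_gt0.
rewrite -poisson_averageE // /poisson_average.
rewrite -(ge0_circle_mean_opp (G := fun x => (poisson r x * f (tshift t x))%:E)).
- by apply: eq_integral => x _; rewrite poisson_even mulrC.
- apply/measurable_EFinP; apply: measurable_funM.
    by apply: continuous_measurable_fun; exact: continuous_poisson.
  exact: (measurableT_comp mf (measurable_tshiftr t)).
- by move=> x; rewrite lee_fin mulr_ge0.
- move=> x y xy; rewrite (circular_poisson _ xy).
  by rewrite (periodic_tshiftl t pf xy).
Qed.

Lemma poisson_operator_le r f g t : 0 <= r < 1 -> torus_function f -> torus_function g ->
  (forall t, f t <= g t) -> poisson_operator r f t <= poisson_operator r g t.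
Proof.
move=> r01 hf hg fg.
apply: (le_Rintegral measurableT (integrable_poisson_operand t r01 hf)
  (integrable_poisson_operand t r01 hg)) => x _.
by rewrite ler_wpM2r // ltW // poisson_gt0.
Qed.

Lemma poisson_operator_norm r f t : 0 <= r < 1 -> torus_function f ->
  `|poisson_operator r f t| <= poisson_operator r (fun t => `|f t|) t.
Proof.
move=> r01 hf; have ha := torus_function_abs hf.
rewrite ler_norml; apply/andP; split.
  have -> : - poisson_operator r (fun t => `|f t|) t = poisson_operator r (fun t => 0 + (-1) * `|f t|) t.
    by rewrite (poisson_operator_lin (-1) t r01 (torus_function_cst 0) ha) poisson_operator_cst // add0r mulN1r.
  apply: poisson_operator_le => //.
    by apply: torus_functionD (torus_function_cst 0) (torus_functionM (torus_function_cst _) ha).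
  by move=> s; rewrite add0r mulN1r lerNl; apply: le_trans (ler_norm _) _; rewrite normrN.
by apply: poisson_operator_le => // s; exact: ler_norm.
Qed.

Lemma torus_function_poisson r f : 0 <= r < 1 -> torus_function f ->
  torus_function (poisson_operator r f).
Proof.
move=> r01 hf; have [mf pf [M fM]] := hf; split.
- have mF : measurable_fun setT (fun q : X * R => f (tshift q.1 q.2) * poisson r q.2).
    apply: measurable_funM.
      apply: (measurableT_comp mf).
      by apply: measurable_tshift2; [exact: measurable_fst|exact: measurable_snd].
    apply: measurableT_comp (@measurable_snd _ _ _ _).
    by apply: continuous_measurable_fun; exact: continuous_poisson.
  exact: (@measurable_Rintegral_param R _ X _ R c setT (fun q : X * R => f (tshift q.1 q.2) * poisson r q.2)).
- move=> t s ts; apply: eq_Rintegral => x _; congr (_ * _).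
  by apply: pf => i; rewrite !tnth_tshift !expiD ts.
- exists M => t; apply: le_trans (poisson_operator_norm t r01 hf) _.
  rewrite -[leRHS](poisson_operator_cst M t r01).
  by apply: poisson_operator_le; [|exact: torus_function_abs|exact: torus_function_cst|].
Qed.

(** This is poisson_duality for a constant radius, since the Poisson kernel is
    even. *)
Lemma poisson_selfadjoint_ge0 r f g : 0 <= r < 1 -> torus_function f -> torus_function g ->
  (forall t, 0 <= f t) -> (forall t, 0 <= g t) ->
  \int[T]_t (f t * poisson_operator r g t) = \int[T]_t (poisson_operator r f t * g t).
Proof.
move=> r01 hf hg f0 g0; have [r0 r1] := andP r01.
have [mf pf _] := hf; have [mg pg _] := hg.
have mr : measurable_fun setT (fun _ : X => r) by exact: measurable_cst.
have pr : periodic (fun _ : X => r) by [].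
have D := @poisson_duality R n (fun=> r) r mr pr (fun=> r0) (fun=> lexx r) r1 f mf pf f0 g mg pg g0.
rewrite /Rintegral; congr fine; apply: eq_trans (eq_trans _ D) _.
  by apply: eq_integral => t _; rewrite EFinM poisson_averageE.
by apply: eq_integral => t _; rewrite poisson_adjointE // -EFinM mulrC.
Qed.

Lemma Rintegral_lin f g k : torus_function f -> torus_function g ->
  \int[T]_t (f t + k * g t) = \int[T]_t f t + k * \int[T]_t g t.
Proof.
move=> /torus_function_integrable iF /torus_function_integrable ig.
rewrite -(RintegralZl k measurableT ig).
exact: (RintegralD measurableT iF (integrableZl measurableT k ig)).
Qed.

Lemma Rintegral_prob_cst k : \int[T]_t k = k.
Proof. by rewrite /Rintegral integral_prob_cst. Qed.

Lemma poisson_operator_mean r f : 0 <= r < 1 -> torus_function f ->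
  \int[T]_t poisson_operator r f t = \int[T]_t f t.
Proof.
move=> r01 hf; have [_ _ [M fM]] := hf.
have c1 := torus_function_cst 1.
pose f' t := f t + M * 1.
have hf' : torus_function f'.
  exact: torus_functionD hf (torus_functionM (torus_function_cst M) c1).
have f'0 t : 0 <= f' t.
  by rewrite /f' mulr1 -lerBlDr sub0r; have := fM t; rewrite ler_norml => /andP[].
have := @poisson_selfadjoint_ge0 r f' (fun=> 1) r01 hf' c1 f'0 (fun=> ler01).
under eq_Rintegral do rewrite poisson_operator_cst // mulr1.
under [X in _ = X -> _]eq_Rintegral do rewrite (poisson_operator_lin _ _ r01 hf c1) mulr1.
rewrite /f' (Rintegral_lin M hf c1).
have hA := torus_function_poisson r01 hf.
have hA1 := torus_function_poisson r01 c1.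
rewrite (Rintegral_lin M hA hA1).
have -> : \int[T]_t poisson_operator r (fun=> 1) t = \int[T]_t 1.
  by apply: eq_Rintegral => t _; rewrite poisson_operator_cst.
by move=> /addIr ->.
Qed.

(** Adding constants makes the two functions nonnegative; the extra terms
    agree because the operator fixes constants and preserves means. *)
Lemma poisson_selfadjoint r f g : 0 <= r < 1 -> torus_function f -> torus_function g ->
  \int[T]_t (f t * poisson_operator r g t) = \int[T]_t (poisson_operator r f t * g t).
Proof.
move=> r01 hf hg; have [_ _ [M fM]] := hf; have [_ _ [N gN]] := hg.
have c1 := torus_function_cst 1.
have hAf := torus_function_poisson r01 hf; have hAg := torus_function_poisson r01 hg.
pose f' t := f t + M * 1; pose g' t := g t + N * 1.
have hf' : torus_function f'.
  exact: torus_functionD hf (torus_functionM (torus_function_cst M) c1).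
have hg' : torus_function g'.
  exact: torus_functionD hg (torus_functionM (torus_function_cst N) c1).
have f'0 t : 0 <= f' t.
  by rewrite /f' mulr1 -lerBlDr sub0r; have := fM t; rewrite ler_norml => /andP[].
have g'0 t : 0 <= g' t.
  by rewrite /g' mulr1 -lerBlDr sub0r; have := gN t; rewrite ler_norml => /andP[].
have E (a b : X -> R) A B : torus_function a -> torus_function b ->
    \int[T]_t ((a t + A) * (b t + B)) =
    \int[T]_t (a t * b t) + A * \int[T]_t b t + B * \int[T]_t a t + A * B.
  move=> ha hb; have hab := torus_functionM ha hb.
  have h1 : torus_function (fun t => a t * b t + A * b t).
    exact: torus_functionD hab (torus_functionM (torus_function_cst A) hb).
  have h2 : torus_function (fun t => a t * b t + A * b t + B * a t).
    exact: torus_functionD h1 (torus_functionM (torus_function_cst B) ha).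
  rewrite -(Rintegral_lin A hab hb) -(Rintegral_lin B h1 ha) -[A * B]mulr1.
  rewrite -[X in _ + _ * X](Rintegral_prob_cst 1) -(Rintegral_lin (A * B) h2 c1).
  by apply: eq_Rintegral => t _; ring.
have := poisson_selfadjoint_ge0 r01 hf' hg' f'0 g'0.
have -> : \int[T]_t (f' t * poisson_operator r g' t) =
    \int[T]_t ((f t + M) * (poisson_operator r g t + N)).
  apply: eq_Rintegral => t _.
  by rewrite /g' /f' (poisson_operator_lin _ _ r01 hg c1) poisson_operator_cst // !mulr1.
have -> : \int[T]_t (poisson_operator r f' t * g' t) =
    \int[T]_t ((poisson_operator r f t + M) * (g t + N)).
  apply: eq_Rintegral => t _.
  by rewrite /g' /f' (poisson_operator_lin _ _ r01 hf c1) poisson_operator_cst // !mulr1.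
rewrite !E // !poisson_operator_mean //; lra.
Qed.

(** Expand the average of (f - m)^2 with m the average of f. *)
Lemma poisson_operator_jensen r f t : 0 <= r < 1 -> torus_function f ->
  poisson_operator r f t ^+ 2 <= poisson_operator r (fun t => f t ^+ 2) t.
Proof.
move=> r01 hf; set m := poisson_operator r f t.
have c1 := torus_function_cst (m ^+ 2).
have hff : torus_function (fun t => f t ^+ 2).
  by under eq_fun do rewrite expr2; exact: torus_functionM.
have h1 : torus_function (fun t => f t ^+ 2 + (- 2 * m) * f t).
  exact: torus_functionD hff (torus_functionM (torus_function_cst _) hf).
have : 0 <= poisson_operator r (fun t => (f t ^+ 2 + (- 2 * m) * f t) + 1 * m ^+ 2) t.
  apply: Rintegral_ge0 => x _; apply: mulr_ge0; last exact/ltW/poisson_gt0.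
  by have := sqr_ge0 (f (tshift t x) - m); rewrite sqrrB; lra.
rewrite (poisson_operator_lin _ _ r01 h1 c1) (poisson_operator_lin _ _ r01 hff hf).
rewrite poisson_operator_cst // -/m; rewrite !expr2; lra.
Qed.

Lemma poisson_operator_contraction r f : 0 <= r < 1 -> torus_function f ->
  \int[T]_t (poisson_operator r f t ^+ 2) <= \int[T]_t (f t ^+ 2).
Proof.
move=> r01 hf.
have hff : torus_function (fun t => f t ^+ 2).
  by under eq_fun do rewrite expr2; exact: torus_functionM.
have hAA : torus_function (fun t => poisson_operator r f t ^+ 2).
  by under eq_fun do rewrite expr2; apply: torus_functionM; exact: torus_function_poisson.
rewrite -(poisson_operator_mean r01 hff); apply: le_Rintegral => //.
- exact: torus_function_integrable.
- by apply: torus_function_integrable; exact: torus_function_poisson.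
- by move=> t _; exact: poisson_operator_jensen.
Qed.

End poisson_operator.

(** * Harmonic families and their maximal functions *)

Section harmonic_family.
Context {R : realType} (n : nat).
Local Notation X := (n.-tuple R).
Local Notation T := (@torus R n).

(** The properties of u r t = Re f(r e^{it}), for f holomorphic on the
    polydisk, that boundary values depend on (harmonic_family_Re): on each
    orbit of the flow it is a harmonic function of a disc, so that radii
    compose through Poisson operators. *)
Definition harmonic_family (u : R -> X -> R) := [/\
  forall r, 0 <= r < 1 -> torus_function (u r),
  forall r s t, 0 <= r < 1 -> 0 <= s < 1 -> u (r * s) t = poisson_operator r (u s) t &
  forall t r e, 0 <= r < 1 -> 0 < e -> exists2 h : R, 0 < h &
    forall r', 0 <= r' < 1 -> `|r' - r| < h -> `|u r' t - u r t| < e].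

Definition energy (u : R -> X -> R) r := \int[T]_t (u r t ^+ 2).

Implicit Types (u v : R -> X -> R).

Lemma torus_functionX (f : X -> R) : torus_function f -> torus_function (fun t => f t ^+ 2).
Proof. by move=> hf; under eq_fun do rewrite expr2; exact: torus_functionM. Qed.

Lemma torus_functionZ k (f : X -> R) : torus_function f -> torus_function (fun t => k * f t).
Proof. by move=> hf; apply: torus_functionM => //; exact: torus_function_cst. Qed.

Lemma harmonic_pairing_sym u v r s : harmonic_family u -> harmonic_family v ->
  0 <= r < 1 -> 0 <= s < 1 ->
  \int[T]_t (u (r * s) t * v s t) = \int[T]_t (u s t * v (r * s) t).
Proof.
move=> [tu pu _] [tv pv _] r01 s01.
under eq_Rintegral do rewrite pu //.
under [RHS]eq_Rintegral do rewrite pv //.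
by rewrite (poisson_selfadjoint r01 (tu _ s01) (tv _ s01)).
Qed.

Lemma mul01 (r s : R) : 0 <= r < 1 -> 0 <= s < 1 -> 0 <= r * s < 1.
Proof.
move=> /andP[r0 r1] /andP[s0 s1]; rewrite mulr_ge0 //=.
by apply: mulr_ilt1.
Qed.

Lemma harmonic_pairing_semigroup u r s : harmonic_family u ->
  0 <= r < 1 -> 0 <= s < 1 ->
  \int[T]_t (u (r * (r * s)) t * u s t) = energy u (r * s).
Proof.
move=> [tu pu _] r01 s01; have rs := mul01 r01 s01.
rewrite /energy; under eq_Rintegral do rewrite pu //.
rewrite -(poisson_selfadjoint r01 (tu _ rs) (tu _ s01)).
by apply: eq_Rintegral => t _; rewrite -pu // expr2.
Qed.

Lemma energy_mono u r s : harmonic_family u -> 0 <= r -> r <= s -> s < 1 ->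
  energy u r <= energy u s.
Proof.
move=> [tu pu cu] r0 rs s1; have [->//|rns] := eqVneq r s.
have rs' : r < s by rewrite lt_neqAle rns.
have s0 : 0 < s by apply: le_lt_trans rs'.
have rs01 : 0 <= r / s < 1.
  by rewrite (divr_ge0 r0 (ltW s0)) /= ltr_pdivrMr // mul1r.
have s01 : 0 <= s < 1 by rewrite (ltW s0).
rewrite -{1}(divfK (lt0r_neq0 s0) r) /energy.
under eq_Rintegral do rewrite pu //.
by apply: poisson_operator_contraction => //; exact: tu.
Qed.

(** With q = sqrt (r / s), self-adjointness turns the pairing of u r and u s
    into the energy at radius q s, which is at least the energy at r. *)
Lemma energy_dist u r s : harmonic_family u -> 0 <= r -> r <= s -> s < 1 ->
  \int[T]_t ((u s t - u r t) ^+ 2) <= energy u s - energy u r.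
Proof.
move=> hu r0 rs s1; have [->|rns] := eqVneq r s.
  have -> : \int[T]_t ((u s t - u s t) ^+ 2) = \int[T]_t 0.
    by apply: eq_Rintegral => t _; rewrite subrr expr0n.
  by rewrite Rintegral_prob_cst subrr.
have rs' : r < s by rewrite lt_neqAle rns.
have s0 : 0 < s by apply: le_lt_trans rs'.
have s01 : 0 <= s < 1 by rewrite (ltW s0).
have r01 : 0 <= r < 1 by rewrite r0 (lt_trans rs').
pose q := Num.sqrt (r / s).
have rs0 : 0 <= r / s := divr_ge0 r0 (ltW s0).
have q01 : 0 <= q < 1.
  have rs1 : r / s < 1 by rewrite ltr_pdivrMr // mul1r.
  by rewrite sqrtr_ge0 /= -(sqrtr1 R) ltr_sqrt.
have qq : q * (q * s) = r by rewrite mulrA -expr2 sqr_sqrtr // divfK // gt_eqF.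
have P := harmonic_pairing_semigroup hu q01 s01; rewrite qq in P.
have [q0 q1] := andP q01.
have rq : r <= q * s.
  rewrite -[in leLHS]qq; apply: ler_piMl; last exact: ltW.
  by rewrite mulr_ge0 // ltW.
have M := energy_mono hu r0 rq (proj2 (andP (mul01 q01 s01))).
have [tu _ _] := hu.
have trs := torus_functionM (tu _ r01) (tu _ s01).
have hs2 := torus_functionX (tu _ s01); have hr2 := torus_functionX (tu _ r01).
have h1 : torus_function (fun t => u s t ^+ 2 + 1 * u r t ^+ 2).
  exact: torus_functionD hs2 (torus_functionZ 1 hr2).
have -> : \int[T]_t ((u s t - u r t) ^+ 2) =
   \int[T]_t ((u s t ^+ 2 + 1 * u r t ^+ 2) + (- 2) * (u r t * u s t)).
  by apply: eq_Rintegral => t _; ring.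
rewrite (Rintegral_lin _ h1 trs) (Rintegral_lin _ hs2 hr2) P.
rewrite -/(energy u s) -/(energy u r); lra.
Qed.

Lemma harmonic_familyB u v : harmonic_family u -> harmonic_family v ->
  harmonic_family (fun r t => u r t - v r t).
Proof.
move=> [tu pu cu] [tv pv cv]; split.
- by move=> r r01; apply: torus_functionB; [exact: tu|exact: tv].
- move=> r s t r01 s01; rewrite pu // pv //.
  have := poisson_operator_lin (-1) t r01 (tu _ s01) (tv _ s01).
  rewrite mulN1r => <-; apply: eq_Rintegral => x _; by rewrite mulN1r.
- move=> t r e r01 e0; have e2 : 0 < e / 2 by rewrite divr_gt0.
  have [h h0 H] := cu t r _ r01 e2; have [k k0 K] := cv t r _ r01 e2.
  exists (Num.min h k); first by rewrite lt_min h0.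
  move=> r' r'01; rewrite lt_min => /andP[/(H _ r'01){}H /(K _ r'01){}K].
  rewrite (_ : _ - _ = (u r' t - u r t) - (v r' t - v r t)); last ring.
  by apply: le_lt_trans (ler_normB _ _) _; rewrite (splitr e) ltrD.
Qed.

Lemma harmonic_family_dilation u s : 0 <= s < 1 -> harmonic_family u ->
  harmonic_family (fun r t => u (s * r) t).
Proof.
move=> s01 [tu pu cu]; split.
- by move=> r r01; apply: tu; exact: mul01.
- by move=> r s' t r01 s'01; rewrite mulrCA pu //; exact: mul01.
- move=> t r e r01 e0; have [h h0 H] := cu t (s * r) e (mul01 s01 r01) e0.
  exists h => // r' r'01 rr; apply: H; first exact: mul01.
  rewrite -mulrBr normrM; apply: le_lt_trans rr.
  have [s0 s1] := andP s01.
  by rewrite ger0_norm // ler_piMl // ltW.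
Qed.

(** This is energy_dist for the radii m and s m, with m beyond r and s. *)
Lemma energy_dilation u s r S : harmonic_family u -> 0 <= s < 1 -> 0 <= r < 1 ->
  (forall r, 0 <= r < 1 -> energy u r <= S) ->
  energy (fun r t => u r t - u (s * r) t) r <= S - energy u (s * s).
Proof.
move=> hu s01 r01 uS; have [s0 s1] := andP s01; have [r0 r1] := andP r01.
have hv := harmonic_familyB hu (harmonic_family_dilation s01 hu).
pose m := Num.max r s.
have m01 : 0 <= m < 1 by rewrite le_max r0 gt_max r1.
have [m0 m1] := andP m01.
have rm : r <= m by rewrite le_max lexx.
have sm : s <= m by rewrite le_max lexx orbT.
apply: le_trans (energy_mono hv r0 rm m1) _.
have smm : s * m <= m by apply: ler_piMl => //; exact: ltW.
have sm0 : 0 <= s * m by rewrite mulr_ge0.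
apply: le_trans (energy_dist hu sm0 smm m1) _.
apply: lerB; first exact: uS.
apply: energy_mono => //; [by rewrite mulr_ge0|by rewrite ler_wpM2l|].
exact: le_lt_trans smm m1.
Qed.

Section maximal_function.
Variables (v : R -> X -> R) (q : nat -> R) (eta : R).
Hypotheses (hv : harmonic_family v) (q01 : forall k, 0 <= q k < 1).
Hypothesis v_eta : forall r, 0 <= r < 1 -> energy v r <= eta.

(** The radius among q 0, ..., q k at which |v| is largest. *)
Fixpoint best_radius k (t : X) : R :=
  match k with
  | 0 => q 0
  | k'.+1 => if `|v (best_radius k' t) t| < `|v (q k) t| then q k else best_radius k' t
  end.

Definition finite_maximal k t := `|v (best_radius k t) t|.

Lemma finite_maximalS k t :
  finite_maximal k.+1 t = Num.max (finite_maximal k t) `|v (q k.+1) t|.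
Proof. by rewrite /finite_maximal /=; case: ltP => // h; rewrite ?max_r ?max_l // ltW. Qed.

Lemma finite_maximal_ge k j t : (j <= k)%N -> `|v (q j) t| <= finite_maximal k t.
Proof.
elim: k => [|k IH]; first by rewrite leqn0 => /eqP ->.
rewrite leq_eqVlt finite_maximalS le_max => /predU1P[->|]; first by rewrite lexx orbT.
by rewrite ltnS => /IH ->.
Qed.

Lemma measurable_finite_maximal k : measurable_fun setT (finite_maximal k).
Proof.
have [tv _ _] := hv.
have mabs j : measurable_fun setT (fun t => `|v (q j) t|).
  by have [] := torus_function_abs (tv _ (q01 j)).
elim: k => [|k IH]; first exact: mabs.
rewrite (_ : finite_maximal k.+1 = fun t => Num.max (finite_maximal k t) `|v (q k.+1) t|).
  exact: measurable_maxr.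
by apply/funext => t; rewrite finite_maximalS.
Qed.

Lemma measurable_best_radius k : measurable_fun setT (best_radius k).
Proof.
have [tv _ _] := hv.
elim: k => [|k IH]; first exact: (measurable_cst (q 0)).
apply: (@measurable_fun_ifT _ _ _ _ (fun=> q k.+1) (best_radius k)
  (fun t => `|v (best_radius k t) t| < `|v (q k.+1) t|)) => //.
apply: measurable_fun_ltr; first exact: measurable_finite_maximal.
by have [] := torus_function_abs (tv _ (q01 k.+1)).
Qed.

Lemma periodic_best_radius k : periodic (best_radius k).
Proof.
have [tv _ _] := hv.
have pv j : 0 <= j < 1 -> periodic (v j) by move=> /tv[].
have br j t : 0 <= best_radius j t < 1.
  by elim: j => [|j IH] /=; [exact: q01|case: ifP].
elim: k => [|k IH] t s ts //=.
by rewrite (IH t s ts) (pv _ (br k s) t s ts) (pv _ (q01 k.+1) t s ts).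
Qed.

Lemma best_radius_bound k : exists2 rho : R, 0 < rho < 1 &
  forall t, 0 <= best_radius k t <= rho.
Proof.
elim: k => [|k [rho rho01 H]].
  have [q0 q1] := andP (q01 0).
  by exists ((1 + q 0) / 2) => [|t /=]; lra.
have [q0 q1] := andP (q01 k.+1).
exists (Num.max rho (q k.+1)).
  by rewrite lt_max gt_max q1 andbT; case/andP: rho01 => -> ->.
move=> t /=; have := H t; case: ifP => _; rewrite le_max ?lexx ?orbT ?q0 //.
by move=> /andP[-> ->].
Qed.

Lemma finite_maximal_bounded k : exists M, forall t, finite_maximal k t <= M.
Proof.
have [tv _ _] := hv.
elim: k => [|k [M HM]]; first by have [_ _ [M HM]] := tv _ (q01 0); exists M.
have [_ _ [N HN]] := tv _ (q01 k.+1).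
exists (Num.max M N) => t; rewrite finite_maximalS ge_max !le_max HM /=.
by rewrite HN orbT.
Qed.

(** Fix s beyond all the radii involved. The value of v at the radius
    best_radius is a Poisson average of v s with a radius depending on the
    point, so that maximal_linearized applies. *)
Lemma finite_maximal_bound k : \int[T]_t (finite_maximal k t ^+ 2) <= 256 * eta.
Proof.
have [rho /andP[rho0 rho1] br] := best_radius_bound k.
have [tv pv _] := hv.
pose s := (1 + rho) / 2.
have s01 : 0 <= s < 1 by rewrite /s; apply/andP; split; lra.
have s0 : 0 < s by rewrite /s; lra.
have rs : rho < s by rewrite /s; lra.
have [mu pu [M uM]] := torus_function_abs (tv _ s01).
pose u t := `|v s t|.
have u0M t : 0 <= u t <= M by rewrite normr_ge0 /=; have := uM t; rewrite normr_id.
pose r t := best_radius k t / s.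
have mr : measurable_fun setT r.
  by apply: measurable_funM; [exact: measurable_best_radius|exact: measurable_cst].
have pr : periodic r by move=> t t' tt; rewrite /r (periodic_best_radius k tt).
have r0 t : 0 <= r t.
  by have /andP[b0 _] := br t; exact: divr_ge0 b0 (ltW s0).
have rr t : r t <= rho / s.
  by have /andP[_ b1] := br t; rewrite ler_pM2r // invr_gt0.
have rs1 : rho / s < 1 by rewrite ltr_pdivrMr // mul1r.
have r01 t : 0 <= r t < 1 by rewrite r0 (le_lt_trans (rr t)).
have uM' t : u t <= M by have /andP[] := u0M t.
have u0 t : 0 <= u t by exact: normr_ge0.
pose h t := fine (poisson_average r u t).
have hE t : (h t)%:E = poisson_average r u t.
  exact: (EFin_poisson_average mr r0 rr rs1 mu u0 uM').
have h0 t : 0 <= h t.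
  by rewrite -lee_fin hE; exact: (poisson_average_ge0 r0 rr rs1 u0).
have hM t : h t <= M.
  by rewrite -lee_fin hE; exact: (poisson_average_le mr r0 rr rs1 mu u0 uM').
have mh : measurable_fun setT h.
  by apply: measurable_fineT; exact: (measurable_poisson_average mr r0 rr rs1 mu u0).
have fh t : finite_maximal k t <= h t.
  have aE : poisson_average r u t = (poisson_operator (r t) u t)%:E.
    exact: (poisson_averageE t (r01 t) (torus_function_abs (tv _ s01))).
  rewrite -lee_fin hE aE lee_fin.
  rewrite /finite_maximal -{1}(divfK (lt0r_neq0 s0) (best_radius k t)) -/(r t).
  rewrite (pv _ _ t (r01 t) s01).
  exact: (poisson_operator_norm t (r01 t) (tv _ s01)).
apply: le_trans (_ : 256 * \int[T]_t (u t ^+ 2) <= _); last first.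
  rewrite ler_pM2l //; apply: le_trans (v_eta s01); apply: eqW.
  by apply: eq_Rintegral => t _; rewrite /u real_normK ?num_real.
apply: le_trans (maximal_linearized mr pr r0 rr rs1 mu pu u0M).
have iF (f : X -> R) : measurable_fun setT f -> (forall t, 0 <= f t) -> (forall t, f t <= M) ->
    T.-integrable setT (EFin \o (fun t => f t ^+ 2)).
  move=> mf f0 fM; apply: (@bounded_integrable _ _ _ T _ (M ^+ 2)).
    exact: measurable_funX.
  move=> t; rewrite ger0_norm ?sqr_ge0 //.
  by rewrite ler_pXn2r ?nnegrE // (le_trans (f0 t)).
have F0 t : 0 <= finite_maximal k t by exact: normr_ge0.
apply: (le_Rintegral measurableT (iF _ (measurable_finite_maximal k) F0 _) (iF _ mh h0 hM)).
  by move=> t; apply: le_trans (fh t) (hM t).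
by move=> t _; rewrite ler_pXn2r ?nnegrE.
Qed.

End maximal_function.

End harmonic_family.

(** * Almost everywhere radial convergence *)

Section radial_limits.
Context {R : realType} (n : nat).
Local Notation X := (n.-tuple R).
Local Notation T := (@torus R n).
Implicit Types (u v : R -> X -> R).

(** Enumerates a dense set of radii, so that the maximal function is a
    supremum of countably many functions. *)
Definition dense_radius (k : nat) : R :=
  if @unpickle rat k is Some x then
    (if (0 <= (ratr x : R)) && ((ratr x : R) < 1) then ratr x else 0) else 0.

Lemma dense_radius01 k : 0 <= dense_radius k < 1.
Proof.
rewrite /dense_radius; case: unpickle => [x|]; last by rewrite lexx ltr01.
by case: ifP => //; rewrite lexx ltr01.
Qed.

Lemma dense_radius_near r h : 0 <= r < 1 -> 0 < h ->
  exists k, `|dense_radius k - r| < h.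
Proof.
move=> /andP[r0 r1] h0.
have : r < Num.min 1 (r + h) by rewrite lt_min r1 ltrDl.
move=> /rat_in_itvoo[x]; rewrite in_itv /= lt_min => /and3P[rx x1 xh].
exists (pickle x); rewrite /dense_radius pickleK.
have -> /= : (0 <= (ratr x : R)) && ((ratr x : R) < 1).
  by rewrite x1 andbT; apply: le_trans (ltW rx).
by rewrite ger0_norm; lra.
Qed.

Lemma sup_maximal v eta : harmonic_family v ->
  (forall r, 0 <= r < 1 -> energy v r <= eta) ->
  exists W : X -> \bar R, [/\ measurable_fun setT W, (forall t, 0 <= W t)%E,
    (\int[T]_t W t <= (256 * eta)%:E)%E &
    forall t k, ((v (dense_radius k) t ^+ 2)%:E <= W t)%E].
Proof.
move=> hv veta; pose q := dense_radius; have q01 := dense_radius01.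
pose g k t := ((finite_maximal v q k t ^+ 2)%:E).
have fm0 k t : 0 <= finite_maximal v q k t by exact: normr_ge0.
have fmS k t : finite_maximal v q k t <= finite_maximal v q k.+1 t.
  by rewrite finite_maximalS le_max lexx.
have gnd t : nondecreasing_seq (g ^~ t).
  by apply/nondecreasing_seqP => k; rewrite lee_fin ler_pXn2r ?nnegrE.
have mg k : measurable_fun setT (g k).
  by apply/measurable_EFinP; apply: measurable_funX; exact: measurable_finite_maximal.
have g0 k t : (0 <= g k t)%E by rewrite lee_fin sqr_ge0.
have gcv t : g ^~ t @ \oo --> limn (g ^~ t).
  exact: ereal_nondecreasing_is_cvgn.
exists (fun t => limn (g ^~ t)); split.
- by apply: (emeasurable_fun_cvg g) => // t _; exact: gcv.
- by move=> t; apply: lime_ge; [exact: gcv|apply: nearW => k; exact: g0].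
- rewrite (monotone_convergence T measurableT mg (fun k t _ => g0 k t)); last first.
    by move=> t _; exact: gnd.
  apply: lime_le.
    apply: ereal_nondecreasing_is_cvgn; apply/nondecreasing_seqP => k.
    apply: ge0_le_integral => //.
    by move=> t _; exact: (gnd t _ _ (leqnSn k)).
  apply: nearW => k; have := finite_maximal_bound hv q01 veta k.
  rewrite -lee_fin => /(le_trans _); apply; rewrite /Rintegral fineK //.
  apply: integrable_fin_num => //; have [M fM] := finite_maximal_bounded hv q01 k.
  apply: (@bounded_integrable _ _ _ T _ (M ^+ 2)).
    by apply: measurable_funX; exact: measurable_finite_maximal.
  move=> t; rewrite ger0_norm ?sqr_ge0 // ler_pXn2r ?nnegrE //.
  exact: le_trans (fM t).
- move=> t k; apply: (@le_trans _ _ (g k t)).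
    rewrite lee_fin -(real_normK (num_real (v _ t))) ler_pXn2r ?nnegrE //.
    exact: (finite_maximal_ge v q t (leqnn k)).
  have -> : limn (g ^~ t) = ereal_sup (range (g ^~ t)).
    by apply/cvg_lim => //; exact: ereal_nondecreasing_cvgn.
  by apply: ereal_sup_ubound; exists k.
Qed.

(** The maximal function W j of u r - u (s j * r) has an integral of the order
    of the energy gap between s_j^2 and 1, which tends to 0 with 1 - s_j.
    Hence the infimum of all W j vanishes almost everywhere. Where W j is
    small, u r is uniformly close to u (s j * r), and the latter converges as
    r tends to 1. *)
Lemma ae_radial_cauchy u M : harmonic_family u ->
  (forall r, 0 <= r < 1 -> energy u r <= M) ->
  {ae T, forall t, forall e, 0 < e -> exists2 h : R, 0 < h < 1 &
    forall r r', 1 - h < r < 1 -> 1 - h < r' < 1 -> `|u r t - u r' t| < e}.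
Proof.
move=> hu uM.
pose A := [set energy u r | r in [set r | 0 <= r < 1]].
have A0 : A (energy u 0) by exists 0 => //=; rewrite lexx ltr01.
have Aub : has_ubound A by exists M => _ [r r01 <-]; exact: uM.
pose S := sup A.
have uS r : 0 <= r < 1 -> energy u r <= S.
  by move=> r01; apply: ub_le_sup => //; exists r.
pose s (j : nat) : R := 1 - j.+2%:R^-1.
have s01 j : 0 <= s j < 1.
  have j0 : 0 < j.+2%:R^-1 :> R by rewrite invr_gt0.
  have j1 : j.+2%:R^-1 <= 1 :> R by rewrite invf_le1 // ler1n.
  by rewrite /s; move: (_^-1) j0 j1 => a j0 j1; apply/andP; split; lra.
pose v j r t := u r t - u (s j * r) t.
have hv j : harmonic_family (v j).
  exact: harmonic_familyB hu (harmonic_family_dilation (s01 j) hu).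
have ve j r : 0 <= r < 1 -> energy (v j) r <= S - energy u (s j * s j).
  by move=> r01; exact: energy_dilation.
have [W HW] := choice (fun j => sup_maximal (hv j) (ve j)).
(* The infimum replaces the extraction of an almost everywhere convergent subsequence. *)
pose I t := einfs (W ^~ t) 0.
have W0 j t : (0 <= W j t)%E by have [_ + _ _] := HW j; exact.
have mI : measurable_fun setT I.
  by apply: measurable_fun_einfs => j; have [] := HW j.
have IW j t : (I t <= W j t)%E by apply: ereal_inf_lbound; exists j.
have I0 t : (0 <= I t)%E by apply: le_ereal_inf_tmp => _ [j _ <-].
have intI : (\int[T]_t I t = 0)%E.
  apply/eqP; rewrite eq_le; apply/andP; split; last exact: integral_ge0.
  apply/lee_addgt0Pr => e e0; rewrite add0e.
  have e1 : 0 < e / 256 by rewrite divr_gt0.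
  have [_ [r r01 <-] Sr] := sup_adherent e1 (conj (ex_intro _ _ A0) Aub).
  have [r0 r1] := andP r01.
  have [j Hj] : exists j : nat, 2 / (1 - r) < j.+2%:R.
    exists (Num.Def.archi_bound (2 / (1 - r))).
    have H : 0 <= 2 / (1 - r) by rewrite divr_ge0 // subr_ge0 ltW.
    by apply: lt_le_trans (archi_boundP H) _; rewrite ler_nat; do 2 apply: leqW.
  have rs : r <= s j * s j.
    have N0 : 0 < j.+2%:R :> R by [].
    have : 2 * j.+2%:R^-1 < 1 - r.
      by rewrite ltr_pdivrMr // mulrC -ltr_pdivrMr // subr_gt0.
    have : 0 <= j.+2%:R^-1 * j.+2%:R^-1 :> R by rewrite -expr2 sqr_ge0.
    by rewrite /s; move: (_^-1) => a; lra.
  have [sj0 sj1] := andP (s01 j).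
  have E := energy_mono hu r0 rs (proj2 (andP (mul01 (s01 j) (s01 j)))).
  have [mW _ iW _] := HW j.
  apply: le_trans (_ : (\int[T]_t W j t <= _)%E).
    by apply: ge0_le_integral.
  apply: le_trans iW _; rewrite lee_fin.
  rewrite -/S in Sr; lra.
have /(ae_eq_integral_abs T measurableT mI) : (\int[T]_t `|I t| = 0)%E.
  by rewrite -[RHS]intI; apply: eq_integral => t _; rewrite gee0_abs.
apply: filterS => t /(_ Logic.I) It0 e e0.
have e4 : 0 < (e / 4) ^+ 2 by rewrite exprn_gt0 // divr_gt0.
have [j Wj] : exists j, (W j t < ((e / 4) ^+ 2)%:E)%E.
  apply: contrapT => /forallNP H.
  have : (((e / 4) ^+ 2)%:E <= I t)%E.
    by apply: le_ereal_inf_tmp => _ [j _ <-]; rewrite leNgt; apply/negP; exact: H.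
  by rewrite It0 lee_fin leNgt e4.
have [_ pu cu] := hu.
have vq k : `|v j (dense_radius k) t| < e / 4.
  have [_ _ _ /(_ t k) H] := HW j.
  have := le_lt_trans H Wj; rewrite lte_fin -(real_normK (num_real (v j _ t))).
  by rewrite ltr_pXn2r ?nnegrE // divr_ge0 // ltW.
have vr r : 0 <= r < 1 -> `|u r t - u (s j * r) t| <= e / 4.
  move=> r01; rewrite leNgt; apply/negP => H.
  have [_ _ cv] := hv j.
  have d0 : 0 < `|v j r t| - e / 4 by rewrite subr_gt0.
  have [h h0 Hh] := cv t r _ r01 d0.
  have [k kr] := dense_radius_near r01 h0.
  have := Hh _ (dense_radius01 k) kr; have := vq k.
  have := lerB_normD (v j r t) (v j (dense_radius k) t - v j r t).
  rewrite subrKC; lra.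
have e8 : 0 < e / 8 by rewrite divr_gt0.
have [h h0 Hh] := cu t (s j) _ (s01 j) e8.
have [sj0 sj1] := andP (s01 j).
exists (Num.min h 2^-1).
  by rewrite lt_min h0 invr_gt0 ltr0n gt_min invf_lt1 ?ltr1n ?orbT.
have key r : 1 - Num.min h 2^-1 < r < 1 -> 0 <= r < 1 /\ `|u (s j * r) t - u (s j) t| < e / 8.
  move=> /andP[r1 r2].
  have m1 : Num.min h 2^-1 <= h by rewrite ge_min lexx.
  have m2 : Num.min h 2^-1 <= 2^-1 by rewrite ge_min lexx orbT.
  have r01 : 0 <= r < 1 by apply/andP; split; lra.
  split => //; apply: Hh; first exact: mul01.
  rewrite -{2}[s j]mulr1 -mulrBr normrM ger0_norm //.
  have : s j * `|r - 1| <= `|r - 1| by apply: ler_piMl => //; exact: ltW.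
  by rewrite ltr0_norm; lra.
move=> r r' /key[r01 Hr] /key[r'01 Hr'].
have V := vr r r01; have V' := vr r' r'01.
rewrite (_ : _ - _ = (u r t - u (s j * r) t) + (u (s j * r) t - u (s j) t)
  - (u (s j * r') t - u (s j) t) - (u r' t - u (s j * r') t)); last ring.
apply: le_lt_trans (ler_normB _ _) _; apply: le_lt_trans (lerD (ler_normB _ _) (lexx _)) _.
apply: le_lt_trans (lerD (lerD (ler_normD _ _) (lexx _)) (lexx _)) _.
lra.
Qed.

(** Fatou's lemma applied to energy_dist. *)
Lemma radial_limit_L2 u (ustar : X -> R) M s : harmonic_family u ->
  (forall r, 0 <= r < 1 -> energy u r <= M) -> 0 <= s < 1 ->
  {ae T, forall t, forall e, 0 < e -> exists2 h : R, 0 < h &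
    forall r, 1 - h < r < 1 -> `|u r t - ustar t| < e} ->
  measurable_fun setT ustar ->
  (\int[T]_t ((ustar t - u s t) ^+ 2)%:E <= (M - energy u s)%:E)%E.
Proof.
move=> hu uM s01 ulim mu; have [s0 s1] := andP s01.
have [tu _ _] := hu.
pose rk (k : nat) : R := Num.max s (1 - k.+1%:R^-1).
have rk01 k : 0 <= rk k < 1.
  by rewrite le_max s0 gt_max s1 /= gtrBl invr_gt0.
have srk k : s <= rk k by rewrite le_max lexx.
pose f k t := ((u (rk k) t - u s t) ^+ 2)%:E.
have mus r : 0 <= r < 1 -> measurable_fun setT (u r) by move=> /tu[].
have mf k : measurable_fun setT (f k).
  by apply/measurable_EFinP; apply: measurable_funX; apply: measurable_funB; exact: mus.
have f0 k t : (0 <= f k t)%E by rewrite lee_fin sqr_ge0.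
have If k : (\int[T]_t f k t <= (M - energy u s)%:E)%E.
  have hf : torus_function (fun t => (u (rk k) t - u s t) ^+ 2).
    by apply: torus_functionX; apply: torus_functionB; exact: tu.
  rewrite (ge0_RintegralE (torus_function_integrable hf)) lee_fin.
  have [_ rk1] := andP (rk01 k).
  by apply: le_trans (energy_dist hu s0 (srk k) rk1) _; rewrite lerB // uM.
have lim_f : {ae T, forall t, limn_einf (f ^~ t) = ((ustar t - u s t) ^+ 2)%:E}.
  apply: filterS ulim => t ut; apply: (cvg_limn_einf_sup _).1.
  apply: cvg_EFin; first by apply: nearW.
  have cu : u (rk k) t @[k --> \oo] --> ustar t.
    apply/cvgrPdist_lt => e e0; have [h h0 H] := ut e e0.
    have : \forall k \near \oo, (k.+1%:R^-1 : R) < h.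
      exact: near_infty_natSinv_lt (PosNum h0).
    apply: filterS => k kh; rewrite distrC; apply: H.
    have [_ ->] := andP (rk01 k); rewrite andbT lt_max; apply/orP; right.
    by rewrite ltrD2l ltrN2.
  have C : (u (rk k) t - u s t) ^+ 2 @[k --> \oo] --> (ustar t - u s t) ^+ 2.
    rewrite expr2; under eq_fun do rewrite expr2.
    by apply: cvgM; apply: cvgB => //; exact: cvg_cst.
  exact: C.
have F := fatou T measurableT mf (fun k t _ => f0 k t).
apply: (@le_trans _ _ (\int[T]_t limn_einf (f ^~ t))%E).
  rewrite le_eqVlt; apply/orP; left; apply/eqP; apply: ge0_ae_eq_integral => //.
  - by apply/measurable_EFinP; apply: measurable_funX; apply: measurable_funB => //; exact: mus.
  - have mfN k : measurable_fun setT (fun t => (- f k t)%E).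
      exact: measurableT_comp.
    exact: (measurableT_comp (@oppe_measurable _ setT) (measurable_fun_limn_esup mfN)).
  - by move=> t _; rewrite lee_fin sqr_ge0.
  - move=> t _; rewrite limn_einf_lim; apply: lime_ge; first exact: is_cvg_einfs.
    by apply: nearW => k; apply: le_ereal_inf_tmp => _ [j _ <-].
  - by apply: filterS lim_f => t -> _.
apply: le_trans F _; rewrite limn_einf_lim; apply: lime_le; first exact: is_cvg_einfs.
apply: nearW => k; apply: le_trans (If k).
by apply: ereal_inf_lbound; exists k => /=.
Qed.

End radial_limits.

(** * Real parts of holomorphic functions are harmonic families *)

Section tuple_continuity.
Context {R : realType} (n : nat).
Local Notation X := (n.-tuple R).

Definition tuple_continuous (g : X -> R) := forall t e, 0 < e ->
  exists2 h : R, 0 < h & forall s, (forall j, `|tnth s j - tnth t j| < h) -> `|g s - g t| < e.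

Lemma uniform_ord (Q : 'I_n -> R -> Prop) :
  (forall j h k, k <= h -> Q j h -> Q j k) ->
  (forall j, exists2 h : R, 0 < h & Q j h) -> exists2 h : R, 0 < h & forall j, Q j h.
Proof.
move=> Qle H; have /choice[h Hh] : forall j, exists h : R, 0 < h /\ Q j h.
  by move=> j; have [h h0 Qh] := H j; exists h.
exists (\big[Order.min/1]_j h j).
  by apply: lt_bigmin => // j _; have [] := Hh j.
move=> j; apply: (Qle _ (h j)); last by have [] := Hh j.
exact: bigmin_le.
Qed.

Lemma measurable_countable_factor (C : countType) (c : X -> C) (G : C -> R) :
  (forall z, measurable [set t | c t = z]) -> measurable_fun setT (G \o c).
Proof.
move=> mc _ B mB; rewrite setTI.
have -> : (G \o c) @^-1` B =
    \bigcup_k [set t | @unpickle C k = Some (c t) /\ B (G (c t))].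
  apply/seteqP; split => [t /= Bt|t [k _ [_ //]]].
  by exists (pickle (c t)) => //; split => //; rewrite pickleK.
apply: bigcupT_measurable => k.
case E : (unpickle k) => [z|]; last first.
  rewrite (_ : [set t | _] = set0); first exact: measurable0.
  by apply/seteqP; split => // t [].
have [BGz|BGz] := pselect (B (G z)).
  rewrite (_ : [set t | _] = [set t | c t = z]) //.
  apply/seteqP; split => t /=; first by case=> -[<-].
  by move=> ->; split.
rewrite (_ : [set t | _] = set0); first exact: measurable0.
by apply/seteqP; split => // t /= -[[<-]].
Qed.

(** A continuous function is the limit of its values at the lower corners of
    the cells of finer and finer grids, which are measurable because they take
    countably many values. *)
Lemma measurable_tuple_continuous (g : X -> R) : tuple_continuous g ->
  measurable_fun setT g.
Proof.
move=> cg.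
pose c (m : nat) (t : X) : n.-tuple int := [tuple Num.floor (m.+1%:R * tnth t j) | j < n].
pose G (m : nat) (z : n.-tuple int) := g [tuple (tnth z j)%:~R / m.+1%:R | j < n].
apply: (@measurable_fun_cvg _ _ _ _ (fun m => G m \o c m)).
  move=> m; apply: measurable_countable_factor => z.
  have -> : [set t | c m t = z] =
     \bigcap_(j in [set: 'I_n]) [set t | Num.floor (m.+1%:R * tnth t j) = tnth z j].
    apply/seteqP; split => [t <- j _ /=|t H]; first by rewrite tnth_mktuple.
    by apply: eq_from_tnth => j; rewrite tnth_mktuple; exact: H.
  apply: fin_bigcap_measurable => // j _.
  have -> : [set t : X | Num.floor (m.+1%:R * tnth t j) = tnth z j] =
     (fun t : X => m.+1%:R * tnth t j) @^-1` `[(tnth z j)%:~R, (tnth z j + 1)%:~R[.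
    apply/seteqP; split => t /=; rewrite in_itv /=.
      by move=> <-; rewrite floor_itv.
    by move=> H; apply/floor_def.
  rewrite -[X in measurable X]setTI.
  have mt : measurable_fun setT (fun t : X => m.+1%:R * tnth t j).
    by apply: measurable_funM => //; exact: measurable_tnth.
  by apply: mt.
move=> t _; apply/cvgrPdist_lt => e e0; have [h h0 H] := cg t e e0.
have : \forall m \near \oo, (m.+1%:R^-1 : R) < h.
  exact: near_infty_natSinv_lt (PosNum h0).
apply: filterS => m mh; rewrite distrC /G /=; apply: H => j.
rewrite !tnth_mktuple distrC.
have m0 : 0 < m.+1%:R :> R by [].
have := floor_itv (m.+1%:R * tnth t j); set z := Num.floor _ => /andP[z1 z2].
have -> : tnth t j - z%:~R / m.+1%:R = (m.+1%:R * tnth t j - z%:~R) / m.+1%:R.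
  by rewrite mulrBl mulrAC mulfV ?gt_eqF // mul1r.
rewrite ger0_norm; last by rewrite divr_ge0 // subr_ge0.
apply: le_lt_trans mh; rewrite -[leRHS]mul1r ler_pM2r ?invr_gt0 //.
by rewrite lerBlDl; apply: ltW; rewrite -[1]/(1%:~R) -intrD.
Qed.

Lemma circle_representative (x : R) : exists2 y : R, 0 <= y <= 2 * pi & expi y = expi x.
Proof.
pose k := Num.floor (x / (2 * pi)); have p0 := @twopi_gt0 R.
exists (x - k%:~R * (2 * pi)); last first.
  by rewrite -[LHS](expi_periodz _ k) subrK.
have := floor_itv (x / (2 * pi)); rewrite -/k ler_pdivlMr // ltr_pdivrMr // intrD mulrDl.
by move=> /andP[H1 H2]; apply/andP; split; lra.
Qed.

(** By periodicity it suffices to consider the compact cube [0, 2 pi]^n. *)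
Lemma bounded_tuple_continuous (g : X -> R) : tuple_continuous g -> periodic g ->
  exists M, forall t, `|g t| <= M.
Proof.
move=> cg pg.
pose G (w : 'rV[R]_n) := g [tuple w ord0 j | j < n].
have cG : continuous G.
  move=> w; have FF : ProperFilter (nbhs w) by exact: nbhs_pfilter.
  apply/(@cvgrPdist_lt _ _ _ (nbhs w) FF) => e e0; have [h h0 H] := cg [tuple w ord0 j | j < n] e e0.
  apply/nbhs_ballP; exists h => // w' ww'; rewrite distrC; apply: H => j.
  rewrite !tnth_mktuple distrC.
  by case: ww' => _ /(_ ord0 j).
have K := @rV_compact R n (fun=> `[0, 2 * pi]%classic) (fun=> @segment_compact R 0 (2 * pi)).
have := compact_bounded (continuous_compact (continuous_subspaceT cG) K).
move=> [M [_ HM]]; exists (M + 1) => t.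
have /choice[y Hy] : forall j, exists y : R, 0 <= y <= 2 * pi /\ expi y = expi (tnth t j).
  by move=> j; have [y y1 y2] := circle_representative (tnth t j); exists y.
apply: (HM (M + 1)); first by rewrite ltrDl.
exists (\row_j y j).
  by move=> j /=; rewrite mxE in_itv /=; have [] := Hy j.
by apply: pg => j; rewrite tnth_mktuple mxE; have [] := Hy j.
Qed.

End tuple_continuity.

Section hardy_slices.
Context {R : realType} (d : nat).
Local Notation C := (R[i]^o).
Local Notation point := 'rV[R[i]^o]_d.
Local Notation X := (d.-tuple R).
Implicit Types (f : point -> R[i]^o).

(** The restriction of f to the complex line through a point of the torus.
    Rotating the variable moves the point along the flow (slice_radial). *)
Definition slice f (t : X) (z : R[i]) : R[i] := f (\row_j (z * expi (tnth t j)) : point).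

Lemma slice_radial f (t : X) r x :
  slice f t (r%:C%C * expi x) = f (radial_point r (tshift t x)).
Proof.
congr f; apply/rowP => j; rewrite !mxE tnth_tshift addrC expiD.
by rewrite -mulrA.
Qed.

Lemma polydiskP (z : point) : polydisk z <-> forall j, cabs (z ord0 j) < 1.
Proof.
split=> H j; have Hj := H j; last first.
  by rewrite -[1]/((1 : R)%:C%C) [X in X < _]normC_cabs ltcR.
by rewrite [X in X < _]normC_cabs -[1]/((1 : R)%:C%C) ltcR in Hj.
Qed.

Definition holomorphic f := forall z : point, polydisk z -> differentiable f z.

Lemma cderivable_slice f t z : holomorphic f -> cabs z < 1 -> cderivable (slice f t) z.
Proof.
move=> df z1; apply/cderivableP.
pose e : point := \row_j expi (tnth t j).
have pz : polydisk (z *: e).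
  by apply/polydiskP => j; rewrite !mxE cabsM cabs_expi mulr1.
have := @diff_derivable _ _ _ f _ e (df _ pz).
rewrite /derivable.
have -> // : (fun h : C => h^-1 *: ((slice f t \o shift (z : C)) (h *: (1 : C)) - slice f t z : C)) =
   (fun h : C => h^-1 *: ((f \o shift (z *: e)) (h *: e) - f (z *: e))).
apply/funext => h; congr (_ *: (_ - _)).
  rewrite /slice /=; congr f; apply/rowP => j; rewrite !mxE.
  by rewrite /GRing.scale /= mulr1 mulrDl.
by rewrite /slice; congr f; apply/rowP => j; rewrite !mxE.
Qed.

Lemma differentiable_cabs_continuous f (z : point) e : differentiable f z -> 0 < e ->
  exists2 h : R, 0 < h & forall w : point, (forall j, cabs (w ord0 j - z ord0 j) < h) ->
    cabs (f w - f z) < e.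
Proof.
move=> df e0; have cf := differentiable_continuous df.
have FF : ProperFilter (nbhs z) by exact: nbhs_pfilter.
have /(@cvgrPdist_lt _ _ _ (nbhs z) FF) H := cf.
have : 0 < e%:C%C :> R[i] by rewrite ltcR.
move=> /H /nbhs_ballP[_ /posC[h h0 ->] Hh]; exists h => // w wz.
have := Hh w; rewrite [X in (_ -> X < _) -> _]normC_cabs ltcR cabsC; apply.
split=> [|i j]; first by rewrite ltcR.
rewrite (ord1 i) /ball /= [X in X < _]normC_cabs ltcR cabsC.
exact: wz.
Qed.

Lemma tuple_continuous_radial f r (L : R[i] -> R) : holomorphic f -> 0 <= r < 1 ->
  (forall z w, `|L z - L w| <= cabs (z - w)) ->
  tuple_continuous (fun t => L (f (radial_point r t))).
Proof.
move=> df /andP[r0 r1] HL t e e0.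
have pz : polydisk (radial_point r t).
  by apply/polydiskP => j; rewrite mxE cabsM cabs_expi mulr1 cabs_real ger0_norm.
have [h h0 H] := differentiable_cabs_continuous (df _ pz) e0.
have [h' h'0 H'] : exists2 h' : R, 0 < h' & forall (j : 'I_d) (x : R), `|x - tnth t j| < h' ->
    cabs (expi x - expi (tnth t j)) < h.
  apply: uniform_ord => [j a b ba Ha x xb|j]; first exact/Ha/(lt_le_trans xb).
  exact: expi_continuous.
exists h' => // s Hs; apply: le_lt_trans (HL _ _) _; apply: H => j.
rewrite !mxE -mulrBr cabsM cabs_real ger0_norm //.
apply: le_lt_trans (H' j _ (Hs j)); apply: ler_piMl; [exact: cabs_ge0|exact: ltW].
Qed.

Lemma periodic_radial f r T (L : R[i] -> T) : periodic (fun t : X => L (f (radial_point r t))).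
Proof. by move=> t s ts; congr (L (f _)); apply/rowP => j; rewrite !mxE ts. Qed.

(** The composition of radii is the Poisson formula for the slices of f. *)
Lemma harmonic_family_Re f : holomorphic f ->
  harmonic_family (fun r (t : X) => complex.Re (f (radial_point r t))).
Proof.
move=> df; split.
- move=> r r01.
  have tc : tuple_continuous (fun t : X => complex.Re (f (radial_point r t))).
    by apply: tuple_continuous_radial => // z w; rewrite -cReB; exact: Re_le_cabs.
  have pp := @periodic_radial f r _ (@complex.Re R).
  by split => //; [exact: measurable_tuple_continuous|exact: bounded_tuple_continuous].
- move=> r s t r01 s01; rewrite /poisson_operator.
  have := poisson_formula_disc 0 r01 s01 (fun z => @cderivable_slice f t z df).
  rewrite slice_radial tshift0 => ->.
  by apply: eq_Rintegral => x _; rewrite addr0 slice_radial.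
- move=> t r e r01 e0; have [r0 r1] := andP r01.
  have [|h h0 H] := @cderivable_ccontinuous R (slice f t) r%:C%C _ e e0.
    by apply: cderivable_slice => //; rewrite cabs_real ger0_norm.
  exists h => // r' r'01 rr.
  have E q : f (radial_point q t) = slice f t q%:C%C.
    by have := slice_radial f t q 0; rewrite expi0 mulr1 tshift0.
  rewrite -cReB !E; apply: le_lt_trans (Re_le_cabs _) _; apply: H.
  by rewrite -rmorphB /= cabs_real.
Qed.

End hardy_slices.

(** * Radial limits and the set where they exist *)

Section radial_limits.
Context {R : realType}.
Local Notation C := (R[i]^o).

Definition radial_limit (F : R -> R) (L : R) := forall e : R, 0 < e ->
  exists2 h : R, 0 < h & forall r, 1 - h < r < 1 -> `|F r - L| < e.

Lemma near_left1P (P : set R) :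
  (\forall r \near (1 : R)^'-, P r) <->
  exists2 h : R, 0 < h & forall r, 1 - h < r < 1 -> P r.
Proof.
split.
  move=> /nbhs_ballP[h /= h0 H]; exists h => // r /andP[r1 r2].
  by apply: H => //=; rewrite /ball /= ger0_norm; lra.
move=> [h h0 H]; apply/nbhs_ballP; exists h => //= r.
rewrite /ball /= => r1 r2; apply: H; rewrite r2 andbT.
by have := ler_norm (1 - r); lra.
Qed.

Lemma radial_limitP F L : F r @[r --> (1 : R)^'-] --> L <-> radial_limit F L.
Proof.
split=> [/cvgrPdist_lt H e e0|H].
  by have /near_left1P[h h0 Hh] := H e e0; exists h => // r /Hh; rewrite distrC.
apply/cvgrPdist_lt => e e0; apply/near_left1P.
by have [h h0 Hh] := H e e0; exists h => // r /Hh; rewrite distrC.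
Qed.

Lemma radial_cauchy_limit (F : R -> R) :
  (forall e, 0 < e -> exists2 h : R, 0 < h &
    forall r r', 1 - h < r < 1 -> 1 - h < r' < 1 -> `|F r - F r'| < e) ->
  exists L, radial_limit F L.
Proof.
move=> H; have : cvg (F r @[r --> (1 : R)^'-]).
  apply/cauchy_cvgP/cauchy_exP => e e0; have [h h0 Hh] := H e e0.
  exists (F (1 - h / 2)); apply/near_left1P; exists h => // r r1.
  by apply: Hh => //; lra.
by move=> /radial_limitP; exists (lim (F r @[r --> (1 : R)^'-])).
Qed.

Lemma radial_limit_cauchy (F : R -> R) L : radial_limit F L ->
  forall e, 0 < e -> exists2 h : R, 0 < h &
    forall r r', 1 - h < r < 1 -> 1 - h < r' < 1 -> `|F r - F r'| < e.
Proof.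
move=> H e e0; have [h h0 Hh] := H (e / 2) ltac:(lra); exists h => // r r' r1 r2.
have := Hh r r1; have := Hh r' r2 => H2 H1.
have -> : F r - F r' = (F r - L) - (F r' - L) by lra.
by apply: le_lt_trans (ler_normB _ _) _; lra.
Qed.

Definition radial_climit (F : R -> R[i]) (L : R[i]) :=
  radial_limit (fun r => complex.Re (F r)) (complex.Re L) /\
  radial_limit (fun r => complex.Im (F r)) (complex.Im L).

Lemma radial_climit_cabs F L : radial_climit F L <-> forall e : R, 0 < e ->
  exists2 h : R, 0 < h & forall r, 1 - h < r < 1 -> cabs (F r - L) < e.
Proof.
split=> [[H1 H2] e e0|H].
  have e20 : 0 < e / 2 by rewrite divr_gt0.
  have [h1 h10 Hh1] := H1 _ e20; have [h2 h20 Hh2] := H2 _ e20.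
  exists (Num.min h1 h2); first by rewrite lt_min h10.
  move=> r /andP[r0 r1]; apply: le_lt_trans (cabs_le_ReIm _) _.
  have m1 : Num.min h1 h2 <= h1 by rewrite ge_min lexx.
  have m2 : Num.min h1 h2 <= h2 by rewrite ge_min lexx orbT.
  have := Hh1 r ltac:(apply/andP; lra); have := Hh2 r ltac:(apply/andP; lra).
  rewrite cReB cImB; lra.
split=> e e0; have [h h0 Hh] := H e e0; exists h => // r /Hh.
  by rewrite -cReB; apply: le_lt_trans; exact: Re_le_cabs.
by rewrite -cImB; apply: le_lt_trans; exact: Im_le_cabs.
Qed.

Lemma radial_climitP (F : R -> C) (L : C) :
  F r @[r --> (1 : R)^'-] --> L <-> radial_climit F L.
Proof.
rewrite radial_climit_cabs; split=> [/cvgrPdist_lt H e e0|H].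
  have /near_left1P[h h0 Hh] := H e%:C%C ltac:(by rewrite ltcR); exists h => // r /Hh.
  by rewrite [X in X < _]normC_cabs ltcR cabsC.
apply/cvgrPdist_lt => _ /posC[e e0 ->]; apply/near_left1P.
have [h h0 Hh] := H e e0; exists h => // r /Hh.
by rewrite [X in _ -> X < _]normC_cabs ltcR cabsC.
Qed.

Lemma lim_radialE (F : R -> C) (L : C) : radial_climit F L ->
  lim (F r @[r --> (1 : R)^'-]) = L.
Proof. by move=> /radial_climitP; apply: cvg_lim. Qed.

(** At points without a radial limit, boundary_value takes the default value
    0. *)
Lemma lim_radial_dvg (F : R -> C) : ~ (exists L, radial_climit F L) ->
  lim (F r @[r --> (1 : R)^'-]) = 0.
Proof.
move=> H; apply: (@dvgP C) => /radial_climitP FL; apply: H.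
by exists (lim (F r @[r --> (1 : R)^'-])).
Qed.

Lemma radial_climit_bv (F : R -> C) : (exists L, radial_climit F L) ->
  radial_climit F (lim (F r @[r --> (1 : R)^'-])).
Proof. by move=> [L FL]; rewrite (lim_radialE FL). Qed.

Lemma radial_climitM (F G : R -> R[i]) (L M : R[i]) : radial_climit F L ->
  radial_climit G M -> radial_climit (fun r => F r * G r) (L * M).
Proof.
move=> /(radial_climitP (F : R -> C)) FL /(radial_climitP (G : R -> C)) GM.
exact/(radial_climitP (fun r => F r * G r : C))/(@cvgM _ _ _ _ (F : R -> C) G _ _ FL GM).
Qed.

Lemma radial_climitD (F G : R -> R[i]) (L M : R[i]) : radial_climit F L ->
  radial_climit G M -> radial_climit (fun r => F r + G r) (L + M).
Proof.
move=> /(radial_climitP (F : R -> C)) FL /(radial_climitP (G : R -> C)) GM.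
exact/(radial_climitP (fun r => F r + G r : C))/(@cvgD _ _ _ _ _ (F : R -> C) G _ _ FL GM).
Qed.

End radial_limits.

Lemma near_infty_natSinv_lt_ex (R : archiRealFieldType) (h : R) : 0 < h -> exists m, m.+1%:R^-1 < h.
Proof.
by move=> h0; have [m _ Hm] := near_infty_natSinv_lt (PosNum h0); exists m; exact: (Hm m (leqnn m)).
Qed.

Section cauchy_set.
Context {R : realType} (n : nat).
Local Notation X := (n.-tuple R).

Definition cauchy_set (u : R -> X -> R) := [set t : X | exists L, radial_limit (u^~ t) L].

(** By continuity in the radius, Cauchy's criterion can be tested on countably
    many radii. *)
Lemma measurable_cauchy_set u : harmonic_family u -> measurable (cauchy_set u).
Proof.
move=> [tu _ cu]; pose q := @dense_radius R; have q01 : forall k, 0 <= q k < 1 := @dense_radius01 R.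
have -> : cauchy_set u = \bigcap_j \bigcup_m \bigcap_k \bigcap_l
    [set t | 1 - m.+1%:R^-1 < q k -> 1 - m.+1%:R^-1 < q l ->
             `|u (q k) t - u (q l) t| <= j.+1%:R^-1].
  apply/seteqP; split => t.
    move=> [L uL] j _; have j0 : 0 < j.+1%:R^-1 :> R by rewrite invr_gt0.
    have [h h0 Hh] := radial_limit_cauchy uL j0.
    have [m mh] := near_infty_natSinv_lt_ex h0.
    exists m => // k _ l _ k1 l1; apply/ltW/Hh; apply/andP; split.
    - by apply: lt_trans k1; rewrite ltrD2l ltrN2.
    - by have /andP[] := q01 k.
    - by apply: lt_trans l1; rewrite ltrD2l ltrN2.
    - by have /andP[] := q01 l.
  move=> H; apply: radial_cauchy_limit => e e0.
  have e30 : 0 < e / 3 by lra.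
  have [j je] := near_infty_natSinv_lt_ex e30.
  have [m _ Hm] := H j I.
  have m0 : 0 < m.+1%:R^-1 :> R by rewrite invr_gt0.
  have m1 : m.+1%:R^-1 <= 1 :> R by rewrite invf_le1 // ler1n.
  move: (m.+1%:R^-1) (j.+1%:R^-1) m0 m1 je Hm => a b m0 m1 je Hm.
  exists a => // r r' r1 r1'.
  have approx x : 1 - a < x < 1 -> exists k, 1 - a < q k /\ `|u (q k) t - u x t| < e / 3.
    move=> /andP[x0 x1].
    have x01 : 0 <= x < 1 by apply/andP; lra.
    have [h h0 Hh] := cu t x _ x01 e30.
    have g0 : 0 < Num.min h (x - (1 - a)) by rewrite lt_min h0 subr_gt0.
    have [k Hk] := dense_radius_near x01 g0.
    move: Hk; rewrite lt_min => /andP[Hk1 Hk2]; exists k.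
    have Hk3 : `|u (q k) t - u x t| < e / 3 := Hh _ (q01 k) Hk1.
    split=> //.
    by have := ler_norm (x - q k); rewrite distrC /q; lra.
  have [k [k1 Hk]] := approx r r1; have [l [l1 Hl]] := approx r' r1'.
  have := Hm k I l I k1 l1 => Hkl.
  have -> : u r t - u r' t = (u (q k) t - u (q l) t) - (u (q k) t - u r t) + (u (q l) t - u r' t).
    by lra.
  apply: le_lt_trans (ler_normD _ _) _.
  have := ler_normB (u (q k) t - u (q l) t) (u (q k) t - u r t); lra.
apply: bigcapT_measurable => j; apply: bigcupT_measurable => m.
apply: bigcapT_measurable => k; apply: bigcapT_measurable => l.
have [k1|k1] := boolP (1 - m.+1%:R^-1 < q k); last first.
  by rewrite (_ : [set t | _] = setT) //; apply/seteqP; split => // t _ /= /(negP k1).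
have [l1|l1] := boolP (1 - m.+1%:R^-1 < q l); last first.
  by rewrite (_ : [set t | _] = setT) //; apply/seteqP; split => // t _ /= _ /(negP l1).
have [mk _ _] := tu _ (q01 k); have [ml _ _] := tu _ (q01 l).
have mkl : measurable_fun setT (fun t => `|u (q k) t - u (q l) t|).
  by apply: measurableT_comp => //; exact: measurable_funB.
rewrite (_ : [set t | _] = (fun t => `|u (q k) t - u (q l) t|) @^-1` `]-oo, j.+1%:R^-1]).
  by rewrite -[X in measurable X]setTI; exact: mkl.
by apply/seteqP; split => t /=; rewrite in_itv /= => H; [exact: H|].
Qed.

End cauchy_set.

(** * Limits of harmonic families in the mean square *)

Section square_integrable.
Context d (Y : measurableType d) (R : realType) (P : probability Y R).
Implicit Types f g h : Y -> R.

Definition square_integrable f :=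
  measurable_fun setT f /\ P.-integrable setT (EFin \o (fun t => f t ^+ 2)).

Lemma integrable_dominated f g : measurable_fun setT f ->
  P.-integrable setT (EFin \o g) -> (forall t, `|f t| <= g t) -> P.-integrable setT (EFin \o f).
Proof.
move=> mf ig fg; apply: le_integrable ig => //; first exact/measurable_EFinP.
by move=> t _; rewrite /= lee_fin (le_trans (fg t)) // ler_norm.
Qed.

Lemma integrable_lin f g k l : P.-integrable setT (EFin \o f) -> P.-integrable setT (EFin \o g) ->
  P.-integrable setT (EFin \o (fun t => k * f t + l * g t)).
Proof.
move=> i1 i2.
have := integrableD measurableT (integrableZl measurableT k i1) (integrableZl measurableT l i2).
by apply: eq_integrable => // t _ /=; rewrite EFinD !EFinM.
Qed.

Lemma square_integrableM f g : square_integrable f -> square_integrable g ->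
  P.-integrable setT (EFin \o (fun t => f t * g t)).
Proof.
move=> [mf jf] [mg jg]; apply: integrable_dominated (integrable_lin 1 1 jf jg) _.
  exact: measurable_funM.
by move=> t; rewrite ler_norml; apply/andP; split; nra.
Qed.

Lemma square_integrable_lin f g k l : square_integrable f -> square_integrable g ->
  square_integrable (fun t => k * f t + l * g t).
Proof.
move=> [mf jf] [mg jg]; split.
  by apply: measurable_funD; apply: measurable_funM => //; exact: measurable_cst.
have i := integrable_lin (2 * k ^+ 2) (2 * l ^+ 2) jf jg.
apply: integrable_dominated i _.
  apply: measurable_funX; apply: measurable_funD; apply: measurable_funM => //; exact: measurable_cst.
move=> t; rewrite ger0_norm ?sqr_ge0 //.
by have := sqr_ge0 (k * f t - l * g t); nra.
Qed.

Lemma square_integrableB f g : square_integrable f -> square_integrable g ->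
  square_integrable (fun t => f t - g t).
Proof.
move=> jf jg; have := square_integrable_lin 1 (-1) jf jg.
by congr square_integrable; apply/funext => t; lra.
Qed.

Lemma Rintegral_abs_le f g h k l : P.-integrable setT (EFin \o f) ->
  P.-integrable setT (EFin \o g) -> P.-integrable setT (EFin \o h) ->
  (forall t, `|f t| <= k * g t + l * h t) ->
  `|\int[P]_t f t| <= k * \int[P]_t g t + l * \int[P]_t h t.
Proof.
move=> jf jg jh H; rewrite ler_norml; apply/andP; split; last first.
  by apply: Rintegral_le_lin => // t; apply: le_trans (ler_norm _) (H t).
rewrite lerNl -mulN1r -(RintegralZl (-1) measurableT jf); apply: Rintegral_le_lin => //.
  have := integrableZl measurableT (-1) jf.
  by apply: eq_integrable => // t _ /=; rewrite EFinM.
by move=> t; rewrite mulN1r; apply: le_trans (H t); rewrite -normrN; exact: ler_norm.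
Qed.

Lemma le_amgm (a b c : R) : 0 <= a -> 0 <= b -> c ^+ 2 <= a * b -> `|c| <= a + b.
Proof.
move=> a0 b0 H; rewrite -[leRHS]ger0_norm ?addr_ge0 // -ler_sqr ?nnegrE //.
by rewrite !real_normK ?num_real //; nra.
Qed.

Lemma young f g k : 0 < k -> square_integrable f -> square_integrable g ->
  `|\int[P]_t (f t * g t)| <= k * \int[P]_t (f t ^+ 2) + k^-1 * \int[P]_t (g t ^+ 2).
Proof.
move=> k0 jf jg; have k1 : 0 < k^-1 by rewrite invr_gt0.
have [[_ if2] [_ ig2]] := (jf, jg).
apply: Rintegral_abs_le => //; first exact: square_integrableM.
move=> t; apply: le_amgm; try by apply: mulr_ge0; [exact: ltW|exact: sqr_ge0].
by rewrite mulrACA mulfV ?gt_eqF // mul1r exprMn.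
Qed.

Lemma Rintegral_sqr_ge0 f : 0 <= \int[P]_t (f t ^+ 2).
Proof. by apply: Rintegral_ge0 => t _; exact: sqr_ge0. Qed.

End square_integrable.

Section L2_limit.
Context {R : realType} (n : nat).
Local Notation X := (n.-tuple R).
Local Notation T := (@torus R n).
Implicit Types (u v : R -> X -> R) (f g : X -> R).

Lemma torus_function_square_integrable f : torus_function f -> square_integrable T f.
Proof.
move=> tf; split; first by have [] := tf.
exact: torus_function_integrable (torus_functionX tf).
Qed.

Definition L2_limit u g := square_integrable T g /\ forall e, 0 < e ->
  exists2 s0 : R, 0 <= s0 < 1 & forall s, s0 <= s < 1 -> \int[T]_t ((g t - u s t) ^+ 2) < e.

Lemma ge0_Rintegral_le f b : measurable_fun setT f -> (forall t, 0 <= f t) ->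
  (\int[T]_t (f t)%:E <= b%:E)%E ->
  T.-integrable setT (EFin \o f) /\ \int[T]_t f t <= b.
Proof.
move=> mf f0 H; have i : T.-integrable setT (EFin \o f).
  apply/integrableP; split; first exact/measurable_EFinP.
  apply: le_lt_trans (ltry b); apply: le_trans H; apply: ge0_le_integral => //.
  - by do 2 apply: measurableT_comp => //.
  - exact/measurable_EFinP.
  - by move=> t _ /=; rewrite lee_fin ger0_norm.
by split => //; rewrite -lee_fin -ge0_RintegralE.
Qed.

(** The error at radius s is at most the gap between the supremum of the
    energies and the energy at s. *)
Lemma radial_limit_L2_limit u g M : harmonic_family u ->
  (forall r, 0 <= r < 1 -> energy u r <= M) ->
  {ae T, forall t, radial_limit (u^~ t) (g t)} -> measurable_fun setT g -> L2_limit u g.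
Proof.
move=> hu uM ulim mg; have [tu _ _] := hu.
pose A := [set energy u r | r in [set r | 0 <= r < 1]].
have z01 : 0 <= (0 : R) < 1 by rewrite lexx ltr01.
have A0 : A (energy u 0) by exists 0.
have Aub : has_ubound A by exists M => _ [r r01 <-]; exact: uM.
have hA : has_sup A by split => //; exists (energy u 0).
have uS r : 0 <= r < 1 -> energy u r <= sup A by move=> r01; apply: ub_le_sup => //; exists r.
have key s : 0 <= s < 1 -> T.-integrable setT (EFin \o (fun t => (g t - u s t) ^+ 2)) /\
    \int[T]_t ((g t - u s t) ^+ 2) <= sup A - energy u s.
  move=> s01; apply: ge0_Rintegral_le.
  - by apply: measurable_funX; apply: measurable_funB => //; have [] := tu _ s01.
  - by move=> t; exact: sqr_ge0.
  - exact: radial_limit_L2 hu uS s01 ulim mg.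
split.
  split=> //; have [i0 _] := key 0 z01.
  have [_ j0] := torus_function_square_integrable (tu _ z01).
  apply: integrable_dominated (integrable_lin 2 2 i0 j0) _; first exact: measurable_funX.
  move=> t; rewrite ger0_norm ?sqr_ge0 //.
  by have := sqr_ge0 (g t - u 0 t - u 0 t); nra.
move=> e e0; have [_ [s s01 <-] Hs] := sup_adherent e0 hA.
exists s => // r /andP[sr r1]; have [s0 s1] := andP s01.
have r01 : 0 <= r < 1 by rewrite (le_trans s0 sr).
have [_ H] := key r r01; have := energy_mono hu s0 sr r1; lra.
Qed.

Lemma le_eps_mul (a b K : R) : (forall e, 0 < e -> a <= b + e * K) -> a <= b.
Proof.
move=> H; have K0 : 0 < `|K| + 1 by rewrite ltr_wpDl.
apply/ler_addgt0Pr => e e0; have ee : 0 < e / (`|K| + 1) by rewrite divr_gt0.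
apply: le_trans (H _ ee) _; rewrite lerD2l.
apply: (@le_trans _ _ (e / (`|K| + 1) * (`|K| + 1))).
  by apply: ler_wpM2l; [exact: ltW|have := ler_norm K; lra].
by rewrite divfK // gt_eqF.
Qed.

(** The radius s0 is independent of h: this uniformity is used along a
    sequence of functions in component_weak_null. *)
Lemma L2_limit_young u g k e : harmonic_family u -> L2_limit u g -> 0 < k -> 0 < e ->
  exists2 s0 : R, 0 <= s0 < 1 & forall s h, s0 <= s < 1 -> square_integrable T h ->
    `|\int[T]_t (g t * h t) - \int[T]_t (u s t * h t)| <= k * \int[T]_t (h t ^+ 2) + e.
Proof.
move=> [tu _ _] [jg H] k0 e0.
have ke : 0 < e * k by rewrite mulr_gt0.
have [s0 s01 Hs] := H _ ke; exists s0 => // s h ss jh.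
have s1 : 0 <= s < 1 by have /andP[s00 _] := s01; have /andP[? ->] := ss; rewrite (le_trans s00).
have ju := torus_function_square_integrable (tu _ s1).
rewrite -RintegralB //; try exact: square_integrableM.
rewrite (_ : \int[T]_t _ = \int[T]_t (h t * (g t - u s t))); last first.
  by apply: eq_Rintegral => t _; ring.
apply: le_trans (young k0 jh (square_integrableB jg ju)) _.
rewrite lerD2l mulrC ler_pdivrMr //; apply: ltW; exact: Hs.
Qed.

Lemma L2_limit_energy u g s : harmonic_family u -> L2_limit u g -> 0 <= s < 1 ->
  energy u s <= \int[T]_t (g t ^+ 2).
Proof.
move=> hu ug s01; have [tu _ _] := hu; have [jg H] := ug.
apply: (@le_eps_mul _ _ (2 * \int[T]_t (g t ^+ 2) + 3)) => e e0.
have ee : 0 < e * Num.min e 1 by rewrite mulr_gt0 // lt_min e0 ltr01.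
have [s0 s00 Hs] := H _ ee.
pose r := Num.max s s0.
have r01 : 0 <= r < 1.
  by rewrite /r le_max gt_max; have /andP[-> ->] := s01; have /andP[_ ->] := s00.
have sr : s <= r by rewrite /r le_max lexx.
have s0r : s0 <= r < 1 by rewrite /r le_max lexx orbT; have /andP[_] := r01.
have [r0 r1] := andP r01; have [s0' s1] := andP s01.
apply: le_trans (energy_mono hu s0' sr r1) _.
have ju := torus_function_square_integrable (tu _ r01).
have jd := square_integrableB jg ju.
have Y := young e0 jg jd; have Hr := Hs r s0r.
have E : energy u r = \int[T]_t (g t ^+ 2) - 2 * \int[T]_t (g t * (g t - u r t)) +
    \int[T]_t ((g t - u r t) ^+ 2).
  have ip := square_integrableM jg jd; have [_ i1] := jg; have [_ i2] := jd.
  rewrite -(RintegralZl _ measurableT ip) -RintegralB //; last first.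
    by have := integrableZl measurableT 2 ip; apply: eq_integrable => // t _ /=; rewrite EFinM.
  rewrite -RintegralD //; last first.
    have := integrable_lin 1 (-2) i1 ip; apply: eq_integrable => // t _ /=.
    by congr EFin; ring.
  by apply: eq_Rintegral => t _; ring.
have D1 : e^-1 * \int[T]_t ((g t - u r t) ^+ 2) <= Num.min e 1.
  by rewrite mulrC ler_pdivrMr // mulrC; exact: ltW.
have m1 : Num.min e 1 <= e by rewrite ge_min lexx.
have m2 : e * Num.min e 1 <= e by apply: ler_piMr; [exact: ltW|rewrite ge_min lexx orbT].
move: Y Hr D1; rewrite ler_norml E => /andP[Y1 Y2] Hr D1; lra.
Qed.

(** At a common radius c beyond s the two pairings are close to those of
    harmonic_pairing_sym. *)
Lemma L2_limit_sym u v g h s : harmonic_family u -> harmonic_family v ->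
  L2_limit u g -> L2_limit v h -> 0 <= s < 1 ->
  \int[T]_t (u s t * h t) = \int[T]_t (g t * v s t).
Proof.
move=> hu hv ug vh s01; have [s0 s1] := andP s01.
have [[tu _ _] [tv _ _]] := (hu, hv).
have [ju jv] := (torus_function_square_integrable (tu _ s01), torus_function_square_integrable (tv _ s01)).
apply/eqP; rewrite -subr_eq0 -normr_eq0 eq_le normr_ge0 andbT.
apply: (@le_eps_mul _ _ (\int[T]_t (v s t ^+ 2) + \int[T]_t (u s t ^+ 2) + 2)) => e e0.
have [a /andP[a0 a1] Ha] := L2_limit_young hu ug e0 e0.
have [b /andP[b0 b1] Hb] := L2_limit_young hv vh e0 e0.
(* The radius c exceeds s, which is then c times s / c, and both approximation radii. *)
have [c /andP[c1 c2]] : exists c, Num.max s (Num.max a b) < c < 1.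
  exists ((Num.max s (Num.max a b) + 1) / 2); apply/andP.
  have : Num.max s (Num.max a b) < 1 by rewrite !gt_max s1 a1.
  by split; lra.
move: c1; rewrite !gt_max => /and3P[sc ac bc].
have c0 : 0 < c by apply: le_lt_trans sc.
have c01 : 0 <= c < 1 by rewrite (ltW c0).
have sc01 : 0 <= s / c < 1.
  by rewrite divr_ge0 ?(ltW c0) //= ltr_pdivrMr // mul1r.
have := harmonic_pairing_sym hu hv sc01 c01; rewrite divfK ?gt_eqF // => E.
have := Ha c (v s) ltac:(by rewrite (ltW ac)) jv.
have := Hb c (u s) ltac:(by rewrite (ltW bc)) ju.
rewrite -E (_ : \int[T]_t (h t * u s t) = \int[T]_t (u s t * h t)); last first.
  by apply: eq_Rintegral => t _; ring.
rewrite (_ : \int[T]_t (v c t * u s t) = \int[T]_t (u s t * v c t)); last first.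
  by apply: eq_Rintegral => t _; ring.
by rewrite !ler_norml => /andP[? ?] /andP[? ?]; apply/andP; split; lra.
Qed.

(** |g v_m| <= k c_m + k^-1 g^2 b_m^2 for every k > 0. The first term is small
    in the mean with k, and the second one tends to 0 by dominated
    convergence. *)
Lemma weak_null (g : X -> R) (v c : nat -> X -> R) (b : nat -> X -> R) (M : R) e :
  square_integrable T g -> (forall m, square_integrable T (v m)) ->
  (forall m, measurable_fun setT (b m)) -> (forall m t, 0 <= b m t <= 1) ->
  (forall t, b ^~ t @ \oo --> (0 : R)) ->
  (forall m, T.-integrable setT (EFin \o c m)) -> (forall m, \int[T]_t c m t <= M) ->
  (forall m t, 0 <= c m t) -> (forall m t, v m t ^+ 2 <= b m t ^+ 2 * c m t) -> 0 < e ->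
  \forall m \near \oo, `|\int[T]_t (g t * v m t)| < e.
Proof.
move=> jg jv mb b01 b0 jc cM c0 vb e0; have [mg ig] := jg.
pose w m t := g t ^+ 2 * b m t ^+ 2.
have mw m : measurable_fun setT (w m) by apply: measurable_funM; exact: measurable_funX.
have wle m t : `|w m t| <= g t ^+ 2.
  rewrite /w normrM [`|g t ^+ 2|]ger0_norm ?sqr_ge0 //; apply: ler_piMr; first exact: sqr_ge0.
  have /andP[b1 b2] := b01 m t; rewrite ger0_norm ?sqr_ge0 //; exact: exprn_ile1.
have iw m : T.-integrable setT (EFin \o w m) by apply: integrable_dominated ig _.
have M0 : 0 <= M by apply: le_trans (cM 0%N); apply: Rintegral_ge0 => t _; exact: c0.
have k0 : 0 < e / (2 * (M + 1)) by rewrite divr_gt0 // mulr_gt0 // ltr_wpDl.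
set k := e / (2 * (M + 1)) in k0 *.
have bnd m : `|\int[T]_t (g t * v m t)| <= k * \int[T]_t c m t + k^-1 * \int[T]_t w m t.
  apply: Rintegral_abs_le => //; first exact: square_integrableM.
  have k1 : 0 < k^-1 by rewrite invr_gt0.
  move=> t; apply: le_amgm; first by rewrite mulr_ge0 // ltW.
    by rewrite mulr_ge0 ?(ltW k1) // /w mulr_ge0 ?sqr_ge0.
  rewrite mulrACA mulfV ?gt_eqF // mul1r exprMn /w.
  by have := vb m t; have := sqr_ge0 (g t); nra.
have w0 : \int[T]_t w m t @[m --> \oo] --> 0.
  have cvw : {ae T, forall t, setT t -> (EFin \o w m) t @[m --> \oo] --> (cst 0%E : X -> \bar R) t}.
    apply: aeW => t _; apply/fine_cvgP; split; first by near=> m.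
    rewrite /= [X in _ --> X](_ : _ = g t ^+ 2 * (0 * 0)); last by rewrite !mulr0.
    by apply: cvgMr; apply: cvgM; exact: b0.
  have dom : {ae T, forall t m, setT t -> (`|(EFin \o w m) t| <= (EFin \o (fun t => (g t ^+ 2)%R)) t)%E}.
    by apply: aeW => t m _; rewrite /= lee_fin.
  have mw' m : measurable_fun setT (EFin \o w m) by exact/measurable_EFinP.
  have [_ _] := dominated_convergence measurableT mw' (measurable_cst _) cvw ig dom.
  rewrite [X in _ --> X](_ : _ = 0%:E); last by rewrite integral0_eq.
  by move=> /fine_cvgP[].
have k1 : 0 < e / 2 * k by rewrite mulr_gt0 // divr_gt0.
have := w0 => /cvgrPdist_lt /(_ _ k1); apply: filterS => m; rewrite sub0r normrN => Hm.
apply: le_lt_trans (bnd m) _.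
have H1 : k * \int[T]_t c m t <= e / 2.
  apply: le_trans (ler_wpM2l (ltW k0) (cM m)) _.
  rewrite /k mulrAC ler_pdivrMr ?mulr_gt0 // ?ltr_wpDl //; nra.
have H2 : k^-1 * \int[T]_t w m t < e / 2.
  rewrite mulrC ltr_pdivrMr //; apply: le_lt_trans Hm; exact: ler_norm.
lra.
Unshelve. all: by end_near.
Qed.

End L2_limit.

(** * Boundary values in the Hardy space *)

Section hardy_boundary.
Context {R : realType} (d : nat).
Local Notation C := (R[i]^o).
Local Notation point := 'rV[R[i]^o]_d.
Local Notation X := (d.-tuple R).
Local Notation T := (@torus R d).
Implicit Types (f g : point -> R[i]^o).

Definition real_trace f r (t : X) : R := complex.Re (f (radial_point r t)).
Definition imag_trace f r (t : X) : R := complex.Im (f (radial_point r t)).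

Lemma holomorphicM f g : holomorphic f -> holomorphic g -> holomorphic (f \* g).
Proof. by move=> df dg z pz; apply: differentiableM; [exact: df|exact: dg]. Qed.

Lemma holomorphicB f g : holomorphic f -> holomorphic g -> holomorphic (f \- g).
Proof. by move=> df dg z pz; apply: differentiableB; [exact: df|exact: dg]. Qed.

Lemma holomorphicZ (k : R[i]) f : holomorphic f -> holomorphic (fun z => k * f z).
Proof. by move=> df z pz; exact: (@differentiableZ _ _ _ f k z (df z pz)). Qed.

Lemma harmonic_real_trace f : holomorphic f -> harmonic_family (real_trace f).
Proof. exact: harmonic_family_Re. Qed.

(** The imaginary part of f is the real part of -if. *)
Lemma harmonic_imag_trace f : holomorphic f -> harmonic_family (imag_trace f).
Proof.
move=> df; have := harmonic_family_Re (holomorphicZ (- 'i%C) df).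
congr harmonic_family; apply/funext => r; apply/funext => t.
by rewrite /imag_trace; case: (f _) => a b /=; ring.
Qed.

Lemma Re_normsq (z : R[i]) : complex.Re (`|z| ^+ 2) = complex.Re z ^+ 2 + complex.Im z ^+ 2.
Proof. by rewrite normC_cabs -rmorphXn /= cabs_sqr. Qed.

Lemma torus_mean_normsq f r : holomorphic f -> 0 <= r < 1 ->
  torus_mean (fun t : X => complex.Re (`|f (radial_point r t)| ^+ 2)) =
  energy (real_trace f) r + energy (imag_trace f) r.
Proof.
move=> df r01.
have [t1 _ _] := harmonic_real_trace df; have [t2 _ _] := harmonic_imag_trace df.
have i1 := torus_function_integrable (torus_functionX (t1 _ r01)).
have i2 := torus_function_integrable (torus_functionX (t2 _ r01)).
rewrite /energy -RintegralD //.
rewrite (_ : (fun t : X => _) = fun t => real_trace f r t ^+ 2 + imag_trace f r t ^+ 2); last first.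
  by apply/funext => t; rewrite Re_normsq.
rewrite torus_meanE //; have := integrable_lin 1 1 i1 i2.
by apply: eq_integrable => // t _ /=; congr EFin; ring.
Qed.

Lemma hardy_holomorphic f : hardy f -> holomorphic f.
Proof. by case=> _ df _ z; exact: df. Qed.

Lemma hardy_energy f : hardy f -> exists M, forall r, 0 <= r < 1 ->
  energy (real_trace f) r + energy (imag_trace f) r <= M.
Proof.
move=> hf; have [_ _ [M HM]] := hf; exists M => r r01.
by rewrite -torus_mean_normsq //; [exact: HM|exact: hardy_holomorphic].
Qed.

Lemma hardy_intro f M : (forall z, ~ polydisk z -> f z = 0) -> holomorphic f ->
  (forall r, 0 <= r < 1 -> energy (real_trace f) r + energy (imag_trace f) r <= M) -> hardy f.
Proof.
move=> f0 df HM; split=> //; exists M => r r01.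
by rewrite torus_mean_normsq //; exact: HM.
Qed.

Lemma energy_ge0 (u : R -> X -> R) r : 0 <= energy u r.
Proof. exact: Rintegral_sqr_ge0. Qed.

Lemma hardy_real_energy f : hardy f -> exists M, forall r, 0 <= r < 1 ->
  energy (real_trace f) r <= M.
Proof.
move=> /hardy_energy[M HM]; exists M => r /HM; apply: le_trans.
by rewrite lerDl energy_ge0.
Qed.

Lemma hardy_imag_energy f : hardy f -> exists M, forall r, 0 <= r < 1 ->
  energy (imag_trace f) r <= M.
Proof.
move=> /hardy_energy[M HM]; exists M => r /HM; apply: le_trans.
by rewrite lerDr energy_ge0.
Qed.

Lemma ae_cauchy_set (u : R -> X -> R) M : harmonic_family u ->
  (forall r, 0 <= r < 1 -> energy u r <= M) -> {ae T, forall t, cauchy_set u t}.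
Proof.
move=> hu uM; have := ae_radial_cauchy hu uM; apply: filterS => t H.
by apply: radial_cauchy_limit => e e0; have [h /andP[h0 _] Hh] := H e e0; exists h.
Qed.

Lemma ae_boundary_value f : hardy f ->
  {ae T, forall t, radial_climit (fun r => f (radial_point r t)) (boundary_value f t)}.
Proof.
move=> hf; have df := hardy_holomorphic hf.
have [M HM] := hardy_real_energy hf; have [N HN] := hardy_imag_energy hf.
have := ae_cauchy_set (harmonic_real_trace df) HM.
apply: filterS2 (ae_cauchy_set (harmonic_imag_trace df) HN) => t [b Hb] [a Ha].
by apply: radial_climit_bv; exists (a +i* b)%C.
Qed.

(** The convergence set is measurable, the boundary value is a limit along a
    sequence of radii on this set, and it is 0 elsewhere. *)
Lemma measurable_boundary f : holomorphic f ->
  measurable_fun setT (fun t : X => complex.Re (boundary_value f t)) /\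
  measurable_fun setT (fun t : X => complex.Im (boundary_value f t)).
Proof.
move=> df; have hr := harmonic_real_trace df; have hi := harmonic_imag_trace df.
pose D := cauchy_set (real_trace f) `&` cauchy_set (imag_trace f).
have mD : measurable D by apply: measurableI; exact: measurable_cauchy_set.
pose q (m : nat) : R := 1 - m.+1%:R^-1.
have q01 m : 0 <= q m < 1.
  have m1 : m.+1%:R^-1 <= 1 :> R by rewrite invf_le1 // ler1n.
  by rewrite subr_ge0 m1 ltrBlDl ltrDr invr_gt0 ltr0n.
have qlim F L : radial_limit F L -> F (q m) @[m --> \oo] --> L.
  move=> H; apply/cvgrPdist_lt => e e0; have [h h0 Hh] := H e e0.
  have : \forall m \near \oo, (m.+1%:R^-1 : R) < h by exact: near_infty_natSinv_lt (PosNum h0).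
  apply: filterS => m mh; rewrite distrC; apply: Hh.
  by have /andP[_ ->] := q01 m; rewrite andbT ltrD2l ltrN2.
have onD t : D t -> radial_climit (fun r => f (radial_point r t)) (boundary_value f t).
  by move=> [[a Ha] [b Hb]]; apply: radial_climit_bv; exists (a +i* b)%C.
have offD t : ~ D t -> boundary_value f t = 0.
  move=> Dt; apply: lim_radial_dvg => -[L [H1 H2]]; apply: Dt.
  by split; [exists (complex.Re L)|exists (complex.Im L)].
have key (u : R -> X -> R) (g : X -> R) : harmonic_family u ->
    (forall t, D t -> radial_limit (u^~ t) (g t)) -> (forall t, ~ D t -> g t = 0) ->
    measurable_fun setT g.
  move=> [tu _ _] H1 H2.
  apply: (@measurable_fun_cvg _ _ _ _ (fun m t => \1_D t * u (q m) t)).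
    move=> m; apply: measurable_funM; first exact: measurable_indic.
    by have [] := tu _ (q01 m).
  move=> t _; have [Dt|Dt] := pselect (D t).
    rewrite (_ : (fun m => \1_D t * u (q m) t) = (fun m => u (q m) t)).
      exact: qlim (H1 t Dt).
    by apply/funext => m; rewrite indicE mem_set // mul1r.
  rewrite H2 // (_ : (fun m => \1_D t * u (q m) t) = cst 0); first exact: cvg_cst.
  by apply/funext => m; rewrite indicE memNset // mul0r.
split.
  by refine (key _ _ hr _ _) => t Dt; [have [] := onD t Dt|rewrite offD].
by refine (key _ _ hi _ _) => t Dt; [have [] := onD t Dt|rewrite offD].
Qed.

Lemma real_L2_limit f : hardy f ->
  L2_limit (real_trace f) (fun t => complex.Re (boundary_value f t)).
Proof.
move=> hf; have df := hardy_holomorphic hf; have [M HM] := hardy_real_energy hf.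
apply: (radial_limit_L2_limit (harmonic_real_trace df) HM); last by have [] := measurable_boundary df.
by apply: filterS (ae_boundary_value hf) => t [].
Qed.

Lemma imag_L2_limit f : hardy f ->
  L2_limit (imag_trace f) (fun t => complex.Im (boundary_value f t)).
Proof.
move=> hf; have df := hardy_holomorphic hf; have [M HM] := hardy_imag_energy hf.
apply: (radial_limit_L2_limit (harmonic_imag_trace df) HM); last by have [] := measurable_boundary df.
by apply: filterS (ae_boundary_value hf) => t [].
Qed.

Lemma square_integrable_Re f : hardy f ->
  square_integrable T (fun t => complex.Re (boundary_value f t)).
Proof. by move=> /real_L2_limit[]. Qed.

Lemma square_integrable_Im f : hardy f ->
  square_integrable T (fun t => complex.Im (boundary_value f t)).
Proof. by move=> /imag_L2_limit[]. Qed.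

Lemma Re_innerE f g : hardy f -> hardy g -> complex.Re (inner f g) =
  \int[T]_t (complex.Re (boundary_value f t) * complex.Re (boundary_value g t)) +
  \int[T]_t (complex.Im (boundary_value f t) * complex.Im (boundary_value g t)).
Proof.
move=> hf hg.
have i1 := square_integrableM (square_integrable_Re hf) (square_integrable_Re hg).
have i2 := square_integrableM (square_integrable_Im hf) (square_integrable_Im hg).
rewrite -RintegralD // /inner /torus_cmean /=.
rewrite (_ : (fun t : X => _) = fun t => complex.Re (boundary_value f t) * complex.Re (boundary_value g t) +
   complex.Im (boundary_value f t) * complex.Im (boundary_value g t)); last first.
  by apply/funext => t; case: (boundary_value f t) => a b; case: (boundary_value g t) => a' b' /=; ring.
rewrite torus_meanE //; have := integrable_lin 1 1 i1 i2.
by apply: eq_integrable => // t _ /=; congr EFin; ring.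
Qed.

Lemma Im_innerE f g : hardy f -> hardy g -> complex.Im (inner f g) =
  \int[T]_t (complex.Im (boundary_value f t) * complex.Re (boundary_value g t)) -
  \int[T]_t (complex.Re (boundary_value f t) * complex.Im (boundary_value g t)).
Proof.
move=> hf hg.
have i1 := square_integrableM (square_integrable_Im hf) (square_integrable_Re hg).
have i2 := square_integrableM (square_integrable_Re hf) (square_integrable_Im hg).
rewrite -RintegralB // /inner /torus_cmean /=.
rewrite (_ : (fun t : X => _) = fun t => complex.Im (boundary_value f t) * complex.Re (boundary_value g t) -
   complex.Re (boundary_value f t) * complex.Im (boundary_value g t)); last first.
  by apply/funext => t; case: (boundary_value f t) => a b; case: (boundary_value g t) => a' b' /=; ring.
rewrite torus_meanE //; have := integrable_lin 1 (-1) i1 i2.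
by apply: eq_integrable => // t _ /=; congr EFin; ring.
Qed.

Lemma hardy_normsq f : hardy f -> hnorm f ^+ 2 =
  \int[T]_t (complex.Re (boundary_value f t) ^+ 2) +
  \int[T]_t (complex.Im (boundary_value f t) ^+ 2).
Proof.
move=> hf; rewrite /hnorm Re_innerE // sqr_sqrtr //.
by apply: addr_ge0; exact: Rintegral_sqr_ge0.
Qed.

End hardy_boundary.

(** * Multiplication by inner functions *)

Section inner_functions.
Context {R : realType} (d : nat).
Local Notation C := (R[i]^o).
Local Notation point := 'rV[R[i]^o]_d.
Local Notation X := (d.-tuple R).
Local Notation T := (@torus R d).
Implicit Types (f g b : point -> R[i]^o).

(** Inner functions with a unimodular radial limit at every point of the
    torus, as opposed to almost every one. This holds for P^*/P, whose
    denominator has no zero on the torus, and makes multiplication compatible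
    with boundary values everywhere (boundary_valueMl). *)
Definition inner_function b := [/\ holomorphic b,
  forall r (t : X), 0 < r < 1 -> cabs (b (radial_point r t)) <= 1 &
  forall t : X, exists2 beta : R[i], cabs beta = 1 &
    radial_climit (fun r => b (radial_point r t)) beta].

Lemma radial_climit_cst (c : R[i]) : radial_climit (fun=> c) c.
Proof. by split=> e e0; exists 1 => // r _; rewrite subrr normr0. Qed.

Lemma inner_function1 : inner_function (fun=> 1).
Proof.
split=> [z _|r t _|t]; first exact: differentiable_cst.
  by rewrite cabs1.
by exists 1; [exact: cabs1|exact: radial_climit_cst].
Qed.

Lemma inner_functionM b1 b2 : inner_function b1 -> inner_function b2 -> inner_function (b1 \* b2).
Proof.
move=> [h1 l1 r1] [h2 l2 r2]; split; first exact: holomorphicM.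
  move=> r t r01 /=; rewrite cabsM.
  by apply: mulr_ile1; rewrite ?cabs_ge0 ?l1 ?l2.
move=> t; have [x x1 Hx] := r1 t; have [y y1 Hy] := r2 t.
by exists (x * y); [rewrite cabsM x1 y1 mulr1|exact: radial_climitM].
Qed.

Lemma boundary_inner b t : inner_function b -> cabs (boundary_value b t) = 1 /\
  radial_climit (fun r => b (radial_point r t)) (boundary_value b t).
Proof. by move=> [_ _ /(_ t)[x x1 Hx]]; rewrite /boundary_value (lim_radialE Hx). Qed.

Lemma radial_climitV (F : R -> R[i]) (L : R[i]) : L != 0 -> radial_climit F L ->
  radial_climit (fun r => (F r)^-1) L^-1.
Proof.
move=> L0 /(radial_climitP (F : R -> C)) FL.
exact/(radial_climitP (fun r => (F r)^-1 : C))/(@cvgV _ _ _ _ (F : R -> C) _ L0 FL).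
Qed.

Lemma radial_climit_near (F G : R -> R[i]) (L : R[i]) h : 0 < h ->
  (forall r, 1 - h < r < 1 -> F r = G r) -> radial_climit F L -> radial_climit G L.
Proof.
move=> h0 FG; rewrite !radial_climit_cabs => H e e0; have [k k0 Hk] := H e e0.
exists (Num.min h k); first by rewrite lt_min h0.
have m1 : Num.min h k <= h by rewrite ge_min lexx.
have m2 : Num.min h k <= k by rewrite ge_min lexx orbT.
move=> r /andP[r0 r1]; rewrite -FG; last by apply/andP; lra.
by apply: Hk; apply/andP; lra.
Qed.

(** If f has no radial limit at a point, neither has b f, since b tends to a
    nonzero limit; then both sides are 0. *)
Lemma boundary_valueMl b f t : inner_function b ->
  boundary_value (b \* f) t = boundary_value b t * boundary_value f t.
Proof.
move=> ib; have [b1 Hb] := boundary_inner t ib.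
have b0 : boundary_value b t != 0 by rewrite -cabs_eq0 b1 oner_eq0.
have [Hf|Hf] := pselect (exists L, radial_climit (fun r => f (radial_point r t)) L).
  by apply: lim_radialE; apply: radial_climitM => //; exact: radial_climit_bv.
rewrite [boundary_value f t]lim_radial_dvg // mulr0.
apply: lim_radial_dvg => -[L HL]; apply: Hf.
exists ((boundary_value b t)^-1 * L).
have [|h h0 Hh] := (proj1 (radial_climit_cabs _ _) Hb) 1; first exact: ltr01.
apply: (radial_climit_near h0 _ (radial_climitM (radial_climitV b0 Hb) HL)) => r r1.
rewrite /= mulKf // -cabs_eq0; apply: contraTneq (Hh r r1) => br0.
move/eqP: br0; rewrite cabs_eq0 => /eqP ->.
by rewrite sub0r cabsN b1 ltxx.
Qed.

Lemma inner_mull b f g : inner_function b -> inner (b \* f) (b \* g) = inner f g.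
Proof.
move=> ib; rewrite /inner; congr torus_cmean; apply/funext => t.
rewrite !boundary_valueMl //; have [b1 _] := boundary_inner t ib.
rewrite rmorphM /= mulrACA; have -> : boundary_value b t * (boundary_value b t)^* = 1.
  by rewrite -normCK normC_cabs b1 expr1n.
by rewrite mul1r.
Qed.

Lemma hnorm_mull b f : inner_function b -> hnorm (b \* f) = hnorm f.
Proof. by move=> ib; rewrite /hnorm inner_mull. Qed.

Lemma le_Rintegral_torus (F G : X -> R) : torus_function F -> torus_function G ->
  (forall t, F t <= G t) -> \int[T]_t F t <= \int[T]_t G t.
Proof.
move=> tF tG FG; apply: (le_Rintegral measurableT) => //.
- exact: torus_function_integrable.
- exact: torus_function_integrable.
Qed.

Definition trace_sq f r (t : X) := real_trace f r t ^+ 2 + imag_trace f r t ^+ 2.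

Lemma trace_sqE f r t : trace_sq f r t = cabs (f (radial_point r t)) ^+ 2.
Proof. by rewrite cabs_sqr. Qed.

Lemma torus_function_trace_sq f r : holomorphic f -> 0 <= r < 1 -> torus_function (trace_sq f r).
Proof.
move=> df r01; have [t1 _ _] := harmonic_real_trace df; have [t2 _ _] := harmonic_imag_trace df.
exact: torus_functionD (torus_functionX (t1 _ r01)) (torus_functionX (t2 _ r01)).
Qed.

Lemma trace_energy f r : holomorphic f -> 0 <= r < 1 ->
  energy (real_trace f) r + energy (imag_trace f) r = \int[T]_t trace_sq f r t.
Proof.
move=> df r01; have [t1 _ _] := harmonic_real_trace df; have [t2 _ _] := harmonic_imag_trace df.
have i1 := torus_function_integrable (torus_functionX (t1 _ r01)).
have i2 := torus_function_integrable (torus_functionX (t2 _ r01)).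
by rewrite /energy -(RintegralD measurableT i1 i2).
Qed.

(** Energies increase with the radius, so the radius 0 is covered by the
    others. *)
Lemma hardy_intro_pos f M : (forall z, ~ polydisk z -> f z = 0) -> holomorphic f ->
  (forall r, 0 < r < 1 -> \int[T]_t trace_sq f r t <= M) -> hardy f.
Proof.
move=> f0 df HM; apply: (hardy_intro (M := M)) => // r /andP[r0 r1].
pose s := (r + 1) / 2; have s01 : 0 < s < 1 by apply/andP; rewrite /s; lra.
have /andP[s0 s1] := s01.
apply: le_trans (HM s s01); rewrite -trace_energy //; last by rewrite s1 ltW.
by apply: lerD; apply: energy_mono => //; [exact: harmonic_real_trace| |exact: harmonic_imag_trace|];
  rewrite /s; lra.
Qed.

Lemma hardy_mull b f : inner_function b -> hardy f -> hardy (b \* f).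
Proof.
move=> [db b1 _] hf; have df := hardy_holomorphic hf; have [f0 _ _] := hf.
have [M HM] := hardy_energy hf; have dbf := holomorphicM db df.
apply: (hardy_intro_pos (M := M)) => // [z /f0 /= ->|r r01]; first by rewrite mulr0.
have r01' : 0 <= r < 1 by have /andP[r0 ->] := r01; rewrite ltW.
apply: le_trans (HM r r01'); rewrite trace_energy //.
apply: le_Rintegral_torus => [||t]; try exact: torus_function_trace_sq.
rewrite !trace_sqE /= cabsM exprMn; apply: ler_piMl; first exact: sqr_ge0.
by apply: exprn_ile1; [exact: cabs_ge0|exact: b1].
Qed.

Lemma hardyB f g : hardy f -> hardy g -> hardy (f \- g).
Proof.
move=> hf hg; have [f0 df _] := hf; have [g0 dg _] := hg.
have [M HM] := hardy_energy hf; have [N HN] := hardy_energy hg.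
have hf' := hardy_holomorphic hf; have hg' := hardy_holomorphic hg.
have dfg := holomorphicB hf' hg'.
apply: (hardy_intro_pos (M := 2 * M + 2 * N)) => // [z pz /=|r r01].
  by rewrite f0 // g0 // subr0.
have r01' : 0 <= r < 1 by have /andP[r0 ->] := r01; rewrite ltW.
have tf := torus_function_trace_sq hf' r01'; have tg := torus_function_trace_sq hg' r01'.
have := Rintegral_le_lin (P := T) (k := 2) (l := 2)
  (torus_function_integrable (torus_function_trace_sq dfg r01'))
  (torus_function_integrable tf) (torus_function_integrable tg).
have := HM r r01'; have := HN r r01'; rewrite !trace_energy // => H1 H2 H3.
apply: le_trans (H3 _) _; last lra.
move=> t; rewrite /trace_sq /real_trace /imag_trace /= cReB cImB.
by have := sqr_ge0 (complex.Re (f (radial_point r t)) + complex.Re (g (radial_point r t)));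
  have := sqr_ge0 (complex.Im (f (radial_point r t)) + complex.Im (g (radial_point r t))); nra.
Qed.

Lemma hardy0 : hardy ((fun=> 0) : point -> R[i]^o).
Proof.
apply: (hardy_intro_pos (M := 0)) => // r r01.
rewrite (_ : trace_sq _ r = fun=> 0) ?Rintegral_cst ?mul0r //.
by apply/funext => t; rewrite /trace_sq /real_trace /imag_trace /= expr0n /= addr0.
Qed.

Lemma boundary_valueB f g : hardy f -> hardy g ->
  {ae T, forall t, boundary_value (f \- g) t = boundary_value f t - boundary_value g t}.
Proof.
move=> hf hg; apply: filterS2 (ae_boundary_value hf) (ae_boundary_value hg) => t Hf Hg.
rewrite -mulN1r; apply: lim_radialE.
have := radial_climitD Hf (radial_climitM (radial_climit_cst (-1)) Hg).
by congr radial_climit; apply/funext => r; rewrite /= mulN1r.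
Qed.

End inner_functions.

(** * Products with inner functions that tend to zero inside are weakly null *)

Section expansion.
Context {R : realType} (d : nat).
Local Notation C := (R[i]^o).
Local Notation point := 'rV[R[i]^o]_d.
Local Notation X := (d.-tuple R).
Local Notation T := (@torus R d).
Implicit Types (f g h : point -> R[i]^o) (b : nat -> point -> R[i]^o).

Lemma measurable_cabs_radial f r : holomorphic f -> 0 <= r < 1 ->
  measurable_fun setT (fun t : X => cabs (f (radial_point r t))).
Proof.
move=> df r01; apply: measurable_tuple_continuous; apply: tuple_continuous_radial => // z w.
exact: cabs_dist.
Qed.

(** Up to a small error, uniform in m, the limit g can be replaced by u s with
    s close to 1. By L2_limit_sym the pairing of u s and h m is that of g and
    v m s, and the factor b s m of v m s tends to 0 pointwise because s < 1.
    *)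
Lemma component_weak_null (u : R -> X -> R) (g : X -> R) (v : nat -> R -> X -> R)
    (h : nat -> X -> R) (b c : R -> nat -> X -> R) M e :
  harmonic_family u -> L2_limit u g ->
  (forall m, harmonic_family (v m)) -> (forall m, L2_limit (v m) (h m)) ->
  (forall m, \int[T]_t (h m t ^+ 2) <= M) ->
  (forall s m, 0 < s < 1 -> measurable_fun setT (b s m)) ->
  (forall s m t, 0 < s < 1 -> 0 <= b s m t <= 1) ->
  (forall s t, 0 < s < 1 -> b s ^~ t @ \oo --> (0 : R)) ->
  (forall s m, 0 < s < 1 -> T.-integrable setT (EFin \o c s m)) ->
  (forall s m, 0 < s < 1 -> \int[T]_t c s m t <= M) ->
  (forall s m t, 0 <= c s m t) ->
  (forall s m t, v m s t ^+ 2 <= b s m t ^+ 2 * c s m t) -> 0 < e ->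
  \forall m \near \oo, `|\int[T]_t (g t * h m t)| < e.
Proof.
move=> hu ug hv vh hM mb b01 b0 ic cM c0 vb e0.
have M0 : 0 <= M by apply: le_trans (hM 0%N); exact: Rintegral_sqr_ge0.
have k0 : 0 < e / (4 * (M + 1)) by rewrite divr_gt0 // mulr_gt0 // ltr_wpDl.
have e40 : 0 < e / 4 by lra.
have [a /andP[a0 a1] Ha] := L2_limit_young hu ug k0 e40.
pose s := Num.max a (1 / 2).
have s01 : 0 < s < 1 by rewrite lt_max gt_max a1 /=; apply/andP; split; [apply/orP; right|]; lra.
have /andP[s0 s1] := s01; have s01' : 0 <= s < 1 by rewrite (ltW s0).
have as1 : a <= s < 1 by rewrite s1 le_max lexx.
have e20 : 0 < e / 2 by lra.
have jv m : square_integrable T (v m s).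
  by apply: torus_function_square_integrable; have [tv _ _] := hv m; exact: tv.
have := weak_null (proj1 ug) jv (fun m => mb s m s01) (fun m t => b01 s m t s01)
  (fun t => b0 s t s01) (fun m => ic s m s01) (fun m => cM s m s01) (c0 s) (vb s) e20.
apply: filterS => m; rewrite -(L2_limit_sym hu (hv m) ug (vh m) s01') => H.
have := Ha s (h m) as1 (proj1 (vh m)).
have : e / (4 * (M + 1)) * \int[T]_t (h m t ^+ 2) <= e / 4.
  apply: le_trans (ler_wpM2l (ltW k0) (hM m)) _.
  by rewrite mulrAC ler_pdivrMr ?mulr_gt0 // ?ltr_wpDl //; nra.
move: H; rewrite ltr_norml => /andP[H1 H2] H3; rewrite ler_norml => /andP[H4 H5].
by rewrite ltr_norml; apply/andP; split; lra.
Qed.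

(** The real and imaginary parts of b m * k m at radius s are bounded by |b m|
    |k m|, and hnorm (b m * k m) = hnorm (k m), so component_weak_null applies
    to both. *)
Lemma inner_weak_null f b (k : nat -> point -> R[i]^o) M e : hardy f ->
  (forall m, inner_function (b m)) -> (forall m, hardy (k m)) ->
  (forall m, hnorm (k m) ^+ 2 <= M) ->
  (forall r (t : X), 0 < r < 1 -> (fun m => cabs (b m (radial_point r t))) @ \oo --> (0 : R)) ->
  0 < e -> \forall m \near \oo, `|complex.Re (inner f (b m \* k m))| < e.
Proof.
move=> hf ib hk kM b0 e0; have e20 : 0 < e / 2 by lra.
have hbk m : hardy (b m \* k m) by exact: hardy_mull.
have dbk m := hardy_holomorphic (hbk m); have dk m := hardy_holomorphic (hk m).
have bkM m : hnorm (b m \* k m) ^+ 2 <= M by rewrite hnorm_mull.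
have df := hardy_holomorphic hf.
pose bb s m (t : X) := cabs (b m (radial_point s t)).
pose cc s m := @trace_sq R d (k m) s.
have p01 s : 0 < s < 1 -> 0 <= s < 1 by move=> /andP[s0 ->]; rewrite ltW.
have mb s m : 0 < s < 1 -> measurable_fun setT (bb s m).
  by move=> /p01 s01; apply: measurable_cabs_radial => //; have [] := ib m.
have b01 s m t : 0 < s < 1 -> 0 <= bb s m t <= 1.
  by move=> s01; rewrite /bb cabs_ge0 /=; have [_ H _] := ib m; exact: H.
have bl s t : 0 < s < 1 -> bb s ^~ t @ \oo --> (0 : R) by move=> s01; exact: b0.
have ic s m : 0 < s < 1 -> T.-integrable setT (EFin \o cc s m).
  by move=> /p01 s01; apply: torus_function_integrable; exact: torus_function_trace_sq.
have c0 s m t : 0 <= cc s m t by rewrite /cc trace_sqE sqr_ge0.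
have cM s m : 0 < s < 1 -> \int[T]_t cc s m t <= M.
  move=> /p01 s01; rewrite /cc -trace_energy //; apply: le_trans (kM m).
  rewrite hardy_normsq //; apply: lerD; apply: L2_limit_energy s01.
  - exact: harmonic_real_trace.
  - exact: real_L2_limit.
  - exact: harmonic_imag_trace.
  - exact: imag_L2_limit.
have bc s m t : cabs ((b m \* k m) (radial_point s t)) ^+ 2 = bb s m t ^+ 2 * cc s m t.
  by rewrite /= cabsM exprMn /cc trace_sqE.
have vr s m t : real_trace (b m \* k m) s t ^+ 2 <= bb s m t ^+ 2 * cc s m t.
  by rewrite -bc cabs_sqr lerDl sqr_ge0.
have vi s m t : imag_trace (b m \* k m) s t ^+ 2 <= bb s m t ^+ 2 * cc s m t.
  by rewrite -bc cabs_sqr lerDr sqr_ge0.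
have hr m : \int[T]_t (complex.Re (boundary_value (b m \* k m) t) ^+ 2) <= M.
  by apply: le_trans (bkM m); rewrite hardy_normsq // lerDl Rintegral_sqr_ge0.
have hi m : \int[T]_t (complex.Im (boundary_value (b m \* k m) t) ^+ 2) <= M.
  by apply: le_trans (bkM m); rewrite hardy_normsq // lerDr Rintegral_sqr_ge0.
have H1 := component_weak_null (harmonic_real_trace df) (real_L2_limit hf)
  (fun m => harmonic_real_trace (dbk m)) (fun m => real_L2_limit (hbk m)) hr mb b01 bl ic cM c0 vr e20.
have H2 := component_weak_null (harmonic_imag_trace df) (imag_L2_limit hf)
  (fun m => harmonic_imag_trace (dbk m)) (fun m => imag_L2_limit (hbk m)) hi mb b01 bl ic cM c0 vi e20.
apply: filterS2 H1 H2 => m H1 H2; rewrite Re_innerE //.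
by apply: le_lt_trans (ler_normD _ _) _; lra.
Qed.

Lemma Re_innerBl f g k : hardy f -> hardy g -> hardy k ->
  complex.Re (inner (f \- g) k) = complex.Re (inner f k) - complex.Re (inner g k).
Proof.
move=> hf hg hk; have hfg := hardyB hf hg; rewrite !Re_innerE //.
have ae1 (L : R[i] -> R) (p : X -> R) : (forall x y, L (x - y) = L x - L y) ->
    (forall h, hardy h -> square_integrable T (fun t => L (boundary_value h t))) ->
    square_integrable T p ->
    \int[T]_t (L (boundary_value (f \- g) t) * p t) =
    \int[T]_t (L (boundary_value f t) * p t) - \int[T]_t (L (boundary_value g t) * p t).
  move=> LB jL jp.
  have i1 := square_integrableM (jL _ hf) jp; have i2 := square_integrableM (jL _ hg) jp.
  have [m3 _] := jL _ hfg; have [mp _] := jp.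
  rewrite -RintegralB // /Rintegral; congr fine; apply: ae_eq_integral => //.
  - by apply/measurable_EFinP; exact: measurable_funM.
  - apply/measurable_EFinP; apply: measurable_funB.
      by apply: measurable_funM => //; have [] := jL _ hf.
    by apply: measurable_funM => //; have [] := jL _ hg.
  by apply: filterS (boundary_valueB hf hg) => t -> _; rewrite LB mulrBl.
rewrite (ae1 (@complex.Re R)); first last.
- exact: square_integrable_Re.
- by move=> *; exact: square_integrable_Re.
- exact: cReB.
rewrite (ae1 (@complex.Im R)); first lra.
- exact: cImB.
- by move=> *; exact: square_integrable_Im.
- exact: square_integrable_Im.
Qed.

Lemma Re_innerC f g : hardy f -> hardy g -> complex.Re (inner g f) = complex.Re (inner f g).
Proof.
by move=> hf hg; rewrite !Re_innerE //; congr (_ + _); apply: eq_Rintegral => t _; rewrite mulrC.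
Qed.

Lemma Im_innerC f g : hardy f -> hardy g -> complex.Im (inner g f) = - complex.Im (inner f g).
Proof.
move=> hf hg; rewrite !Im_innerE // opprB; congr (_ - _); apply: eq_Rintegral => t _; rewrite mulrC //.
Qed.

Lemma inner_eq0C f g : hardy f -> hardy g -> inner f g = 0 -> inner g f = 0.
Proof.
by move=> hf hg H; apply/eqP; rewrite eq_complex Re_innerC // Im_innerC // H /= oppr0 !eqxx.
Qed.

Lemma Re_inner_self f : hardy f -> complex.Re (inner f f) = hnorm f ^+ 2.
Proof. by move=> hf; rewrite hardy_normsq // Re_innerE. Qed.

Lemma inner_bound f g : hardy f -> hardy g ->
  `|complex.Re (inner f g)| <= 2 * hnorm f ^+ 2 + 2^-1 * hnorm g ^+ 2.
Proof.
move=> hf hg; rewrite Re_innerE // !hardy_normsq //.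
have Y1 := young (ltr0n R 2) (square_integrable_Re hf) (square_integrable_Re hg).
have Y2 := young (ltr0n R 2) (square_integrable_Im hf) (square_integrable_Im hg).
by apply: le_trans (ler_normD _ _) _; apply: le_trans (lerD Y1 Y2) _; lra.
Qed.

End expansion.

(** * A function of norm zero vanishes *)

Section positivity.
Context {R : realType}.

(** After a rotation x0 becomes pi, and the interval of radius h around it is
    contained in [0, 2 pi]. *)
Lemma circle_integral_lower (G : R -> \bar R) x0 (e h : R) : measurable_fun setT G ->
  (forall x, 0 <= G x)%E -> circular G -> 0 <= e -> 0 < h < pi ->
  (forall x, `|x - x0| < h -> (e%:E <= G x)%E) ->
  ((e * (h / pi))%:E <= \int[circle_mean]_x G x)%E.
Proof.
move=> mG G0 cG e0 /andP[h0 hpi] HG.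
rewrite -(ge0_circle_mean_shift (x0 - pi) mG G0 cG).
have mA : measurable (`]pi - h, pi + h[%classic : set R) by exact: measurable_itv.
apply: (@le_trans _ _ (\int[circle_mean]_x (e * \1_(`]pi - h, pi + h[%classic : set R) x)%:E)%E); last first.
  apply: ge0_le_integral => //.
  - by move=> x _; rewrite lee_fin mulr_ge0 // indicE.
  - by apply/measurable_EFinP; apply: measurable_funM => //; exact: measurable_indic.
  - by apply: measurableT_comp => //; exact: measurable_funD.
  move=> x _; rewrite indicE; case: (boolP (x \in _)) => [|_] /=; last by rewrite mulr0.
  rewrite inE /= in_itv /= => /andP[x1 x2]; rewrite mulr1; apply: HG.
  by rewrite ltr_norml; apply/andP; split; lra.
rewrite ge0_circle_meanE; first last.
- by move=> x; rewrite lee_fin mulr_ge0 // indicE.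
- by apply/measurable_EFinP; apply: measurable_funM => //; exact: measurable_indic.
under eq_integral do rewrite EFinM.
rewrite ge0_integralZl_EFin //; last by apply/measurable_EFinP; exact: measurable_indic.
rewrite integral_indic // setIidl; last first.
  move=> x /=; rewrite !in_itv /= => /andP[x1 x2].
  by have p0 := pi_gt0 R; apply/andP; split; lra.
have L : lebesgue_measure (`]pi - h, pi + h[%classic : set R) = (2 * h)%:E.
  by rewrite lebesgue_measure_itv /= lte_fin ifT; [congr EFin|]; lra.
rewrite [X in (_ * (_ * X))%E](_ : _ = (2 * h)%:E); last exact: L.
rewrite -!EFinM lee_fin.
have p0 := pi_gt0 R; rewrite le_eqVlt; apply/orP; left; apply/eqP.
move: (lt0r_neq0 p0); move: (pi : R) => p pn; by field.
Qed.

Lemma torus_integral_lower n (F : n.-tuple R -> R) t0 (e h : R) : measurable_fun setT F ->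
  (forall t, 0 <= F t) -> periodic F -> 0 <= e -> 0 < h < pi ->
  (forall t, (forall j, `|tnth t j - tnth t0 j| < h) -> e <= F t) ->
  ((e * (h / pi) ^+ n)%:E <= \int[torus n]_t (F t)%:E)%E.
Proof.
elim: n F t0 => [|n IH] F t0 mF F0 pF e0 hpi HF.
  rewrite expr0 mulr1 (eq_integral (fun=> e%:E + (F t0 - e)%:E)%E); last first.
    move=> t _; rewrite -EFinD; congr EFin; have -> : t = t0 by apply: eq_from_tnth => -[].
    by lra.
  rewrite -EFinD integral_prob_cst lee_fin.
  have e1 : e <= F t0 by apply: HF => -[].
  by lra.
have [h0 _] := andP hpi; have hp : 0 <= h / pi by rewrite divr_ge0 ?(ltW h0) ?pi_ge0.
rewrite ge0_torus_cons; [|exact/measurable_EFinP|by move=> t; rewrite lee_fin].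
rewrite exprSr mulrA; apply: (@circle_integral_lower _ (tnth t0 ord0)) => //.
- apply: (measurable_fun_fubini_tonelli_F (fun p => (F (tuple_cons p))%:E)).
    by apply/measurable_EFinP; apply: measurableT_comp => //; exact: measurable_tuple_cons.
  by move=> x; rewrite lee_fin.
- by move=> x; apply: integral_ge0 => s _; rewrite lee_fin.
- move=> x y xy; apply: eq_integral => s _; congr EFin.
  exact: (periodic_consl s pF xy).
- by rewrite mulr_ge0 // exprn_ge0.
move=> x xh; apply: (IH _ [tuple of behead t0]) => //.
- by apply: measurableT_comp => //; apply: measurableT_comp; [exact: measurable_tuple_cons|exact: measurable_pair1].
- exact: periodic_cons.
move=> s Hs; apply: HF => j; case: (unliftP ord0 j) => [i ->|->]; last by rewrite tnth0.
have := Hs i; rewrite tnthS tnth_behead.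
by congr (`|_ - tnth _ _| < _); apply/val_inj; rewrite /= /bump /= inordK //= ltnS ltn_ord.
Qed.

End positivity.

Section uniqueness.
Context {R : realType} (d : nat).
Local Notation C := (R[i]^o).
Local Notation point := 'rV[R[i]^o]_d.
Local Notation X := (d.-tuple R).
Local Notation T := (@torus R d).
Implicit Types (f : point -> R[i]^o).

Lemma polar (z : R[i]) : exists a, z = (cabs z)%:C%C * expi a.
Proof.
have [->|z0] := eqVneq z 0; first by exists 0; rewrite cabs0 mul0r.
have c0 : cabs z != 0 by rewrite cabs_eq0.
suff [a Ha] : exists a, expi a = z / (cabs z)%:C%C.
  by exists a; rewrite Ha mulrC divfK // eq_complex /= eqxx andbT.
have : cabs (z / (cabs z)%:C%C) ^+ 2 = 1.
  by rewrite cabsM cabsV cabs_real ger0_norm ?cabs_ge0 // mulfV // expr1n.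
case: (z / _) => x y; rewrite cabs_sqr /= => xy.
have x1 : -1 <= x <= 1 by apply/andP; split; nra.
have sE : sin (acos x) = `|y|.
  by rewrite sin_acos // -sqrtr_sqr; congr Num.sqrt; lra.
have [y0|y0] := leP 0 y.
  by exists (acos x); rewrite /expi acosK // sE ger0_norm.
by exists (- acos x); rewrite /expi cosN sinN acosK // sE ltr0_norm // opprK.
Qed.

(** The mean of the continuous function |f|^2 over the torus of radius r is at
    most the squared norm of f. *)
Lemma radial_zero f : hardy f -> hnorm f = 0 -> forall r t, 0 < r < 1 -> f (radial_point r t) = 0.
Proof.
move=> hf f0 r t r01; have df := hardy_holomorphic hf.
have r01' : 0 <= r < 1 by have /andP[r0 ->] := r01; rewrite ltW.
apply/eqP; rewrite -cabs_eq0; apply/negP => /negP c0.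
have {}c0 : 0 < cabs (f (radial_point r t)) by rewrite lt_neqAle eq_sym c0 cabs_ge0.
have E : \int[T]_t trace_sq f r t <= 0.
  rewrite -trace_energy // -[leRHS](expr0n R 2) -f0 hardy_normsq //.
  apply: lerD; apply: L2_limit_energy r01'.
  - exact: harmonic_real_trace.
  - exact: real_L2_limit.
  - exact: harmonic_imag_trace.
  - exact: imag_L2_limit.
set c := cabs (f (radial_point r t)) in c0.
have tc : tuple_continuous (fun t : X => cabs (f (radial_point r t))).
  by apply: tuple_continuous_radial => // z w; exact: cabs_dist.
have [h h0 Hh] := tc t (c / 2) ltac:(lra).
have [tm tp _] := torus_function_trace_sq df r01'.
have p0 := pi_gt0 R.
have hp : 0 < Num.min h (pi / 2) < pi.
  by rewrite lt_min gt_min h0 /=; apply/andP; split; [|apply/orP; right]; lra.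
have L := @torus_integral_lower R d (trace_sq f r) t ((c / 2) ^+ 2) (Num.min h (pi / 2)) tm
  _ tp (sqr_ge0 _) hp.
have : (((c / 2) ^+ 2 * (Num.min h (pi / 2) / pi) ^+ d)%:E <= (\int[T]_t trace_sq f r t)%:E)%E.
  rewrite -ge0_RintegralE; last by apply: torus_function_integrable; exact: torus_function_trace_sq.
  apply: L => [s|s Hs]; first by rewrite trace_sqE sqr_ge0.
  have mh : Num.min h (pi / 2) <= h by rewrite ge_min lexx.
  have := Hh s (fun j => lt_le_trans (Hs j) mh).
  rewrite trace_sqE ltr_norml => /andP[H1 H2].
  by rewrite ler_sqr ?nnegrE ?cabs_ge0 //; rewrite -/c in H1 H2; lra.
rewrite lee_fin => H; have := le_trans H E; apply/negP; rewrite -ltNge.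
have /andP[hp0 _] := hp.
by rewrite mulr_gt0 // exprn_gt0 // divr_gt0.
Qed.

Definition set_coord (q : point) (k : 'I_d) (z : R[i]) : point :=
  \row_j (if j == k then z else q ord0 j).

Lemma cderivable_coord f q k z : holomorphic f -> polydisk (set_coord q k z) ->
  cderivable (fun w => f (set_coord q k w)) z.
Proof.
move=> df pz; apply/cderivableP.
pose e : point := \row_j (j == k)%:R.
have := @diff_derivable _ _ _ f _ e (df _ pz).
rewrite /derivable.
have -> // : (fun h : C => h^-1 *: (((fun w => f (set_coord q k w)) \o shift (z : C)) (h *: (1 : C)) - f (set_coord q k z) : C)) =
   (fun h : C => h^-1 *: ((f \o shift (set_coord q k z)) (h *: e) - f (set_coord q k z))).
apply/funext => h; congr (_ *: (_ - _)).
rewrite /=; congr f; apply/rowP => j; rewrite !mxE /GRing.scale /=.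
by case: ifP => _; rewrite ?mulr1 // mulr0 add0r.
Qed.

(** The Poisson formula on the disc of radius s, for g and -ig. *)
Lemma disc_zero (g : R[i] -> R[i]) s z : 0 < s < 1 ->
  (forall w, cabs w < 1 -> cderivable g w) -> (forall w, cabs w = s -> g w = 0) ->
  cabs z < s -> g z = 0.
Proof.
move=> /andP[s0 s1] dg g0 zs; have [a za] := polar z.
have s01 : 0 <= s < 1 by rewrite (ltW s0).
pose r := cabs z / s; have r01 : 0 <= r < 1.
  by rewrite divr_ge0 ?cabs_ge0 ?(ltW s0) //= ltr_pdivrMr // mul1r.
have rs : cabs z = r * s by rewrite /r divfK // gt_eqF.
have key (F : R[i] -> R[i]) : (forall w, cabs w < 1 -> cderivable F w) ->
    (forall w, cabs w = s -> F w = 0) -> complex.Re (F z) = 0.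
  move=> dF F0; rewrite za rs (poisson_formula_disc a r01 s01 dF).
  rewrite (_ : (fun t : R => _) = fun=> 0) ?Rintegral_cst ?mul0r //.
  apply/funext => t; rewrite F0 /= ?mul0r //.
  by rewrite cabsM cabs_expi mulr1 cabs_real ger0_norm // ltW.
have H1 := key g dg g0.
have g0' w : cabs w = s -> - 'i%C * g w = 0 by move=> /g0 ->; rewrite mulr0.
have H2 := key (fun w => - 'i%C * g w) (fun w w1 => cderivableMl _ (dg w w1)) g0'.
apply/eqP; rewrite eq_complex /= H1 eqxx /=; move: H2; case: (g z) => x y /= H; apply/eqP; lra.
Qed.

(** Starting from the torus of radius s, the coordinates are moved one after
    the other into the disc of radius s; f vanishes on the circle of the
    moving coordinate, hence on its disc. *)
Lemma radial_zero_polydisk f : holomorphic f ->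
  (forall r t, 0 < r < 1 -> f (radial_point r t) = 0) -> forall z, polydisk z -> f z = 0.
Proof.
move=> df f0 z /polydiskP pz.
have [s s01 zs] : exists2 s : R, 0 < s < 1 & forall j, cabs (z ord0 j) < s.
  pose m := \big[Num.max/0]_j cabs (z ord0 j).
  have m1 : m < 1 by apply: bigmax_lt => // j _; exact: pz.
  have m0 : 0 <= m by exact: bigmax_ge_id.
  exists ((m + 1) / 2); first by apply/andP; split; lra.
  by move=> j; have := le_bigmax 0 (fun j => cabs (z ord0 j)) j; rewrite -/m; lra.
have /andP[s0 s1] := s01.
suff H k (q : point) : (forall j, cabs (q ord0 j) <= s) ->
    (forall j : 'I_d, (k <= j)%N -> cabs (q ord0 j) = s) -> f q = 0.
  by apply: (H d) => [j|j]; [exact: ltW|rewrite leqNgt ltn_ord].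
elim: k q => [|k IH] q q1 q2.
  have /choice[a Ha] : forall j, exists a, q ord0 j = s%:C%C * expi a.
    by move=> j; have [a ->] := polar (q ord0 j); exists a; rewrite q2 // cabsM cabs_expi cabs_real ger0_norm ?mulr1 // ltW.
  rewrite -(f0 s [tuple a j | j < d] s01); congr f; apply/rowP => j.
  by rewrite mxE tnth_mktuple Ha.
have [kd|dk] := ltnP k d; last first.
  by apply: IH => // j jk; have := ltn_ord j; rewrite ltnNge (leq_trans dk jk).
pose k' := Ordinal kd.
have qE : set_coord q k' (q ord0 k') = q.
  by apply/rowP => j; rewrite mxE; case: eqP => [->|].
have g0 w : cabs w = s -> f (set_coord q k' w) = 0.
  move=> ws; apply: IH => j; rewrite mxE; first by case: ifP => // _; rewrite ws.
  case: eqP => // jk kj; apply: q2; rewrite ltn_neqAle kj andbT.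
  by apply/eqP => kj'; apply: jk; apply/val_inj.
have := q1 k'; rewrite le_eqVlt => /orP[/eqP H|H]; first by rewrite -qE g0.
rewrite -qE; apply: (disc_zero (g := fun w => f (set_coord q k' w)) s01 _ g0 H) => w w1.
apply: cderivable_coord => //; apply/polydiskP => j; rewrite mxE; case: ifP => // _.
exact: le_lt_trans s1.
Qed.

Lemma hnorm_eq0 f : hardy f -> hnorm f = 0 -> f = (fun=> 0).
Proof.
move=> hf f0; apply/funext => z; have [pz|pz] := pselect (polydisk z).
  exact: (radial_zero_polydisk (hardy_holomorphic hf) (radial_zero hf f0)).
by have [H _ _] := hf; exact: H.
Qed.

End uniqueness.

(** * Expansion along a sequence of inner functions *)

Section inner_expansion.
Context {R : realType} (d : nat).
Local Notation C := (R[i]^o).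
Local Notation point := 'rV[R[i]^o]_d.
Local Notation X := (d.-tuple R).
Local Notation T := (@torus R d).
Variables (f : point -> C) (fs U B phi : nat -> point -> C).
Hypotheses (hf : hardy f) (fs0 : fs 0%N = f) (B0 : B 0%N = (fun=> 1)).
Hypothesis iphi : forall n, inner_function (phi n).
Hypothesis hU : forall n, hardy (U n).
Hypothesis U_orth : forall n h, hardy h -> inner (U n) (phi n \* h) = 0.
Hypothesis hfS : forall n, hardy (fs n.+1).
Hypothesis fsS : forall n, fs n \- U n = phi n \* fs n.+1.
Hypothesis BS : forall n, B n.+1 = B n \* phi n.
Hypothesis B_null : forall r (t : X), 0 < r < 1 ->
  (fun n => cabs (B n (radial_point r t))) @ \oo --> (0 : R).

Let hfs n : hardy (fs n).
Proof. by case: n => [|n]; [rewrite fs0|exact: hfS]. Qed.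

Let iB n : inner_function (B n).
Proof.
elim: n => [|n IH]; first by rewrite B0; exact: inner_function1.
by rewrite BS; exact: inner_functionM.
Qed.

Let B_factor m n : (m < n)%N -> exists2 b, inner_function b & B n = B m \* (phi m \* b).
Proof.
elim: n => // n IH; rewrite ltnS leq_eqVlt => /orP[/eqP ->|/IH[b ib E]].
  exists (fun=> 1); first exact: inner_function1.
  by rewrite BS; apply/funext => z /=; rewrite mulr1.
exists (b \* phi n); first exact: inner_functionM.
by rewrite BS E; apply/funext => z /=; rewrite !mulrA.
Qed.

(** The difference of f and the n-th partial sum (partial_sumE). *)
Let remainder n : point -> C := B n \* fs n.

Let h_rem n : hardy (remainder n).
Proof. exact: hardy_mull. Qed.

Let hUB n : hardy (B n \* U n).
Proof. exact: hardy_mull. Qed.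

Let UBE n : U n \* B n = B n \* U n.
Proof. by apply/funext => z /=; rewrite mulrC. Qed.

Let remainderS n : remainder n.+1 = remainder n \- (B n \* U n).
Proof.
rewrite /remainder BS; apply/funext => z /=.
by rewrite -mulrA -[phi n z * _]/((phi n \* fs n.+1) z) -fsS /= mulrBr.
Qed.

(** B n is a multiple of B m * phi m, multiplication by B m is isometric, and
    U m is orthogonal to the multiples of phi m. *)
Let term_orth m n h : (m < n)%N -> hardy h -> inner (B m \* U m) (B n \* h) = 0.
Proof.
move=> /B_factor[b ib ->] hh.
have -> : (B m \* (phi m \* b)) \* h = B m \* (phi m \* (b \* h)).
  by apply/funext => z /=; rewrite !mulrA.
by rewrite inner_mull //; apply: U_orth; exact: hardy_mull.
Qed.

Lemma terms_hardy n : hardy (U n \* B n).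
Proof. by rewrite UBE. Qed.

Lemma terms_orthogonal m n : m != n -> inner (U m \* B m) (U n \* B n) = 0.
Proof.
rewrite !UBE neq_ltn => /orP[mn|nm]; first exact: term_orth.
by apply: inner_eq0C => //; exact: term_orth.
Qed.

Lemma partial_sumE n : (fun z => f z - \sum_(0 <= k < n) U k z * B k z) = remainder n.
Proof.
elim: n => [|n IH].
  by apply/funext => z; rewrite big_geq // subr0 /remainder B0 /= mul1r fs0.
rewrite remainderS -IH; apply/funext => z /=.
by rewrite big_nat_recr //= opprD addrA [U n z * _]mulrC.
Qed.

Let remainder0 : remainder 0 = f.
Proof. by rewrite /remainder B0 fs0; apply/funext => z /=; rewrite mul1r. Qed.

(** Two consecutive remainders differ by a term B j * U j, which is orthogonal
    to remainder m for j < m. *)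
Let inner_remainder j m : (j <= m)%N ->
  complex.Re (inner (remainder j) (remainder m)) = complex.Re (inner f (remainder m)).
Proof.
elim: j => [|j IH] jm; first by rewrite remainder0.
rewrite remainderS Re_innerBl // -IH ?(ltnW jm) //.
by rewrite (term_orth jm (hfs m)) subr0.
Qed.

Let remainder_normsq m : hnorm (remainder m) ^+ 2 = complex.Re (inner f (remainder m)).
Proof. by rewrite -Re_inner_self // inner_remainder. Qed.

Let remainder_bounded m : hnorm (remainder m) ^+ 2 <= 4 * hnorm f ^+ 2.
Proof.
have := inner_bound hf (h_rem m); rewrite -remainder_normsq.
by rewrite ger0_norm ?sqr_ge0 //; lra.
Qed.

(** The squared norm of the remainder is its pairing with f, which tends to 0
    by inner_weak_null because the remainder is B n * fs n with fs n bounded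
    in norm. *)
Lemma remainder_cvg0 :
  hnorm (fun z => f z - \sum_(0 <= k < n) U k z * B k z) @[n --> \oo] --> (0 : R).
Proof.
under eq_fun do rewrite partial_sumE.
apply/cvgrPdist_lt => e e0; have e20 : 0 < e ^+ 2 by rewrite exprn_gt0.
have kM m : hnorm (fs m) ^+ 2 <= 4 * hnorm f ^+ 2.
  by rewrite -(hnorm_mull (fs m) (iB m)); exact: remainder_bounded.
apply: filterS (inner_weak_null hf iB hfs kM B_null e20) => m.
rewrite -[B m \* fs m]/(remainder m) -remainder_normsq ger0_norm ?sqr_ge0 //.
by rewrite sub0r normrN ltr_sqr ?nnegrE ?sqrtr_ge0 ?(ltW e0) // ger0_norm ?sqrtr_ge0.
Qed.

(** If h = B n * k n for all n, then the norms of the k n are all equal to the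
    norm of h, and inner_weak_null shows that the pairing of h with itself is
    0. *)
Lemma multiples_intersection : \bigcap_n hardy_multiples (B n) = [set (fun=> 0)].
Proof.
apply/seteqP; split => [h hh|_ -> n _]; last first.
  by exists (fun=> 0); [exact: hardy0|apply/funext => z /=; rewrite mulr0].
have /choice[k Hk] : forall n, exists k, hardy k /\ B n \* k = h.
  by move=> n; have [k hk E] := hh n I; exists k.
have h_h : hardy h by have [hk <-] := Hk 0%N; exact: hardy_mull.
have kM m : hnorm (k m) ^+ 2 <= hnorm h ^+ 2.
  by have [_ <-] := Hk m; rewrite hnorm_mull.
apply: (hnorm_eq0 h_h); apply/eqP; rewrite -sqrf_eq0 eq_le sqr_ge0 andbT.
apply/ler_addgt0Pr => e e0; rewrite add0r.
have [m _ Hm] := inner_weak_null h_h iB (fun m => proj1 (Hk m)) kM B_null e0.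
have : `|complex.Re (inner h (B m \* k m))| < e := Hm m (leqnn m).
rewrite (proj2 (Hk m)) Re_inner_self //.
by move=> /ltW; apply: le_trans; exact: ler_norm.
Qed.

End inner_expansion.

(** * The inner functions P^*/P *)
Import ReversedPolynomial.

Section rational_inner.
Context {R : realType} (d : nat).
Local Notation C := (R[i]^o).
Local Notation point := 'rV[R[i]^o]_d.
Local Notation X := (d.-tuple R).
Implicit Types P Q : mpoly.mpoly d R[i].

Lemma differentiable_meval_row Q (z : point) :
  differentiable (meval_row Q : point -> C) z.
Proof.
have D0 i n : differentiable ((fun v : point => v ord0 i ^+ n) : point -> C) z.
  elim: n => [|n IH].
    rewrite (_ : (fun v : point => _) = cst 1); first exact: differentiable_cst.
    by apply/funext => v; rewrite expr0.
  rewrite (_ : (fun v : point => _) = (fun v : point => v ord0 i : C) \* (fun v => v ord0 i ^+ n)).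
    exact: differentiableM (differentiable_coord _ _ _) IH.
  by apply/funext => v; rewrite exprS.
have D1 m (s : seq 'I_d) : differentiable ((fun v : point =>
    \prod_(i <- s) v ord0 i ^+ (@mpoly.fun_of_multinom d m i)) : point -> C) z.
  elim: s => [|i s IH].
    rewrite (_ : (fun v : point => _) = cst 1); first exact: differentiable_cst.
    by apply/funext => v; rewrite big_nil.
  rewrite (_ : (fun v : point => _) = (fun v : point => v ord0 i ^+ (@mpoly.fun_of_multinom d m i) : C) \*
     (fun v => \prod_(i <- s) v ord0 i ^+ (@mpoly.fun_of_multinom d m i))).
    exact: differentiableM (D0 _ _) IH.
  by apply/funext => v; rewrite big_cons.
have D2 s : differentiable ((fun v : point => \sum_(m <- s) mpoly.mcoeff m Q *
    \prod_i v ord0 i ^+ (@mpoly.fun_of_multinom d m i)) : point -> C) z.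
  elim: s => [|m s IH].
    rewrite (_ : (fun v : point => _) = cst 0); first exact: differentiable_cst.
    by apply/funext => v; rewrite big_nil.
  rewrite (_ : (fun v : point => _) = (fun v : point => mpoly.mcoeff m Q * \prod_i v ord0 i ^+ (@mpoly.fun_of_multinom d m i) : C) \+
     (fun v => \sum_(m <- s) mpoly.mcoeff m Q * \prod_i v ord0 i ^+ (@mpoly.fun_of_multinom d m i))).
    apply: differentiableD => //; exact: (differentiableZ _ (D1 _ _)).
  by apply/funext => v; rewrite big_cons.
rewrite (_ : meval_row Q = (fun v : point => \sum_(m <- mpoly.msupp Q) mpoly.mcoeff m Q *
    \prod_i v ord0 i ^+ (@mpoly.fun_of_multinom d m i))); first exact: D2.
by apply/funext => v; rewrite /meval_row mpoly.mevalE.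
Qed.

Lemma meval_radial Q r (t : X) : meval_row Q (radial_point r t) =
  mpoly.meval (fun i => r%:C%C * expi (tnth t i)) Q.
Proof. by apply: mpoly.meval_eq => i; rewrite mxE. Qed.

Lemma norm_expi (x : R) : `|expi x| = 1.
Proof. by rewrite normC_cabs cabs_expi. Qed.

Lemma radial_climit_meval Q (t : X) :
  radial_climit (fun r => meval_row Q (radial_point r t))
    (mpoly.meval (fun i => expi (tnth t i)) Q).
Proof.
have -> : mpoly.meval (fun i => expi (tnth t i)) Q = meval_row Q (radial_point 1 t).
  by rewrite meval_radial; apply: mpoly.meval_eq => i; rewrite mul1r.
apply/radial_climit_cabs => e e0.
have [h h0 H] := differentiable_cabs_continuous (differentiable_meval_row Q (radial_point 1 t)) e0.
exists h => // r r1; apply: H => j; rewrite !mxE -mulrBl -rmorphB /= cabsM cabs_expi mulr1.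
by rewrite cabs_real ltr_norml; apply/andP; lra.
Qed.

Lemma admissible_nz P : @admissible R d P -> forall z : 'I_d -> R[i],
  (forall i, `|z i| < 1) \/ (forall i, `|z i| = 1) -> mpoly.meval z P != 0.
Proof.
move=> [_ Pnz _] z zz.
have -> : mpoly.meval z P = meval_row P (\row_i z i).
  by apply: mpoly.meval_eq => i; rewrite mxE.
by apply: Pnz; case: zz => H; [left|right] => i; rewrite mxE.
Qed.

Lemma reversed_radial_lt P r (t : X) : @admissible R d P -> 0 < r < 1 ->
  cabs (meval_row (reversed_mpoly P) (radial_point r t)) < cabs (meval_row P (radial_point r t)).
Proof.
move=> aP /andP[r0 r1]; have [nP _ _] := aP.
rewrite !meval_radial -ltcR -!normC_cabs.
apply: normC_reversed_lt => //; [|exact: admissible_nz| |].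
- by move=> i; exact: norm_expi.
- by rewrite -cabs_eq0 cabs_real normr_eq0 gt_eqF.
- by rewrite normC_cabs -[1]/((1 : R)%:C%C) ltcR cabs_real gtr0_norm.
Qed.

Lemma rational_inner_inner P : @admissible R d P -> inner_function (rational_inner P).
Proof.
move=> aP; have [nP Pnz _] := aP; split.
- move=> z pz; have nz : meval_row P z != 0 by apply: Pnz; left.
  exact: differentiableM (differentiable_meval_row _ z) (differentiableV (differentiable_meval_row _ z) nz).
- move=> r t r01; have lt := reversed_radial_lt t aP r01.
  rewrite /rational_inner cabsM cabsV ler_pdivrMr ?mul1r; first exact: ltW.
  by apply: le_lt_trans lt; exact: cabs_ge0.
move=> t; pose w i := expi (tnth t i) : R[i].
have w1 i : `|w i| = 1 by exact: norm_expi.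
have nz : mpoly.meval w P != 0 by apply: (admissible_nz aP); right.
exists (mpoly.meval w (reversed_mpoly P) / mpoly.meval w P).
  rewrite cabsM cabsV; have := normC_reversed_torus P w1.
  rewrite !normC_cabs => -[->].
  by rewrite mulfV // cabs_eq0.
exact: radial_climitM (radial_climit_meval _ t) (radial_climitV nz (radial_climit_meval _ t)).
Qed.

End rational_inner.

(** * Uniform bounds on compact families *)

Section compact_families.
Context {R : realType} (d : nat).
Local Notation C := (R[i]^o).
Local Notation point := 'rV[R[i]^o]_d.
Local Notation X := (d.-tuple R).
Implicit Types P Q : mpoly.mpoly d R[i].
Local Notation index N := (bounded_index d N).

Lemma cabs_sum (I : finType) (F : I -> R[i]) : cabs (\sum_i F i) <= \sum_i cabs (F i).
Proof.
elim/big_rec2: _ => [|i x y _ xy]; first by rewrite cabs0.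
by apply: le_trans (cabsD _ _) _; rewrite lerD2l.
Qed.

Lemma eval_coef_lipschitz N (z : 'I_d -> R[i]) : exists2 S : R, 0 < S &
  forall (x y : index N -> R[i]) h, 0 <= h -> (forall m, cabs (x m - y m) < h) ->
    cabs (eval_coef x z - eval_coef y z) <= S * h.
Proof.
pose M (m : index N) := cabs (\prod_i z i ^+ mpoly.fun_of_multinom (mpoly.bmnm (m : mpoly.bmultinom d N)) i).
have M0 : 0 <= \sum_m M m by apply: sumr_ge0 => m _; exact: cabs_ge0.
exists (1 + \sum_m M m); first by lra.
move=> x y h h0 xy; rewrite /eval_coef -sumrB; apply: le_trans (cabs_sum _) _.
apply: (@le_trans _ _ (\sum_m h * M m)).
  apply: ler_sum => m _; rewrite -mulrBl cabsM; apply: ler_wpM2r; first exact: cabs_ge0.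
  exact: ltW.
by rewrite -mulr_sumr mulrC mulrDl mul1r lerDr.
Qed.

Lemma realCM (a b : R) : (a * b)%:C%C = a%:C%C * b%:C%C :> R[i].
Proof. exact: rmorphM. Qed.

Lemma cabs_normC (a b : R[i]) (m : R) : `|a| = m%:C%C * `|b| -> cabs a = m * cabs b.
Proof. by rewrite !normC_cabs -realCM => -[]. Qed.

Lemma cabs_le_normC (a b : R[i]) (m : R) : `|a| <= m%:C%C * `|b| -> cabs a <= m * cabs b.
Proof. by rewrite !normC_cabs -realCM lecR. Qed.

(** The estimate behind reversed_local_bound: A0 < B0 are the values of the
    bound of normC_reversed_le and of |P| at the centre, dy and dz the
    variations of the evaluations, which are Lipschitz with constants Sy and
    Sz. *)
Lemma gap_stability (A0 B0 mu Sy Sz k : R) : 0 <= A0 -> A0 < B0 -> 0 <= mu ->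
  0 < Sy -> 0 < Sz -> 0 < k ->
  exists2 c, 0 < c < 1 & exists2 h, 0 < h & h <= k /\ forall dy dz y1 y0 z1,
    dy <= Sy * h -> dz <= Sz * h -> A0 = mu * y0 -> y1 <= dy + y0 -> B0 <= dz + z1 ->
    mu * y1 <= c * z1.
Proof.
move=> A00 AB mu0 Sy0 Sz0 k0.
have [eta E3 eta0] : exists2 eta : R, B0 = A0 + 3 * eta & 0 < eta.
  by exists ((B0 - A0) / 3); [|rewrite divr_gt0 // subr_gt0]; lra.
have mu1 : 0 < mu + 1 by lra.
have [h h0 [hk hy hz]] : exists2 h : R, 0 < h &
    [/\ h <= k, (mu + 1) * Sy * h <= eta & Sz * h <= eta].
  exists (Num.min k (Num.min (eta / ((mu + 1) * Sy)) (eta / Sz))).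
    by rewrite !lt_min k0 !divr_gt0 // mulr_gt0.
  split; first by rewrite ge_min lexx.
    by rewrite mulrC -ler_pdivlMr ?mulr_gt0 // !ge_min lexx orbT.
  by rewrite mulrC -ler_pdivlMr // !ge_min lexx !orbT.
have p0 : 0 < A0 + 2 * eta by lra.
exists ((A0 + eta) / (A0 + 2 * eta)).
  by rewrite divr_gt0 ?ltr_pdivrMr ?mul1r //=; lra.
exists h => //; split=> // dy dz y1 y0 z1 Ey Ez EA Ty Tz.
have Ay : mu * y1 <= A0 + eta.
  have T2 : mu * y1 <= mu * (Sy * h + y0) by apply: ler_wpM2l => //; lra.
  have T3 : 0 <= Sy * h by rewrite mulr_ge0 // ltW.
  by move: T2; rewrite mulrDr -EA; nra.
have Bz : A0 + 2 * eta <= z1 by lra.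
apply: le_trans Ay _.
rewrite mulrAC ler_pdivlMr //; apply: ler_wpM2l => //; lra.
Qed.

(** At the centre the right-hand side of normC_reversed_le is |reversed_mpoly
    P| itself, which is less than |P|; both sides of this strict inequality
    are continuous in the coefficients. The radius h is also small enough for
    the nonzero coefficients of P to stay nonzero. *)
Lemma reversed_local_bound N P r (t : X) : @admissible R d P -> degree_lt N P -> 0 < r < 1 ->
  exists2 c : R, 0 < c < 1 & exists2 h : R, 0 < h & forall Q, degree_lt N Q ->
    (forall m : index N, cabs (coefficients Q m - coefficients P m) < h) ->
    cabs (meval_row (reversed_mpoly Q) (radial_point r t)) <=
    c * cabs (meval_row Q (radial_point r t)).
Proof.
move=> aP PN r01; pose z i : R[i] := r%:C%C * expi (tnth t i).
have [r0 r1] := andP r01.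
have zr i : `|z i| = r%:C%C by rewrite normC_cabs cabsM cabs_expi mulr1 cabs_real gtr0_norm.
have z01 i : 0 < `|z i| < 1 by rewrite zr -[1]/((1 : R)%:C%C) !ltcR.
have z0 i : z i != 0 by have /andP[] := z01 i; rewrite normr_gt0.
pose y i := ((z i)^*)^-1.
have [mu mu0 muE] : exists2 mu : R, 0 <= mu &
    \prod_i `|z i| ^+ mpoly.fun_of_multinom (multidegree P) i = mu%:C%C.
  exists (cabs (\prod_i z i ^+ mpoly.fun_of_multinom (multidegree P) i)); first exact: cabs_ge0.
  by rewrite -normC_cabs normr_prod; apply: eq_bigr => i _; rewrite normrX.
pose x0 : index N -> R[i] := coefficients P.
have [A0 EA] : exists A0, A0 = mu * cabs (eval_coef x0 y) by exists (mu * cabs (eval_coef x0 y)).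
have [B0 EB] : exists B0, B0 = cabs (eval_coef x0 z) by exists (cabs (eval_coef x0 z)).
have AB : A0 < B0.
  have := reversed_radial_lt t aP r01; rewrite !meval_radial -/z EA EB.
  have E1 := normC_reversed P z0; rewrite muE in E1.
  by rewrite (cabs_normC E1) /x0 -!(meval_coef _ PN).
have A00 : 0 <= A0 by rewrite EA; exact: mulr_ge0 mu0 (cabs_ge0 _).
have [Sy Sy0 Hy] := @eval_coef_lipschitz N y; have [Sz Sz0 Hz] := @eval_coef_lipschitz N z.
have [k k0 Hk] : exists2 k : R, 0 < k & forall m, x0 m != 0 -> k <= cabs (x0 m).
  exists (\big[Order.min/1]_(m | x0 m != 0) cabs (x0 m)).
    by apply: lt_bigmin => // m xm; rewrite lt_neqAle cabs_ge0 andbT eq_sym cabs_eq0.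
  by move=> m xm; exact: bigmin_le_cond.
have [c c01 [h h0 [hk Hh]]] := gap_stability A00 AB mu0 Sy0 Sz0 k0.
exists c => //; exists h => // Q QN PQ.
have supp m : x0 m != 0 -> coefficients Q m != 0.
  move=> xm; apply: contraTneq (PQ m) => ->; rewrite sub0r cabsN -leNgt.
  by apply: le_trans hk _; exact: Hk.
pose x1 : index N -> R[i] := coefficients Q.
rewrite !meval_radial -/z.
have HA : cabs (mpoly.meval z (reversed_mpoly Q)) <= mu * cabs (eval_coef x1 y).
  have E1 := normC_reversed_le PN QN z01 supp; rewrite muE in E1.
  exact: cabs_le_normC E1.
have EQ : cabs (mpoly.meval z Q) = cabs (eval_coef x1 z) by rewrite (meval_coef _ QN).
rewrite EQ; apply: le_trans HA _.
have Ey := Hy x1 x0 h (ltW h0) PQ; have Ez := Hz x1 x0 h (ltW h0) PQ.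
apply: (Hh _ _ _ _ _ Ey Ez EA).
  by have := cabsD (eval_coef x1 y - eval_coef x0 y) (eval_coef x0 y); rewrite subrK.
by have := cabsD (eval_coef x0 z - eval_coef x1 z) (eval_coef x1 z); rewrite subrK EB cabsC.
Qed.

Lemma nbhs_coefficients N (x : {ptws index N -> C}) (h : R) : 0 < h ->
  \forall y \near x, forall m, cabs (y m - x m) < h.
Proof.
move=> h0; have FF : ProperFilter (nbhs x) by exact: nbhs_pfilter.
apply: (@filter_forall _ (index N) (fun m y => cabs (y m - x m) < h) (nbhs x)) => m.
have := @proj_continuous (index N) (fun=> C) m x.
move=> /(@cvgrPdist_lt _ _ _ (nbhs x) FF) H.
have : 0 < h%:C%C :> R[i] by rewrite ltcR.
move=> /H; apply: filterS => y; rewrite [X in X < _]normC_cabs ltcR cabsC.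
by [].
Qed.

(** The local bounds of reversed_local_bound, with constants c < 1, are made
    uniform by a covering argument in which c tends to 1. *)
Lemma compact_uniform_bound (K : set (mpoly.mpoly d R[i])) r (t : X) :
  K `<=` @admissible R d -> compact_family K -> 0 < r < 1 ->
  exists2 c : R, 0 <= c < 1 &
    forall P, K P -> cabs (rational_inner P (radial_point r t)) <= c.
Proof.
move=> hK [N [KN /compact_near_coveringP cK]] r01.
pose good (c : R) (x : {ptws index N -> C}) := forall Q, K Q ->
  (coefficients Q : index N -> C) = x ->
  cabs (meval_row (reversed_mpoly Q) (radial_point r t)) <= c * cabs (meval_row Q (radial_point r t)).
(* Goodness for all c' close to 1 on a neighbourhood of each coefficient vector. *)
have gx x : [set (coefficients P : {ptws index N -> C}) | P in K] x ->
    \forall y \near x & c \near (1 : R)^'-, good c y.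
  move=> [P KP <-].
  have [c /andP[c0 c1] [h h0 H]] := reversed_local_bound t (hK _ KP) (KN _ KP) r01.
  exists ([set y | forall m, cabs (y m - coefficients P m) < h], [set c' | c <= c' < 1]).
    split; first exact: nbhs_coefficients.
    apply/near_left1P; exists (1 - c); first by rewrite subr_gt0.
    by move=> r' /andP[r1 r2] /=; rewrite r2 andbT; lra.
  move=> [y c'] /= [Hy /andP[cc' _]] Q KQ QE.
  have := H Q (KN _ KQ); rewrite -QE in Hy => /(_ Hy) H'.
  by apply: le_trans H' _; apply: ler_wpM2r => //; exact: cabs_ge0.
have [h h0 Hh] := proj1 (near_left1P _) (cK R ((1 : R)^'-) good (at_left_proper_filter 1) gx).
have [c /andP[c0 c1] ch] : exists2 c : R, 0 <= c < 1 & 1 - h < c.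
  exists (Num.max 0 (1 - h / 2)); first by rewrite le_max lexx gt_max ltr01 /=; lra.
  by rewrite lt_max; apply/orP; right; lra.
exists c; first by rewrite c0.
move=> P KP; have := Hh c; rewrite ch c1 => /(_ isT (coefficients P)).
have KP' : [set (coefficients P : {ptws index N -> C}) | P in K] (coefficients P) by exists P.
move=> /(_ KP' P KP erefl) H; have lt := reversed_radial_lt t (hK _ KP) r01.
rewrite /rational_inner cabsM cabsV ler_pdivrMr; first exact: H.
by apply: le_lt_trans lt; exact: cabs_ge0.
Qed.

End compact_families.

(** At a point of the polydisk the factors are bounded by a constant c < 1, by
    compact_uniform_bound, so B n is at most c^n there. *)
Lemma inner_products_vanish {R : realType} (d : nat) (K : set (mpoly.mpoly d R[i]))
    (P : nat -> mpoly.mpoly d R[i]) (B : nat -> 'rV[R[i]^o]_d -> R[i]^o) r (t : d.-tuple R) :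
  K `<=` @admissible R d -> compact_family K -> (forall n, K (P n)) ->
  B 0%N = (fun=> 1) -> (forall n, B n.+1 = B n \* rational_inner (P n)) -> 0 < r < 1 ->
  (fun n => cabs (B n (radial_point r t))) @ \oo --> (0 : R).
Proof.
move=> hK hKc KP B0 BS r01; have [c /andP[c0 c1] Hc] := compact_uniform_bound t hK hKc r01.
have Bc n : cabs (B n (radial_point r t)) <= c ^+ n.
  elim: n => [|n IH]; first by rewrite B0 cabs1.
  by rewrite BS /= cabsM exprSr ler_pM ?cabs_ge0 // Hc.
apply: (@squeeze_cvgr _ _ _ _ (cst 0) (fun n => c ^+ n)).
- by apply: nearW => n; rewrite cabs_ge0 Bc.
- exact: cvg_cst.
- by apply: cvg_expr; rewrite ger0_norm.
Qed.

Unset Implicit Arguments.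
Set Strict Implicit.
Set Printing Implicit Defensive.

Theorem mainTheorem6 (R : realType) (d : nat) (hd : (1 <= d)%N)
    (K : set (mpoly.mpoly d R[i]))
    (hK : K `<=` @admissible R d) (hKc : compact_family K)
    (f : 'rV[R[i]^o]_d -> R[i]^o) (hf : hardy f)
    (P : nat -> mpoly.mpoly d R[i])
    (fs U B : nat -> 'rV[R[i]^o]_d -> R[i]^o)
    (hf0 : fs 0%N = f) (hB0 : B 0%N = (fun=> 1))
    (hP : forall n, argmin_projection K (fs n) (P n))
    (hU : forall n, is_projection
       (orthogonal_complement (hardy_multiples (rational_inner (P n)))) (fs n) (U n))
    (hfS : forall n,
       is_hardy_quotient (fs n \- U n) (rational_inner (P n)) (fs n.+1))
    (hBS : forall n, B n.+1 = B n \* rational_inner (P n)) :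
  [/\ forall n, hardy (U n \* B n),
      forall m n, m != n -> inner (U m \* B m) (U n \* B n) = 0,
      \bigcap_n hardy_multiples (B n) = [set (fun=> 0)] &
      hnorm (fun z => f z - \sum_(0 <= k < n) U k z * B k z) @[n --> \oo]
        --> (0 : R)].
Proof.
have aP n : admissible (P n) by apply: hK; have [] := hP n.
have iP n : inner_function (rational_inner (P n)) by exact: rational_inner_inner.
have hUn n : hardy (U n) by have [[]] := hU n.
have U_orth n h : hardy h -> inner (U n) (rational_inner (P n) \* h) = 0.
  by move=> hh; have [[_ H] _] := hU n; apply: H; exists h.
have hfn n : hardy (fs n.+1) by have [] := hfS n.
have fsS n : fs n \- U n = rational_inner (P n) \* fs n.+1 by have [] := hfS n.
have B_null r (t : d.-tuple R) : 0 < r < 1 ->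
    (fun n => cabs (B n (radial_point r t))) @ \oo --> (0 : R).
  by apply: inner_products_vanish hK hKc _ hB0 hBS => n; have [] := hP n.
split.
- by move=> n; apply: terms_hardy hB0 iP hUn hBS n.
- by move=> m n; apply: terms_orthogonal hB0 iP hUn U_orth hBS m n.
- exact: multiples_intersection hB0 iP hBS B_null.
- exact: remainder_cvg0 hf hf0 hB0 iP hUn U_orth hfn fsS hBS B_null.
Qed.
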